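(* Let $(w(t))_{t\ge0}$ be a Brownian motion on $\mathbb{H}P^n$ started at $0$, let $r(t)=\arctan|w(t)|$ and let $\mathfrak a(t)$ be its quaternionic stochastic area process. For $\lambda\in[0,\infty)^3$, $r\in[0,\pi/2)$ and $t>0$, $$\mathbb{E}\left(e^{i\lambda\cdot\mathfrak a(t)}\mid r(t)=r\right)=\frac{e^{-2n\mu t}}{(\cos r)^{\mu}}\,\frac{q_t^{2n-1,\mu+1}(0,r)}{q_t^{2n-1,1}(0,r)},$$ where $\mu=\sqrt{|\lambda|^2+1}-1$.
   Context: $n\ge1$. $\mathbb{H}$ is the field of quaternions with units $I,J,K$; imaginary quaternions $xI+yJ+zK$ are identified with $(x,y,z)\in\mathbb{R}^3$. The quaternionic projective space $\mathbb{H}P^n$ is described by inhomogeneous coordinates $w=(w_1,\dots,w_n)\in\mathbb{H}^n$ (valid off a set which Brownian motion started at $0$ almost surely never hits), in which its Riemannian metric is $\frac{\sum_j|dw_j|^2}{1+|w|^2}-\frac{|\sum_j dw_j\overline{w_j}|^2}{(1+|w|^2)^2}$; $0$ is the point $w=0$. Brownian motion has generator $\frac12\Delta_{\mathbb{H}P^n}$ (half the Laplace–Beltrami operator). Its quaternionic stochastic area process is $$\mathfrak a(t)=\frac12\sum_{j=1}^n\int_0^t\frac{dw_j(s)\overline{w_j}(s)-w_j(s)d\overline{w_j}(s)}{1+|w(s)|^2}\in\mathbb{R}^3$$ (Stratonovich, equivalently Itô, integrals). For $\alpha,\beta>-1$, $q_t^{\alpha,\beta}(r_0,r)$ denotes the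 transition density with respect to Lebesgue measure $dr$ on $[0,\pi/2]$ of the diffusion (circular Jacobi process) with generator $$\mathcal{L}^{\alpha,\beta}=\frac12\frac{\partial^2}{\partial r^2}+\left(\left(\alpha+\tfrac12\right)\cot r-\left(\beta+\tfrac12\right)\tan r\right)\frac{\partial}{\partial r}.$$ At $r=0$ the quotient of densities is understood as a limit. $|\lambda|$ is the Euclidean norm. *)

(* Defs.v *)
From HB Require Import structures.
From mathcomp Require Import all_boot all_order all_algebra.
From mathcomp Require Import all_classical all_reals all_analysis.
From mathcomp Require Export complex.

Set Implicit Arguments.
Unset Strict Implicit.
Unset Printing Implicit Defensive.

Import Order.TTheory GRing.Theory Num.Theory.
Import numFieldNormedType.Exports.

Local Open Scope classical_set_scope.
Local Open Scope ring_scope.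

Section Euclidean.
Context {R : realType}.

(* The quaternion a + bI + cJ + dK is the row vector (a, b, c, d). *)
Definition quat (a b c d : R) : 'rV[R]_4 :=
  \row_(i < 4) [:: a; b; c; d]`_i.

Definition qmul (x y : 'rV[R]_4) : 'rV[R]_4 :=
  quat (x 0 0 * y 0 0 - x 0 1 * y 0 1 - x 0 2 * y 0 2 - x 0 3 * y 0 3)
       (x 0 0 * y 0 1 + x 0 1 * y 0 0 + x 0 2 * y 0 3 - x 0 3 * y 0 2)
       (x 0 0 * y 0 2 - x 0 1 * y 0 3 + x 0 2 * y 0 0 + x 0 3 * y 0 1)
       (x 0 0 * y 0 3 + x 0 1 * y 0 2 - x 0 2 * y 0 1 + x 0 3 * y 0 0).

Definition qconj (x : 'rV[R]_4) : 'rV[R]_4 :=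
  quat (x 0 0) (- x 0 1) (- x 0 2) (- x 0 3).

Definition imquat (v : 'rV[R]_3) : 'rV[R]_4 :=
  quat 0 (v 0 0) (v 0 1) (v 0 2).

(* Not the library's norm on matrices, which is the supremum norm. *)
Definition sqnorm m k (x : 'M[R]_(m, k)) : R := \sum_i \sum_j x i j ^+ 2.

Definition enorm m k (x : 'M[R]_(m, k)) : R := Num.sqrt (sqnorm x).

Definition expi (theta : R) : R[i] := (cos theta +i* sin theta)%C.

Definition dot3 (x y : 'rV[R]_3) : R := \sum_i x 0 i * y 0 i.

End Euclidean.

(* H^n is 'M[R]_(n, 4), whose j-th row is the quaternion w_j; its 4n real     *)
(* coordinates are numbered by 'I_(n * 4) through mxvec.                      *)
Section ProjectiveSpace.
Context {R : realType} {n : nat}.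
Implicit Types (w u v x : 'M[R]_(n, 4)) (f : 'M[R]_(n, 4) -> R).

Definition hbasis (k : 'I_(n * 4)) : 'M[R]_(n, 4) := vec_mx (delta_mx 0 k).

Definition partial (k : 'I_(n * 4)) f : 'M[R]_(n, 4) -> R :=
  fun x => 'D_(hbasis k) f x.

(* Infinitely differentiable: all iterated partial derivatives exist and are  *)
(* continuous.                                                                *)
Definition smooth f : Prop :=
  forall s : seq 'I_(n * 4),
    (forall x k, derivable (foldr partial f s) x (hbasis k)) /\
    continuous (foldr partial f s).

Definition compactly_supported f : Prop :=
  exists M : R, forall x, M < enorm x -> f x = 0.

Definition HP_quadratic w u : R :=
  sqnorm u / (1 + sqnorm w)
  - sqnorm (\sum_j qmul (row j u) (qconj (row j w))) / (1 + sqnorm w) ^+ 2.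

(* The metric tensor is the polarization of the quadratic form. *)
Definition HP_inner w u v : R :=
  (HP_quadratic w (u + v) - HP_quadratic w u - HP_quadratic w v) / 2.

Definition HP_metric w : 'M[R]_(n * 4) :=
  \matrix_(k, l) HP_inner w (hbasis k) (hbasis l).

Definition laplace_beltrami (G : 'M[R]_(n, 4) -> 'M[R]_(n * 4)) f x : R :=
  (Num.sqrt (\det (G x)))^-1 *
  \sum_k partial k (fun y =>
    Num.sqrt (\det (G y)) * \sum_l invmx (G y) k l * partial l f y) x.

Definition HP_radius w : R := atan (enorm w).

End ProjectiveSpace.

Section Processes.
Context {R : realType} {d : measure_display} {Omega : measurableType d}.
Variable P : probability Omega R.
Implicit Types (F : R -> set (set Omega)) (M : R -> Omega -> R).

Definition filtration F : Prop :=
  [/\ forall t, 0 <= t -> sigma_algebra setT (F t),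
      forall t, 0 <= t -> F t `<=` measurable &
      forall s t, 0 <= s -> s <= t -> F s `<=` F t].

Definition adapted F M : Prop :=
  forall t, 0 <= t -> forall B : set R, measurable B -> F t (M t @^-1` B).

(* The last clause says that E[M_t | F_s] = M_s. *)
Definition martingale F M : Prop :=
  [/\ adapted F M,
      forall t, 0 <= t -> P.-integrable setT (EFin \o M t) &
      forall s t, 0 <= s -> s <= t -> forall A, F s A ->
        (\int[P]_(omega in A) (M t omega)%:E =
         \int[P]_(omega in A) (M s omega)%:E)%E].

(* Brownian motion started at the point 0, as the continuous solution of the  *)
(* martingale problem for half the Laplace-Beltrami operator. It is read in   *)
(* the chart H^n, so that it is only required to be a continuous path in the  *)
(* chart almost surely.                                                       *)
Definition HP_brownian n F (w : R -> Omega -> 'M[R]_(n, 4)) : Prop :=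
  [/\ filtration F,
      forall i j, adapted F (fun t omega => w t omega i j),
      {ae P, forall omega, w 0 omega = 0 /\
         {within `[0, +oo[, continuous (fun t => w t omega)}} &
      forall f : 'M[R]_(n, 4) -> R, smooth f -> compactly_supported f ->
        martingale F (fun t omega => f (w t omega) -
          \int[lebesgue_measure]_(s in `[0, t])
             (2^-1 * laplace_beltrami HP_metric f (w s omega)))].

(* Stratonovich sum of                                                        *)
(*   1/2 sum_j (dw_j conj(w_j) - w_j dconj(w_j)) / (1 + |w|^2)                *)
(* along the path w and the partition p of [0, t]: each integrand is replaced *)
(* by the mean of its values at the two ends of the time step.                *)
Definition area_sum n (w : R -> 'M[R]_(n, 4)) (t : R) (p : seq R) : 'rV[R]_4 :=
  let time k := nth t (0 :: p) k in
  let z j k := row j (w (time k)) in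
  let c j k := (1 + sqnorm (w (time k)))^-1 *: z j k in
  let mean j k := 2^-1 *: (c j k + c j k.+1) in
  let dz j k := z j k.+1 - z j k in
  2^-1 *: \sum_(j < n) \sum_(0 <= k < size p)
    (qmul (dz j k) (qconj (mean j k)) - qmul (mean j k) (qconj (dz j k))).

(* Stratonovich integrals are limits in probability of the Stratonovich sums  *)
(* when the mesh of the partition tends to 0.                                 *)
Definition HP_area n (w : R -> Omega -> 'M[R]_(n, 4))
    (a : R -> Omega -> 'rV[R]_3) : Prop :=
  forall t, 0 <= t ->
    (forall i, measurable_fun setT (fun omega => a t omega 0 i)) /\
    forall eps eta : R, 0 < eps -> 0 < eta ->
      exists2 delta : R, 0 < delta &
        forall p : seq R, itv_partition 0 t p ->
          (forall k, (k < size p)%N ->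
             nth t (0 :: p) k.+1 - nth t (0 :: p) k < delta) ->
          (P [set omega |
                (eps < enorm (area_sum (w ^~ omega) t p - imquat (a t omega)))%R]
             <= eta%:E)%E.

(* g : D -> R is a version of y |-> E(X | Y = y), where Y takes its values in *)
(* D: g(Y) is a version of E(X | sigma(Y)).                                   *)
Definition cond_expectation (X Y : Omega -> R) (D : set R) (g : R -> R) :
    Prop :=
  [/\ range Y `<=` D, measurable_fun D g,
      P.-integrable setT (EFin \o (g \o Y)) &
      forall B : set R, measurable B ->
        (\int[P]_(omega in Y @^-1` B) (X omega)%:E =
         \int[P]_(omega in Y @^-1` B) (g (Y omega))%:E)%E].

Definition ccond_expectation (X : Omega -> R[i]) (Y : Omega -> R) (D : set R)
    (g : R -> R[i]) : Prop :=
  cond_expectation (fun omega => complex.Re (X omega)) Y D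
                   (fun y => complex.Re (g y)) /\
  cond_expectation (fun omega => complex.Im (X omega)) Y D
                   (fun y => complex.Im (g y)).

End Processes.

Section CircularJacobi.
Context {R : realType}.
Implicit Types (f : R -> R) (q : R -> R -> R -> R).

Definition jacobi_generator (alpha beta : R) f (r : R) : R :=
  2^-1 * derive1n 2 f r +
  ((alpha + 2^-1) * (cos r / sin r) - (beta + 2^-1) * tan r) * derive1 f r.

(* C^2 functions satisfying the Neumann condition at 0 and pi/2. For alpha    *)
(* (or beta) in ]-1, 0[ the generator alone does not determine the behaviour  *)
(* at 0 (or pi/2): as usual, the process is reflected there. For nonnegative  *)
(* parameters the endpoints are entrance boundaries and no choice is made.    *)
Definition neumann f : Prop :=
  [/\ forall r, derivable f r 1, forall r, derivable (derive1 f) r 1,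
      continuous (derive1n 2 f), derive1 f 0 = 0 & derive1 f (pi / 2) = 0].

Definition kernel_op q (t : R) f (x : R) : R :=
  \int[lebesgue_measure]_(y in `[0, pi / 2]) (q t x y * f y).

(* q t r0 r is the transition density of the diffusion: the density with      *)
(* respect to Lebesgue measure on [0, pi/2], in its version continuous in r   *)
(* inside the interval, of a Feller semigroup whose infinitesimal generator   *)
(* is given by jacobi_generator.                                              *)
Record jacobi_density (alpha beta : R) q : Prop := {
  jd_measurable : forall t x : R, 0 < t -> x \in `[0, pi / 2] ->
    measurable_fun `[0, pi / 2] (q t x);
  jd_ge0 : forall t x y : R, 0 < t -> x \in `[0, pi / 2] ->
    y \in `[0, pi / 2] -> 0 <= q t x y;
  jd_mass1 : forall t x : R, 0 < t -> x \in `[0, pi / 2] ->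
    (\int[lebesgue_measure]_(y in `[0%R, (pi / 2)%R]) (q t x y)%:E = 1)%E;
  jd_continuous : forall t x : R, 0 < t -> x \in `[0, pi / 2] ->
    {in `]0, pi / 2[, continuous (q t x)};
  jd_feller : forall (t : R) f, 0 < t ->
    {within `[0, pi / 2], continuous f} ->
    {within `[0, pi / 2], continuous (kernel_op q t f)};
  jd_semigroup : forall (s t : R) f (x : R), 0 < s -> 0 < t ->
    x \in `[0, pi / 2] -> {within `[0, pi / 2], continuous f} ->
    kernel_op q (s + t) f x = kernel_op q s (kernel_op q t f) x;
  jd_generator : forall f, neumann f -> forall eps : R, 0 < eps ->
    exists2 delta : R, 0 < delta &
      forall t x : R, 0 < t -> t < delta -> x \in `]0, pi / 2[ ->
      `|(kernel_op q t f x - f x) / t - jacobi_generator alpha beta f x| < eps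
}.

(* The function h on ]0, pi/2[, extended at 0 by its limit. *)
Definition extend0 (h : R -> R) (r : R) : R :=
  if r == 0 then lim (h x @[x --> 0^'+]) else h r.

End CircularJacobi.

(* Main.v *)
From HB Require Import structures.
Require Import Defs.
From mathcomp Require Import all_boot all_order all_algebra.
From mathcomp Require Import all_classical all_reals all_analysis.
From mathcomp Require Import measurable_realfun ring lra.

Set Implicit Arguments.
Unset Strict Implicit.
Unset Printing Implicit Defensive.
Import Order.TTheory GRing.Theory Num.Theory.
Import numFieldNormedType.Exports.
Local Open Scope classical_set_scope.
Local Open Scope ring_scope.

Section DirectionalChainRule.
Context {R : realType} {V : normedModType R}.

Lemma is_derive_line (f : V -> R) (x v : V) (df : R) :
  is_derive x v f df <-> is_derive (0 : R) 1 (fun h : R => f (h *: v + x)) df.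
Proof.
have E : (fun h : R => h^-1 *: (((fun h : R => f (h *: v + x)) \o shift 0)
      (h *: (1 : R)) - f ((0 : R) *: v + x))) =
    (fun h : R => h^-1 *: ((f \o shift x) (h *: v) - f x)).
  by apply/funext => h /=; rewrite addr0 scale0r add0r [h *: 1]mulr1.
split=> -[d1 d2]; apply: DeriveDef; rewrite /derivable /derive ?E //;
  by move: d1 d2; rewrite /derivable /derive /= E.
Qed.

Lemma is_derive_comp_dir (g : R -> R) (f : V -> R) (x v : V) (dg df : R) :
  is_derive (f x) 1 g dg -> is_derive x v f df ->
  is_derive x v (g \o f) (dg * df).
Proof.
move=> hg /is_derive_line hf; apply/is_derive_line.
have hg' : is_derive (f ((0 : R) *: v + x)) 1 g dg by rewrite scale0r add0r.
have := @is_derive1_comp _ g (fun h => f (h *: v + x)) 0 dg df hg' hf.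
by [].
Qed.

End DirectionalChainRule.

Section SmoothClasses.
Context {R : realType}.

Fixpoint smooth_on (D : set R) (m : nat) (g : R -> R) : Prop :=
  if m is m'.+1 then
    exists g' : R -> R, (forall x, D x -> is_derive x 1 g (g' x)) /\ smooth_on D m' g'
  else forall x, D x -> {for x, continuous g}.

Lemma smooth_on_continuous D m g x :
  smooth_on D m g -> D x -> {for x, continuous g}.
Proof.
case: m => [|m] /=; first by move=> h /h.
move=> [g' [h _]] /h [d _]; apply: differentiable_continuous.
by apply/derivable1_diffP.
Qed.

Context {S : topologicalType} {V : normedModType R}.

(* Continuity is required jointly with the parameter s : S. *)
Fixpoint psmooth (m : nat) (f : S -> V -> R) : Prop :=
  continuous (fun p : S * V => f p.1 p.2) /\
  if m is m'.+1 then
    forall v, exists f', (forall s y, is_derive y v (f s) (f' s y)) /\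
      psmooth m' f'
  else True.

Lemma psmooth_continuous m f :
  psmooth m f -> continuous (fun p : S * V => f p.1 p.2).
Proof. by case: m => [|m] []. Qed.

Lemma psmoothS m f : psmooth m.+1 f -> psmooth m f.
Proof.
elim: m f => [|m IH] f [fc h]; first by split.
split=> // v; have [f' [h1 h2]] := h v; exists f'; split=> //; exact: IH.
Qed.

Lemma psmooth_param m (a : S -> R) :
  continuous a -> psmooth m (fun s _ => a s).
Proof.
have ac : continuous a -> continuous (fun p : S * V => a p.1).
  by move=> h [s y]; apply: continuous_comp; [exact: cvg_fst|exact: h].
elim: m a ac => [|m IH] a ac ca; first by split => //; exact: ac.
split; first exact: ac.
move=> v; exists (fun _ _ => 0); split.
  by move=> s y; exact: is_derive_cst.
apply: IH; last by move=> s; exact: cst_continuous.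
by move=> _ s; exact: cst_continuous.
Qed.

Lemma psmooth_cst m (c : R) : psmooth m (fun _ _ => c).
Proof. by apply: psmooth_param => s; exact: cst_continuous. Qed.

Lemma psmoothD m f g : psmooth m f -> psmooth m g ->
  psmooth m (fun s y => f s y + g s y).
Proof.
elim: m f g => [|m IH] f g [fc hf] [gc hg].
  by split=> // p; apply: continuousD; [exact: fc|exact: gc].
split; first by move=> p; apply: continuousD; [exact: fc|exact: gc].
move=> v; have [f' [f1 f2]] := hf v; have [g' [g1 g2]] := hg v.
exists (fun s y => f' s y + g' s y); split; last exact: IH.
by move=> s y; apply: is_deriveD.
Qed.

Lemma psmoothM m f g : psmooth m f -> psmooth m g ->
  psmooth m (fun s y => f s y * g s y).
Proof.
elim: m f g => [|m IH] f g hf0 hg0; have [fc hf] := hf0; have [gc hg] := hg0.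
  by split=> // p; apply: continuousM; [exact: fc|exact: gc].
split; first by move=> p; apply: continuousM; [exact: fc|exact: gc].
move=> v; have [f' [f1 f2]] := hf v; have [g' [g1 g2]] := hg v.
exists (fun s y => f s y * g' s y + g s y * f' s y); split.
  move=> s y; have := is_deriveM (f1 s y) (g1 s y).
  by rewrite /GRing.scale.
by apply: psmoothD; apply: IH => //; exact: psmoothS.
Qed.

Lemma psmooth_sum m (I : Type) (r : seq I) (f : I -> S -> V -> R) :
  (forall i, psmooth m (f i)) -> psmooth m (fun s y => \sum_(i <- r) f i s y).
Proof.
move=> h; elim: r => [|i r IH].
  rewrite (_ : (fun _ _ => _) = (fun _ _ => 0)); first exact: psmooth_cst.
  by apply/funext => s; apply/funext => y; rewrite big_nil.
rewrite (_ : (fun _ _ => _) = (fun s y => f i s y + \sum_(i <- r) f i s y)).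
  exact: psmoothD.
by apply/funext => s; apply/funext => y; rewrite big_cons.
Qed.

Lemma psmooth_comp (D : set R) m g f : smooth_on D m g -> psmooth m f ->
  (forall s y, D (f s y)) -> psmooth m (fun s y => g (f s y)).
Proof.
move=> hg hf hD; elim: m g hg f hf hD => [|m IH] g hg f hf hD.
  split=> // p; apply: (@continuous_comp _ _ _ (fun p => f p.1 p.2) g).
    exact: psmooth_continuous hf p.
  exact: (@smooth_on_continuous D 0 g _ hg (hD _ _)).
split.
  move=> p; apply: (@continuous_comp _ _ _ (fun p => f p.1 p.2) g).
    exact: psmooth_continuous hf p.
  exact: (@smooth_on_continuous D m.+1 g _ hg (hD _ _)).
case: hg => g' [g1 g2]; have [_ hf'] := hf.
move=> v; have [f' [f1 f2]] := hf' v.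
exists (fun s y => g' (f s y) * f' s y); split.
  by move=> s y; apply: is_derive_comp_dir (f1 s y); exact: g1.
by apply: psmoothM f2; exact: IH (psmoothS hf) hD.
Qed.

Lemma psmooth_linear m (l : V -> R) :
  continuous l -> (forall y v, is_derive y v l (l v)) ->
  psmooth m (fun _ y => l y).
Proof.
move=> lc ld; have lc' : continuous (fun p : S * V => l p.2).
  by move=> p; apply: continuous_comp; [exact: cvg_snd|exact: lc].
case: m => [|m]; first by split.
split=> // v; exists (fun _ _ => l v); split => //.
exact: psmooth_cst.
Qed.

End SmoothClasses.

Section SmoothFunctions.
Context {R : realType}.

Lemma smooth_on_cst (D : set R) m (c : R) : smooth_on D m (fun _ => c).
Proof.
elim: m c => [|m IH] c; first by move=> x _; exact: cst_continuous.
by exists (fun _ => 0); split => // x _; exact: is_derive_cst.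
Qed.

Lemma smooth_onD (D : set R) m f g : smooth_on D m f -> smooth_on D m g ->
  smooth_on D m (fun x => f x + g x).
Proof.
elim: m f g => [|m IH] f g.
  by move=> hf hg x Dx; apply: continuousD; [exact: hf|exact: hg].
move=> [f' [f1 f2]] [g' [g1 g2]]; exists (fun x => f' x + g' x).
split; last exact: IH.
by move=> x Dx; apply: is_deriveD; [exact: f1|exact: g1].
Qed.

Lemma smooth_onZ (D : set R) m (c : R) f : smooth_on D m f ->
  smooth_on D m (fun x => c * f x).
Proof.
elim: m f => [|m IH] f.
  move=> hf x Dx; apply: (@continuousM _ _ (fun=> c) f) => //; last exact: hf.
  exact: cst_continuous.
move=> [f' [f1 f2]]; exists (fun x => c * f' x).
split; last exact: IH.
by move=> x Dx; apply: (@is_deriveZ _ _ _ f c x 1 _ (f1 x Dx)).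
Qed.

Lemma smooth_on_cos_sin m :
  smooth_on setT m (@cos R) /\ smooth_on setT m (@sin R).
Proof.
elim: m => [|m [IHc IHs]].
  by split=> x _; [exact: continuous_cos|exact: continuous_sin].
split.
  exists (fun x => -1 * sin x); split; last exact: smooth_onZ.
  by move=> x _; rewrite mulN1r; exact: is_derive_cos.
by exists cos; split => // x _; exact: is_derive_sin.
Qed.

Lemma smooth_on_powR m (a : R) : smooth_on [set x : R | 0 < x] m (fun x => x `^ a).
Proof.
elim: m a => [|m IH] a.
  move=> x /= x0; apply: differentiable_continuous; apply/derivable1_diffP.
  by apply: derivable_powR; rewrite in_itv/= x0.
exists (fun x => a * x `^ (a - 1)); split; last exact: smooth_onZ.
move=> x /= x0; exact: is_derive1_powR.
Qed.

End SmoothFunctions.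

Lemma sum_ord4 (V : nmodType) (F : 'I_4 -> V) :
  \sum_(j < 4) F j = F 0 + F 1 + F 2 + F 3.
Proof.
rewrite !big_ord_recl big_ord0 addr0 !addrA.
by congr (_ + _ + _ + _); congr F; apply: val_inj.
Qed.

Lemma sum_ord3 (V : nmodType) (F : 'I_3 -> V) :
  \sum_(j < 3) F j = F 0 + F 1 + F 2.
Proof.
rewrite !big_ord_recl big_ord0 addr0 !addrA.
by congr (_ + _ + _); congr F; apply: val_inj.
Qed.

Lemma ord4P (P : 'I_4 -> Prop) : P 0 -> P 1 -> P 2 -> P 3 -> forall q, P q.
Proof.
move=> p0 p1 p2 p3 [[|[|[|[|//]]]] h].
- by rewrite (_ : Ordinal h = 0) //; apply: val_inj.
- by rewrite (_ : Ordinal h = 1) //; apply: val_inj.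
- by rewrite (_ : Ordinal h = 2) //; apply: val_inj.
- by rewrite (_ : Ordinal h = 3) //; apply: val_inj.
Qed.

(* det (1 - A B) = det (1 - B A), from two block factorisations. *)
Lemma det_1_sub_mulmx (R : comNzRingType) m k (A : 'M[R]_(m, k))
    (B : 'M[R]_(k, m)) : \det (1%:M - A *m B) = \det (1%:M - B *m A).
Proof.
have E1 : block_mx (1%:M : 'M[R]_m) A B (1%:M : 'M[R]_k) *m
    block_mx 1%:M 0 (- B) 1%:M = block_mx (1%:M - A *m B) A 0 1%:M.
  rewrite mulmx_block !mul1mx !mulmx1 !mulmx0 !mulmxN !add0r.
  by rewrite subrr.
have E2 : block_mx (1%:M : 'M[R]_m) 0 (- B) 1%:M *m block_mx (1%:M : 'M[R]_m) A B
    (1%:M : 'M[R]_k) = block_mx 1%:M A 0 (1%:M - B *m A).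
  rewrite mulmx_block !mul1mx !mul0mx !addr0 !mulmx1 !mulNmx addNr.
  by rewrite addrC.
have := congr1 determinant E1; have := congr1 determinant E2.
rewrite !det_mulmx !det_lblock !det_ublock !det1 !mul1r !mulr1 => -> //.
Qed.

Section QuaternionicCoordinates.
Context {R : realType} {n : nat}.
Implicit Types (w u v y : 'M[R]_(n, 4)) (q : 'I_4).

Definition ip m k (u v : 'M[R]_(m, k)) : R := \sum_i \sum_j u i j * v i j.

(* The vector (e_q w_1, ..., e_q w_n), where e_q is the q-th of 1, I, J, K. *)
Definition lunit q w : 'M[R]_(n, 4) :=
  \matrix_(i, j) (nth [::] [:: [:: w i 0; w i 1; w i 2; w i 3];
    [:: - w i 1; w i 0; - w i 3; w i 2];
    [:: - w i 2; w i 3; w i 0; - w i 1];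
    [:: - w i 3; - w i 2; w i 1; w i 0]] q)`_j.

Lemma ord4_val : ((0 : 'I_4) = 0 :> nat) * ((1 : 'I_4) = 1 :> nat) *
  ((2 : 'I_4) = 2 :> nat) * ((3 : 'I_4) = 3 :> nat).
Proof. by []. Qed.

Lemma sqnormE m k (x : 'M[R]_(m, k)) : sqnorm x = ip x x.
Proof. by apply: eq_bigr => i _; apply: eq_bigr => j _; rewrite expr2. Qed.

Lemma ip_linear m k (x : 'M[R]_(m, k)) :
  linear (ip x : 'M[R]_(m, k) -> R^o).
Proof.
move=> a b c; rewrite /ip scaler_sumr -big_split; apply: eq_bigr => i _ /=.
rewrite scaler_sumr -big_split; apply: eq_bigr => j _ /=.
by rewrite !mxE /GRing.scale/=; ring.
Qed.
HB.instance Definition _ m k (x : 'M[R]_(m, k)) :=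
  GRing.isLinear.Build R 'M[R]_(m, k) R^o _ _ (ip_linear x).

Lemma ipC m k (x y : 'M[R]_(m, k)) : ip x y = ip y x.
Proof. by apply: eq_bigr => i _; apply: eq_bigr => j _; rewrite mulrC. Qed.

Lemma ipDr m k (x y z : 'M[R]_(m, k)) : ip x (y + z) = ip x y + ip x z.
Proof. exact: (linearD (ip x)). Qed.

Lemma ipDl m k (x y z : 'M[R]_(m, k)) : ip (y + z) x = ip y x + ip z x.
Proof. by rewrite ipC ipDr !(ipC x). Qed.

Lemma ipZr m k a (x y : 'M[R]_(m, k)) : ip x (a *: y) = a * ip x y.
Proof. by have := ip_linear x a y 0; rewrite addr0 (raddf0 (ip x)) addr0. Qed.

Lemma ipZl m k a (x y : 'M[R]_(m, k)) : ip (a *: x) y = a * ip x y.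
Proof. by rewrite ipC ipZr ipC. Qed.

Lemma lunit_linear q : linear (lunit q).
Proof.
move=> a u v; apply/matrixP => i j; rewrite !mxE.
by elim/ord4P: q; elim/ord4P: j; rewrite /= ?mxE ?opprD ?mulrN.
Qed.
HB.instance Definition _ q :=
  GRing.isLinear.Build R 'M[R]_(n, 4) 'M[R]_(n, 4) _ _ (lunit_linear q).

Lemma lunit0 w : lunit 0 w = w.
Proof. by apply/matrixP => i j; rewrite mxE; elim/ord4P: j. Qed.

Lemma ip_lunit q p w : ip (lunit q w) (lunit p w) = sqnorm w *+ (q == p).
Proof.
rewrite /ip /sqnorm -sumrMnl; apply: eq_bigr => i _.
rewrite !sum_ord4 !mxE.
by elim/ord4P: q; elim/ord4P: p; rewrite /=; ring.
Qed.

Lemma lunitK q w : lunit q (lunit q w) = if q == 0 then w else - w.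
Proof.
apply/matrixP => i j; rewrite !mxE.
by elim/ord4P: q; elim/ord4P: j; rewrite /= ?mxE ?opprK.
Qed.

Lemma sum_conj_coord u w (q : 'I_4) :
  (\sum_j qmul (row j u) (qconj (row j w))) 0 q = ip u (lunit q w).
Proof.
rewrite summxE; apply: eq_bigr => i _; rewrite sum_ord4 !mxE.
by elim/ord4P: q; rewrite /= ?mxE /=; ring.
Qed.

Lemma HP_innerE w u v : HP_inner w u v = ip u v / (1 + sqnorm w) -
  (\sum_q ip u (lunit q w) * ip v (lunit q w)) / (1 + sqnorm w) ^+ 2.
Proof.
have E x : sqnorm (\sum_j qmul (row j x) (qconj (row j w))) =
    \sum_q ip x (lunit q w) ^+ 2.
  by rewrite /sqnorm big_ord1; apply: eq_bigr => q _; rewrite sum_conj_coord.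
rewrite /HP_inner /HP_quadratic !E !sqnormE !ipDl !ipDr (ipC v u).
rewrite !sum_ord4 !ipDl.
have h : (2 : R) != 0 by [].
by field; rewrite ?h//= gt_eqF// ltr_pwDl// -sqnormE; do 2!apply: sumr_ge0 => ? _; rewrite sqr_ge0.
Qed.

Lemma sqnorm_ge0 m k (x : 'M[R]_(m, k)) : 0 <= sqnorm x.
Proof. by do 2!apply: sumr_ge0 => ? _; rewrite sqr_ge0. Qed.

Lemma sqnorm1_gt0 m k (x : 'M[R]_(m, k)) : 0 < 1 + sqnorm x.
Proof. by rewrite ltr_pwDl// sqnorm_ge0. Qed.

Lemma sum_mxvec_index (V : nmodType) (F : 'I_(n * 4) -> V) :
  \sum_k F k = \sum_i \sum_j F (mxvec_index i j).
Proof.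
rewrite pair_big /=.
rewrite (reindex (uncurry (@mxvec_index n 4))) /=.
  by apply: eq_bigr => -[].
exact: (curry_mxvec_bij).
Qed.

Lemma ip_mxvec u v : ip u v = \sum_k mxvec u 0 k * mxvec v 0 k.
Proof.
rewrite sum_mxvec_index; apply: eq_bigr => i _; apply: eq_bigr => j _.
by rewrite !mxvecE.
Qed.

Lemma mxvec_hbasis k l : mxvec (hbasis k : 'M[R]_(n, 4)) 0 l = (k == l)%:R.
Proof. by rewrite /hbasis vec_mxK mxE eqxx eq_sym. Qed.

Lemma ip_hbasis k u : ip (hbasis k) u = mxvec u 0 k.
Proof.
rewrite ip_mxvec (bigD1 k)//= mxvec_hbasis eqxx mul1r big1 ?addr0// => l lk.
by rewrite mxvec_hbasis eq_sym (negbTE lk) mul0r.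
Qed.

Lemma sum_hbasis u : \sum_k mxvec u 0 k *: hbasis k = u.
Proof.
apply: (can_inj mxvecK); apply/rowP => l; rewrite linear_sum summxE.
rewrite (bigD1 l)//= linearZ mxE mxvec_hbasis eqxx mulr1 big1 ?addr0// => k kl.
by rewrite linearZ mxE mxvec_hbasis (negbTE kl) mulr0.
Qed.

Definition lunit_mx w : 'M[R]_(n * 4, 4) := \matrix_(k, q) mxvec (lunit q w) 0 k.

Lemma HP_metricE w : HP_metric w =
  (1 + sqnorm w)^-1 *: (1%:M - ((1 + sqnorm w)^-1 *: lunit_mx w) *m (lunit_mx w)^T).
Proof.
apply/matrixP => k l; rewrite !mxE HP_innerE ip_hbasis mxvec_hbasis eq_sym.
rewrite mulrBr; congr (_ - _); first by rewrite mulrC.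
rewrite mulr_suml mulr_sumr; apply: eq_bigr => q _.
by rewrite !ip_hbasis !mxE; field; rewrite gt_eqF// sqnorm1_gt0.
Qed.

Lemma lunit_mxTM w : (lunit_mx w)^T *m lunit_mx w = (sqnorm w)%:M.
Proof.
apply/matrixP => q p; rewrite !mxE -ip_lunit ip_mxvec.
by apply: eq_bigr => k _; rewrite !mxE.
Qed.

Lemma HP_metric_det w : \det (HP_metric w) = ((1 + sqnorm w)^-1) ^+ (n * 4 + 4).
Proof.
have s1 := sqnorm1_gt0 w.
rewrite HP_metricE detZ exprD det_1_sub_mulmx; congr (_ * _).
rewrite -scalemxAr lunit_mxTM scale_scalar_mx -raddfB /= det_scalar; congr (_ ^+ _).
by field; rewrite gt_eqF.
Qed.

Lemma HP_metric_inv w : invmx (HP_metric w) =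
  (1 + sqnorm w) *: (1%:M + lunit_mx w *m (lunit_mx w)^T).
Proof.
have s1 : 1 + sqnorm w != 0 by rewrite gt_eqF// sqnorm1_gt0.
have E : HP_metric w *m
    ((1 + sqnorm w) *: (1%:M + lunit_mx w *m (lunit_mx w)^T)) = 1%:M.
  rewrite HP_metricE; set N := 1%:M - _.
  rewrite -scalemxAl -scalemxAr scalerA mulVf// scale1r {}/N.
  set M := lunit_mx w *m (lunit_mx w)^T.
  have MM : M *m M = sqnorm w *: M.
    rewrite /M mulmxA -(mulmxA (lunit_mx w)) lunit_mxTM -scalemx1.
    by rewrite -scalemxAr mulmx1 -scalemxAl.
  rewrite -scalemxAl -/M mulmxDr mulmx1 mulmxBl mul1mx -scalemxAl MM scalerA.
  by apply/matrixP => i j; move: M {MM} => M; rewrite !mxE; field.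
have [Gu _] := mulmx1_unit E.
have := congr1 (mulmx (invmx (HP_metric w))) E.
by rewrite mulmxA mulVmx// mul1mx mulmx1 => ->.
Qed.

End QuaternionicCoordinates.

Section DerivativeRules.
Context {R : realType} {V : normedModType R}.
Implicit Types (f g : V -> R) (x v : V).

Lemma is_derive_val f x v a b : is_derive x v f a -> a = b -> is_derive x v f b.
Proof. by move=> h <-. Qed.

Lemma is_derive_prod f g x v df dg :
  is_derive x v f df -> is_derive x v g dg ->
  is_derive x v (fun y => f y * g y) (f x * dg + g x * df).
Proof. by move=> hf hg; have := is_deriveM hf hg; rewrite /GRing.scale. Qed.

Lemma is_derive_inv f x v df : f x != 0 -> is_derive x v f df ->
  is_derive x v (fun y => (f y)^-1) (- (f x)^-1 ^+ 2 * df).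
Proof.
move=> fx0 [h1 <-]; apply: DeriveDef; first exact: derivableV.
by rewrite deriveV// exprVn.
Qed.

Lemma is_derive_pow f n x v df : is_derive x v f df ->
  is_derive x v (fun y => f y ^+ n.+1) (n.+1%:R * f x ^+ n * df).
Proof.
move=> h; elim: n => [|n IH]; first by rewrite expr0 !mul1r.
rewrite (_ : (fun _ => _) = (fun y => f y * f y ^+ n.+1)).
  apply: is_derive_val (is_derive_prod h IH) _.
  by rewrite exprS [in RHS]mulrS; ring.
by apply/funext => y; rewrite exprS.
Qed.

Lemma is_derive_bigsum (I : Type) (r : seq I) (f : I -> V -> R) (d : I -> R) x v :
  (forall i, is_derive x v (f i) (d i)) ->
  is_derive x v (fun y => \sum_(i <- r) f i y) (\sum_(i <- r) d i).
Proof.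
move=> h; elim: r => [|i r IH].
  rewrite big_nil (_ : (fun _ => _) = cst 0); first exact: is_derive_cst.
  by apply/funext => y; rewrite big_nil.
rewrite big_cons (_ : (fun _ => _) = (fun y => f i y + \sum_(i <- r) f i y)).
  exact: is_deriveD.
by apply/funext => y; rewrite big_cons.
Qed.

Lemma is_derive_linear (l : V -> R) x v :
  (forall a u y, l (a *: u + y) = a * l u + l y) -> is_derive x v l (l v).
Proof.
move=> hl; apply/is_derive_line.
rewrite (_ : (fun _ => _) = (fun h : R => h * l v + l x)); last exact/funext.
apply: is_derive_eq; rewrite /GRing.scale /=; lra.
Qed.

End DerivativeRules.

Section LaplaceBeltrami.
Context {R : realType} {n : nat}.
Local Notation X := 'M[R]_(n, 4).
Implicit Types (u v w x y : X).

Lemma is_derive_ip u y v : is_derive y v (ip u) (ip u v).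
Proof. by apply: is_derive_linear => a b c; rewrite ipDr ipZr. Qed.

Lemma is_derive_mxvec (k : 'I_(n * 4)) y v :
  is_derive y v (fun y => mxvec y 0 k) (mxvec v 0 k).
Proof. by apply: is_derive_linear => a b c; rewrite linearP !mxE. Qed.

Lemma is_derive_lunit q (k : 'I_(n * 4)) y v :
  is_derive y v (fun y => mxvec (lunit q y) 0 k) (mxvec (lunit q v) 0 k).
Proof. by apply: is_derive_linear => a b c; rewrite 2!linearP !mxE. Qed.

Lemma is_derive_sqnorm y v : is_derive y v (@sqnorm R n 4) (2 * ip y v).
Proof.
apply/is_derive_line.
rewrite (_ : (fun _ => _) =
    (fun h : R => h ^+ 2 * sqnorm v + (h * (2 * ip y v) + sqnorm y))).
  apply: is_derive_eq; rewrite /GRing.scale /=; lra.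
apply/funext => h; rewrite !sqnormE !ipDl !ipDr !ipZl !ipZr (ipC v y); ring.
Qed.

Lemma is_derive_z y v : is_derive y v (fun y : X => (1 + sqnorm y)^-1)
  (- (1 + sqnorm y)^-1 ^+ 2 * (2 * ip y v)).
Proof.
have s1 : 1 + sqnorm y != 0 by rewrite gt_eqF// sqnorm1_gt0.
apply: (@is_derive_inv _ _ (fun y : X => 1 + sqnorm y)) => //.
have := is_deriveD (is_derive_cst (1 : R) y v) (is_derive_sqnorm y v).
  by rewrite add0r.
Qed.

Lemma sum_lunit_trace (q : 'I_4) :
  \sum_(k < n * 4) mxvec (lunit q (hbasis k : X)) 0 k = (n * 4)%:R *+ (q == 0).
Proof.
rewrite sum_mxvec_index natrM -mulrnAr -[n in n%:R * _]card_ord -sum1_card.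
rewrite natr_sum mulr_suml; apply: eq_bigr => i _; rewrite mul1r sum_ord4.
rewrite /hbasis !vec_mx_delta !mxvecE !mxE eqxx.
by elim/ord4P: q => /=; rewrite ?oppr0 ?addr0 // -!natrD.
Qed.

Lemma sum_lunit_hbasis q p u (l : 'I_(n * 4)) :
  \sum_k mxvec (lunit p u) 0 k * mxvec (lunit q (hbasis k : X)) 0 l =
  mxvec (lunit q (lunit p u)) 0 l.
Proof.
rewrite -{2}(sum_hbasis (lunit p u)) linear_sum linear_sum summxE.
by apply: eq_bigr => k _; rewrite !linearZ mxE.
Qed.

(* Half of the Laplacian in terms of the flat 2-jet:                           *)
(* (1 + |y|^2) (Lap f + sum_q D^2 f (e_q y, e_q y) - 4 y . grad f).            *)
Definition lb_jet y (f1 : 'I_(n * 4) -> R) (f2 : 'I_(n * 4) -> 'I_(n * 4) -> R) : R :=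
  (1 + sqnorm y) * (\sum_k f2 k k +
    \sum_q \sum_k \sum_l mxvec (lunit q y) 0 k * (mxvec (lunit q y) 0 l * f2 k l)
    - 4 * \sum_l mxvec y 0 l * f1 l).

Lemma laplace_beltramiE (f : X -> R) f1 f2 :
  (forall k y, is_derive y (hbasis k) f (f1 k y)) ->
  (forall k l y, is_derive y (hbasis k) (f1 l) (f2 k l y)) ->
  forall y, laplace_beltrami (@HP_metric R n) f y =
    lb_jet y (f1 ^~ y) (fun k l => f2 k l y).
Proof.
move=> h1 h2 y.
pose z y : R := (1 + @sqnorm R n 4 y)^-1.
have z0 y' : z y' != 0 by rewrite invr_eq0 gt_eqF// sqnorm1_gt0.
have sz y' : 1 + sqnorm y' = (z y')^-1 by rewrite invrK.
have sdet y' : Num.sqrt (\det (HP_metric y')) = z y' ^+ (n * 2 + 2).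
  rewrite HP_metric_det (_ : (n * 4 + 4 = (n * 2 + 2) * 2)%N); last first.
    by rewrite mulnDl -mulnA.
  by rewrite exprM sqrtr_sqr ger0_norm// exprn_ge0// invr_ge0 ltW// sqnorm1_gt0.
pose a q k y := mxvec (@lunit R n q y) 0 k.
pose W q y := \sum_l a q l y * f1 l y.
pose g k y := z y ^+ (n * 2).+1 * (f1 k y + \sum_q a q k y * W q y).
have gE k : (fun y => Num.sqrt (\det (HP_metric y)) *
    \sum_l invmx (HP_metric y) k l * partial l f y) = g k.
  apply/funext => y'; rewrite sdet addn2 exprS /g -mulrA mulrCA; congr (_ * _).
  rewrite mulr_sumr.
  have -> : f1 k y' = \sum_l (k == l)%:R * f1 l y'.
    rewrite (bigD1 k)//= eqxx mul1r big1 ?addr0// => l /negbTE lk.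
    by rewrite eq_sym lk mul0r.
  have -> : \sum_q a q k y' * W q y' = \sum_l (\sum_q a q k y' * a q l y') * f1 l y'.
    rewrite /W; under eq_bigr do rewrite mulr_sumr.
    rewrite exchange_big; apply: eq_bigr => l _; rewrite mulr_suml.
    by apply: eq_bigr => q _; rewrite mulrA.
  rewrite -big_split; apply: eq_bigr => l _ /=.
  have [_ E] := h1 l y'; rewrite /partial E HP_metric_inv !mxE sz -mulrDl !mulrA.
  rewrite divff// mul1r; congr (_ * _); congr (_ + _).
  by apply: eq_bigr => q _; rewrite !mxE.
pose dW k q := \sum_l (a q l y * f2 k l y + f1 l y * a q l (hbasis k)).
pose dg k := z y ^+ (n * 2).+1 * (f2 k k y + \sum_q (a q k y * dW k q +
      W q y * a q k (hbasis k))) +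
    (f1 k y + \sum_q a q k y * W q y) *
    ((n * 2).+1%:R * z y ^+ (n * 2) * (- z y ^+ 2 * (2 * mxvec y 0 k))).
have hg k : 'D_(hbasis k) (g k) y = dg k.
  suff [_ ->] : is_derive y (hbasis k) (g k) (dg k) by [].
  apply: is_derive_prod.
    have := is_derive_pow (n * 2) (is_derive_z y (hbasis k)).
    by rewrite ipC ip_hbasis.
  apply: is_deriveD.
  apply: is_derive_bigsum => q; apply: is_derive_prod.
    exact: is_derive_lunit.
  apply: is_derive_bigsum => l; apply: is_derive_prod.
  exact: is_derive_lunit.
rewrite /laplace_beltrami sdet.
under eq_bigr => k _ do rewrite gE /partial hg.
rewrite /dg big_split /= -mulr_sumr big_split /=.
have -> : \sum_k (f1 k y + \sum_q a q k y * W q y) *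
    ((n * 2).+1%:R * z y ^+ (n * 2) * (- z y ^+ 2 * (2 * mxvec y 0 k))) =
    - ((n * 2).+1%:R * 2 * z y ^+ (n * 2).+2) * (1 + sqnorm y) * W 0 y.
  transitivity (- ((n * 2).+1%:R * 2 * z y ^+ (n * 2).+2) *
     (W 0 y + \sum_q (\sum_k a q k y * mxvec y 0 k) * W q y)).
    rewrite [W 0 y]/W mulrDr !mulr_sumr.
    transitivity (\sum_k (- ((n * 2).+1%:R * 2 * z y ^+ (n * 2).+2) *
       (a 0 k y * f1 k y + \sum_q a q k y * mxvec y 0 k * W q y))).
      apply: eq_bigr => k _; rewrite /a lunit0.
      transitivity (- ((n * 2).+1%:R * 2 * z y ^+ (n * 2).+2) *
        (mxvec y 0 k * (f1 k y + \sum_q a q k y * W q y))).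
        by rewrite !exprS; ring.
      congr (_ * _); rewrite mulrDr mulr_sumr; congr (_ + _).
      by apply: eq_bigr => q _; rewrite mulrA [_ * a _ _ _]mulrC.
    under eq_bigr do rewrite mulrDr.
    rewrite big_split /=; congr (_ + _).
    rewrite -mulr_sumr exchange_big mulr_sumr; apply: eq_bigr => q _.
    by rewrite -mulr_suml.
  rewrite -[RHS]mulrA mulrDl mul1r; congr (_ * (_ + _)).
  have S q : \sum_k a q k y * mxvec y 0 k = sqnorm y *+ (q == 0).
    by rewrite -{2}[y]lunit0 -ip_mxvec ip_lunit.
  by rewrite sum_ord4 !S /= !mul0r !addr0.
have -> : \sum_k \sum_q (a q k y * dW k q + W q y * a q k (hbasis k)) =
    \sum_q \sum_k \sum_l a q k y * (a q l y * f2 k l y) - 2 * W 0 y +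
    (n * 4)%:R * W 0 y.
  rewrite exchange_big /=.
  transitivity (\sum_q (\sum_k \sum_l a q k y * (a q l y * f2 k l y) +
     ((if q == 0 then 1 else -1) * W 0 y + (n * 4)%:R *+ (q == 0) * W q y))).
    apply: eq_bigr => q _; rewrite big_split /=; rewrite -mulr_sumr addrA.
    congr (_ + _); last by rewrite mulrC sum_lunit_trace.
    rewrite /dW; under eq_bigr do rewrite big_split mulrDr !mulr_sumr /=.
    rewrite big_split /=; congr (_ + _).
    rewrite exchange_big /= /W mulr_sumr; apply: eq_bigr => l _.
    rewrite mulrA /a lunit0.
    transitivity (f1 l y * \sum_k mxvec (lunit q y) 0 k * mxvec (lunit q (hbasis k : X)) 0 l).
      by rewrite mulr_sumr; apply: eq_bigr => k _; ring.
    rewrite sum_lunit_hbasis lunitK mulrC; case: ifP => _; first by rewrite mul1r.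
    by rewrite linearN mxE mulN1r.
  rewrite big_split /= -addrA; congr (_ + _).
  by rewrite sum_ord4 /=; ring.
rewrite /lb_jet /a.
have -> : \sum_l mxvec y 0 l * f1 l y = W 0 y by apply: eq_bigr => l _; rewrite /a lunit0.
set A := \sum_k f2 k k y; set B := \sum_q _; set C := W 0 y.
have zE : z y * (1 + sqnorm y) = 1 by rewrite sz mulfV.
have e1 : (n * 2).+1%:R = 2 * n%:R + 1 :> R by rewrite -natr1 natrM mulrC.
have e2 : (n * 4)%:R = 4 * n%:R :> R by rewrite natrM mulrC.
rewrite e1 e2 sz addn2 !exprS.
set Z := z y ^+ (n * 2); have Z0 : Z != 0 by rewrite expf_neq0.
field; rewrite ?z0 ?Z0 //.
Qed.

End LaplaceBeltrami.

Section SmoothOn.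
Context {R : realType}.
Implicit Types (f g : R -> R).

Lemma smooth_onS (D : set R) m f : smooth_on D m.+1 f -> smooth_on D m f.
Proof.
elim: m f => [|m IH] f.
  by move=> h x Dx; exact: smooth_on_continuous h Dx.
move=> [g [h1 h2]]; exists g; split => //; exact: IH.
Qed.

Lemma smooth_onM (D : set R) m f g : smooth_on D m f -> smooth_on D m g ->
  smooth_on D m (fun x => f x * g x).
Proof.
elim: m f g => [|m IH] f g hf hg.
  by move=> x Dx; apply: continuousM; [exact: hf|exact: hg].
have [f' [f1 f2]] := hf; have [g' [g1 g2]] := hg.
exists (fun x => f x * g' x + g x * f' x); split.
  by move=> x Dx; apply: is_derive_prod; [exact: f1|exact: g1].
by apply: smooth_onD; apply: IH => //; exact: smooth_onS.
Qed.

Lemma smooth_on_comp (D E : set R) m g f : smooth_on E m g -> smooth_on D m f ->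
  (forall x, D x -> E (f x)) -> smooth_on D m (fun x => g (f x)).
Proof.
elim: m f g => [|m IH] f g hg hf DE.
  move=> x Dx; apply: (@continuous_comp _ _ _ f g); first exact: hf.
  by apply: hg; exact: DE.
have [f' [f1 f2]] := hf; have [g' [g1 g2]] := hg.
exists (fun x => g' (f x) * f' x); split.
  move=> x Dx; apply: is_derive_comp_dir; last exact: f1.
  by apply: g1; exact: DE.
apply: smooth_onM f2; apply: IH DE => //; exact: smooth_onS.
Qed.

Lemma smooth_on_affine (D : set R) m (a b : R) :
  smooth_on D m (fun x => a * x + b).
Proof.
have aff (x : R) : is_derive x (1 : R) (fun x : R => a * x + b) a.
  apply: is_derive_val (is_deriveD (is_derive_prod (is_derive_cst a x (1 : R))
     (is_derive_id x (1 : R))) (is_derive_cst b x (1 : R))) _.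
  by rewrite mulr1 mulr0 !addr0.
case: m => [|m].
  move=> x _; apply: differentiable_continuous; apply/derivable1_diffP.
  by case: (aff x).
by exists (fun=> a); split; [move=> x _; exact: aff|exact: smooth_on_cst].
Qed.

(* The functions t^-k exp(-1/t), extended by 0 to t <= 0; this family is      *)
(* closed under differentiation up to linear combinations.                    *)
Definition flat k (t : R) : R :=
  if 0 < t then t^-1 ^+ k * expR (- t^-1) else 0.

Lemma flat_ge0 k t : 0 <= flat k t.
Proof.
rewrite /flat; case: ifPn => // t0.
by rewrite mulr_ge0 ?expR_ge0 // exprn_ge0 // invr_ge0 ltW.
Qed.

Lemma flat_gt0 k t : 0 < t -> 0 < flat k t.
Proof.
by move=> t0; rewrite /flat t0 mulr_gt0 ?expR_gt0 // exprn_gt0 // invr_gt0.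
Qed.

Lemma flat_le k t : `|flat k t| <= k.+2%:R ^+ k.+2 * t ^+ 2.
Proof.
rewrite ger0_norm ?flat_ge0// /flat; case: ifPn => t0; last first.
  by rewrite mulr_ge0 ?sqr_ge0 ?exprn_ge0.
have n0 : 0 < k.+2%:R :> R by rewrite ltr0n.
have tk : 0 < (k.+2%:R * t)^-1 by rewrite invr_gt0 mulr_gt0.
have h : (k.+2%:R * t)^-1 ^+ k.+2 <= expR t^-1.
  have -> : t^-1 = (k.+2%:R * t)^-1 * k.+2%:R.
    by rewrite invfM mulrAC mulVf ?mul1r // gt_eqF.
  rewrite expRM_natr; apply: lerXn2r; rewrite ?nnegrE ?expR_ge0 ?(ltW tk)//.
  by apply: le_trans (expR_ge1Dx _); rewrite lerDr.
have E : expR (- t^-1) <= (k.+2%:R * t) ^+ k.+2.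
  rewrite expRN -[leRHS]invrK lef_pV2 ?posrE ?expR_gt0 ?invr_gt0 ?exprn_gt0 ?mulr_gt0//.
  by rewrite -exprVn.
apply: le_trans (_ : t^-1 ^+ k * (k.+2%:R * t) ^+ k.+2 <= _).
  by rewrite ler_wpM2l // exprn_ge0 // invr_ge0 ltW.
rewrite le_eqVlt; apply/orP; left; apply/eqP.
rewrite [(_ * t) ^+ _]exprMn mulrCA; congr (_ * _).
by rewrite -(addn2 k) exprD mulrA -exprMn mulVf ?gt_eqF// expr1n mul1r.
Qed.

Lemma is_derive_flat k (t : R) :
  is_derive t (1 : R) (flat k) (flat k.+2 t - k%:R * flat k.+1 t).
Proof.
have [t0|t0|t0] := ltgtP t 0.
- have E : \forall u \near t, cst (0 : R) u = flat k u.
    near=> u; rewrite /flat; case: ifPn => // u0.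
    by move: u0; rewrite ltNge; case/negP; apply: ltW; near: u; exact: lt_nbhsl.
  apply: near_eq_is_derive E _.
  apply: is_derive_val (is_derive_cst (0 : R) t 1) _.
  by rewrite /flat !ifN ?mulr0 ?subrr // -leNgt ltW.
- have E : \forall u \near t, u^-1 ^+ k * expR (- u^-1) = flat k u.
    by near=> u; rewrite /flat ifT //; near: u; exact: lt_nbhsr.
  apply: near_eq_is_derive E _.
  have hV : is_derive t 1 (fun u => u^-1) (- t^-1 ^+ 2).
    apply: is_derive_val (is_derive_inv (f := id) _ (is_derive_id t 1)) _.
      by rewrite gt_eqF.
    by rewrite mulr1.
  have hN : is_derive t 1 (fun u => - u^-1) (t^-1 ^+ 2).
    by have := is_deriveN hV; rewrite opprK.
  have hE := is_derive_comp_dir (f := fun u : R => - u^-1) (is_derive_expR (- t^-1)) hN.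
  rewrite /flat t0; case: k => [|k].
    apply: is_derive_val (is_derive_prod (is_derive_cst (1 : R) t 1) hE) _.
    by rewrite mul0r subr0 mulr0 addr0 mul1r mulrC.
  apply: is_derive_val (is_derive_prod (is_derive_pow k hV) hE) _.
  by rewrite !exprS /comp; ring.
- rewrite t0; have h0 j : flat j 0 = 0 by rewrite /flat ltxx.
  rewrite !h0 mulr0 subrr.
  have : (fun h : R => h^-1 *: ((flat k \o shift 0) (h *: (1 : R)) - flat k 0)) @ 0^' --> (0 : R).
    apply/cvgrPdist_le => /= e e0; near=> h.
    have hn0 : h != 0 by near: h; exact: nbhs_dnbhs_neq.
    rewrite h0 subr0 sub0r normrN addr0 [h *: 1]mulr1 normrM normfV.
    rewrite ler_pdivrMl ?normr_gt0//.
    apply: (le_trans (flat_le k h)); rewrite -real_normK ?num_real// expr2.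
    rewrite mulrCA ler_wpM2l//.
    have c0 : 0 < k.+2%:R ^+ k.+2 :> R by rewrite exprn_gt0.
    rewrite -ler_pdivlMl// mulrC.
    near: h; apply: dnbhs0_le; by rewrite divr_gt0.
  by move=> h; apply: DeriveDef; [apply/cvg_ex; exists 0|exact: cvg_lim].
Unshelve. all: by end_near. Qed.

Lemma smooth_on_flat m k : smooth_on setT m (flat k).
Proof.
elim: m k => [|m IH] k.
  move=> x _; apply: differentiable_continuous; apply/derivable1_diffP.
  by case: (is_derive_flat k x).
exists (fun t => flat k.+2 t + - k%:R * flat k.+1 t); split.
  by move=> t _; rewrite mulNr; exact: is_derive_flat.
by apply: smooth_onD => //; exact: smooth_onZ.
Qed.

Lemma exists_smooth_step (a b : R) : a < b -> exists chi : R -> R,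
  [/\ forall m, smooth_on setT m chi, forall t, t <= a -> chi t = 0,
      forall t, b <= t -> chi t = 1 & forall t, 0 <= chi t <= 1].
Proof.
move=> ab; pose f t := flat 0 (t - a); pose g t := flat 0 (b - t).
have fg t : 0 < f t + g t.
  have [ta|ta] := ltP a t.
    by rewrite ltr_pwDl ?flat_ge0// flat_gt0// subr_gt0.
  by rewrite ltr_pwDr ?flat_ge0// flat_gt0// subr_gt0 (le_lt_trans ta).
exists (fun t => f t * (f t + g t) `^ (-1)); split.
- have hf m : smooth_on setT m f.
    apply: (@smooth_on_comp _ setT _ (flat 0) (fun t => t - a)) => //.
      exact: smooth_on_flat.
    by have := smooth_on_affine setT m 1 (- a); under eq_fun do rewrite mul1r.
  have hg m : smooth_on setT m g.
    apply: (@smooth_on_comp _ setT _ (flat 0) (fun t => b - t)) => //.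
      exact: smooth_on_flat.
    have := smooth_on_affine setT m (-1) b.
    by under eq_fun do rewrite mulN1r addrC.
  move=> m; apply: smooth_onM => //.
  apply: (@smooth_on_comp _ [set x : R | 0 < x] _ (fun x => x `^ (-1))).
  - exact: smooth_on_powR.
  - exact: smooth_onD.
  - by move=> x _; exact: fg.
- by move=> t ta; rewrite /f /flat subr_gt0 ltNge ta mul0r.
- move=> t bt; have -> : g t = 0 by rewrite /g /flat subr_gt0 ltNge bt.
  rewrite addr0 powR_inv1 ?flat_ge0// mulfV// gt_eqF// flat_gt0// subr_gt0.
  exact: lt_le_trans bt.
- move=> t; rewrite powR_inv1 ?(ltW (fg t))//.
  rewrite divr_ge0 ?flat_ge0 ?(ltW (fg t))//= ler_pdivrMr// mul1r lerDl.
  exact: flat_ge0.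
Qed.

End SmoothOn.

Section Jets.
Context {R : realType} {n : nat}.
Local Notation X := 'M[R]_(n, 4).
Local Notation I := 'I_(n * 4).
Implicit Types (x y v : X) (lam : 'rV[R]_3).

Definition is_jet (f : X -> R) (f1 : I -> X -> R) (f2 : I -> I -> X -> R) :=
  (forall k y, is_derive y (hbasis k) f (f1 k y)) /\
  (forall k l y, is_derive y (hbasis k) (f1 l) (f2 k l y)).

Lemma jet_prod f f1 f2 g g1 g2 : is_jet f f1 f2 -> is_jet g g1 g2 ->
  is_jet (fun y => f y * g y) (fun k y => f y * g1 k y + g y * f1 k y)
    (fun k l y => f y * g2 k l y + g1 l y * f1 k y +
                  (g y * f2 k l y + f1 l y * g1 k y)).
Proof.
move=> [hf1 hf2] [hg1 hg2]; split=> [k y|k l y].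
  by apply: is_derive_prod.
by apply: is_deriveD; apply: is_derive_prod.
Qed.

Lemma jet_comp (D : set R) (g g1 g2 : R -> R) f f1 f2 :
  (forall t, D t -> is_derive t (1 : R) g (g1 t)) ->
  (forall t, D t -> is_derive t (1 : R) g1 (g2 t)) ->
  is_jet f f1 f2 -> (forall y, D (f y)) ->
  is_jet (fun y => g (f y)) (fun k y => g1 (f y) * f1 k y)
    (fun k l y => g1 (f y) * f2 k l y + f1 l y * (g2 (f y) * f1 k y)).
Proof.
move=> hg1 hg2 [hf1 hf2] hD; split=> [k y|k l y].
  by apply: is_derive_comp_dir => //; exact: hg1.
apply: is_derive_prod => //.
by apply: is_derive_comp_dir => //; exact: hg2.
Qed.

Definition zc (y : X) : R := (1 + sqnorm y)^-1.

Lemma zc_gt0 y : 0 < zc y.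
Proof. by rewrite invr_gt0 sqnorm1_gt0. Qed.

Lemma zc_le1 y : zc y <= 1.
Proof. by rewrite invf_le1 ?sqnorm1_gt0// lerDl sqnorm_ge0. Qed.

Lemma jet_zc : is_jet zc (fun k y => - zc y ^+ 2 * (2 * mxvec y 0 k))
  (fun k l y => - zc y ^+ 2 * (2 * (k == l)%:R) +
     (2 * mxvec y 0 l) * (- (2 * zc y * (- zc y ^+ 2 * (2 * mxvec y 0 k))))).
Proof.
have h1 k y : is_derive y (hbasis k) zc (- zc y ^+ 2 * (2 * mxvec y 0 k)).
  by rewrite -ip_hbasis ipC; exact: is_derive_z.
split=> // k l y; apply: is_derive_prod.
  apply: is_deriveN; apply: is_derive_val (is_derive_pow 1 (h1 k y)) _.
  by rewrite expr1.
apply: is_derive_val (is_derive_prod (is_derive_cst (2 : R) y (hbasis k))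
  (is_derive_mxvec l y (hbasis k))) _.
by rewrite mulr0 addr0 mxvec_hbasis.
Qed.

Lemma jet_ip v : is_jet (ip v) (fun k _ => mxvec v 0 k) (fun _ _ _ => 0).
Proof.
split=> [k y|k l y]; last exact: is_derive_cst.
by rewrite -ip_hbasis ipC; exact: is_derive_ip.
Qed.

Lemma jet_shift f f1 f2 c : is_jet f f1 f2 -> is_jet (fun y => c + f y) f1 f2.
Proof.
move=> [h1 h2]; split => // k y.
by apply: is_derive_val (is_deriveD (is_derive_cst c y _) (h1 k y)) _; rewrite add0r.
Qed.

Definition axis lam x : X :=
  lam 0 0 *: lunit 1 x + lam 0 1 *: lunit 2 x + lam 0 2 *: lunit 3 x.

Definition phase lam x y : R := 2^-1 * (ip (axis lam x) y * (zc x + zc y)).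

Lemma ip_axis_lunit lam x q : ip (axis lam x) (lunit q x) =
  [:: 0; lam 0 0; lam 0 1; lam 0 2]`_q * sqnorm x.
Proof.
rewrite /axis !ipDl !ipZl !ip_lunit.
by elim/ord4P: q => /=; ring.
Qed.

Lemma ip_axis lam x : ip (axis lam x) x = 0.
Proof. by have := ip_axis_lunit lam x 0; rewrite lunit0 mul0r. Qed.

Lemma sqnorm3 lam : sqnorm lam = lam 0 0 ^+ 2 + lam 0 1 ^+ 2 + lam 0 2 ^+ 2.
Proof. by rewrite /sqnorm big_ord1 sum_ord3. Qed.

Lemma sqnorm_axis lam x : sqnorm (axis lam x) = sqnorm lam * sqnorm x.
Proof.
rewrite sqnormE {2}/axis !ipDr !ipZr !ip_axis_lunit /= sqnorm3; ring.
Qed.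

Lemma phase_diag lam x : phase lam x x = 0.
Proof. by rewrite /phase ip_axis mul0r mulr0. Qed.

Definition hess_form y (f2 : I -> I -> R) : R := \sum_k f2 k k +
  \sum_q \sum_k \sum_l mxvec (lunit q y) 0 k * (mxvec (lunit q y) 0 l * f2 k l).

Lemma hess_formD y f g :
  hess_form y (fun k l => f k l + g k l) = hess_form y f + hess_form y g.
Proof.
rewrite /hess_form big_split /= addrACA; congr (_ + _).
rewrite -big_split; apply: eq_bigr => q _; rewrite -big_split; apply: eq_bigr => k _.
by rewrite -big_split; apply: eq_bigr => l _; rewrite !mulrDr.
Qed.

Lemma hess_formZ y c f : hess_form y (fun k l => c * f k l) = c * hess_form y f.
Proof.
rewrite /hess_form mulrDr !mulr_sumr; congr (_ + _).
apply: eq_bigr => q _; rewrite mulr_sumr; apply: eq_bigr => k _.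
by rewrite mulr_sumr; apply: eq_bigr => l _; ring.
Qed.

Lemma hess_form_rank1 y u v : hess_form y (fun k l => mxvec u 0 k * mxvec v 0 l) =
  ip u v + \sum_q ip (lunit q y) u * ip (lunit q y) v.
Proof.
rewrite /hess_form -ip_mxvec; congr (_ + _); apply: eq_bigr => q _.
rewrite !ip_mxvec mulr_suml; apply: eq_bigr => k _.
by rewrite mulr_sumr; apply: eq_bigr => l _; ring.
Qed.

Lemma hess_form_delta y : hess_form y (fun k l => (k == l)%:R) =
  4 * n%:R + 4 * sqnorm y.
Proof.
rewrite /hess_form; congr (_ + _).
  under eq_bigr do rewrite eqxx.
  by rewrite sumr_const card_ord -natrM mulnC.
transitivity (\sum_(q < 4) sqnorm y); last by rewrite sum_ord4; ring.
apply: eq_bigr => q _.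
have -> : sqnorm y = ip (lunit q y) (lunit q y) by rewrite ip_lunit eqxx.
rewrite ip_mxvec; apply: eq_bigr => k _; rewrite (bigD1 k)//= eqxx mulr1.
by rewrite big1 ?addr0// => l /negbTE kl; rewrite eq_sym kl !mulr0.
Qed.

(* The twisted radial function (p cos Psi(x, y) - q sin Psi(x, y)) V(z(y)):    *)
(* half its Laplacian at y = x only sees a radial operator with the extra      *)
(* potential |lam|^2 tan^2 r / 2.                                              *)
Lemma laplace_twisted lam (V V1 V2 : R -> R) (p q : R) x :
  (forall t : R, 0 < t -> is_derive t (1 : R) V (V1 t)) ->
  (forall t : R, 0 < t -> is_derive t (1 : R) V1 (V2 t)) ->
  let K y := (p * cos (phase lam x y) - q * sin (phase lam x y)) * V (zc y) in
  let t := zc x in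
  2^-1 * laplace_beltrami (@HP_metric R n) K x =
  p * (2 * t * (1 - t) * V2 t + (4 * (1 - t) - 4 * n%:R * t) * V1 t
       - 2^-1 * sqnorm lam * ((1 - t) / t) * V t).
Proof.
move=> hV1 hV2 K t.
have jP := jet_prod (jet_ip (axis lam x)) (jet_shift (zc x) jet_zc).
have hu (s : R) : setT s -> is_derive s (1 : R)
    (fun s : R => p * cos (2^-1 * s) - q * sin (2^-1 * s))
    (2^-1 * (- p * sin (2^-1 * s) - q * cos (2^-1 * s))).
  move=> _.
  have hm : is_derive s (1 : R) (fun s : R => 2^-1 * s) 2^-1.
    apply: is_derive_val (is_derive_prod (is_derive_cst (2^-1 : R) s (1 : R)) (is_derive_id s (1 : R))) _.
    by rewrite mulr1 mulr0 addr0.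
  have hc := is_derive_comp_dir (f := fun s : R => 2^-1 * s) (is_derive_cos (2^-1 * s)) hm.
  have hs := is_derive_comp_dir (f := fun s : R => 2^-1 * s) (is_derive_sin (2^-1 * s)) hm.
  apply: is_derive_val (is_deriveB (is_derive_prod (is_derive_cst p s (1 : R)) hc)
     (is_derive_prod (is_derive_cst q s (1 : R)) hs)) _.
  by rewrite /cst !mulr0 !addr0; ring.
have hu1 (s : R) : setT s -> is_derive s (1 : R)
    (fun s : R => 2^-1 * (- p * sin (2^-1 * s) - q * cos (2^-1 * s)))
    (2^-1 * (2^-1 * (- p * cos (2^-1 * s) + q * sin (2^-1 * s)))).
  move=> _.
  have hm : is_derive s (1 : R) (fun s : R => 2^-1 * s) 2^-1.
    apply: is_derive_val (is_derive_prod (is_derive_cst (2^-1 : R) s (1 : R)) (is_derive_id s (1 : R))) _.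
    by rewrite mulr1 mulr0 addr0.
  have hc := is_derive_comp_dir (f := fun s : R => 2^-1 * s) (is_derive_cos (2^-1 * s)) hm.
  have hs := is_derive_comp_dir (f := fun s : R => 2^-1 * s) (is_derive_sin (2^-1 * s)) hm.
  apply: is_derive_val (is_derive_prod (is_derive_cst (2^-1 : R) s (1 : R)) (is_deriveB (is_derive_prod (is_derive_cst (- p) s (1 : R)) hs)
     (is_derive_prod (is_derive_cst q s (1 : R)) hc))) _.
  by rewrite /cst !mulr0 !addr0; ring.
have jU := jet_comp hu hu1 jP (fun _ => Logic.I).
have jV := jet_comp (D := [set t : R | 0 < t]) hV1 hV2 jet_zc zc_gt0.
have [j1 j2] := jet_prod jU jV.
rewrite (laplace_beltramiE j1 j2) /lb_jet -/(hess_form _ _) ip_axis !mul0r !mulr0 cos0 sin0.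
rewrite !mulr0 !mulr1 !subr0 !sub0r.
set a := axis lam x.
have s0 := sqnorm1_gt0 x.
have tn0 : t != 0 by rewrite gt_eqF// zc_gt0.
have sE : sqnorm x = (1 - t) / t.
  by rewrite /t /zc; field; rewrite gt_eqF.
have lE q' : ip (lunit q' x) x = sqnorm x *+ (q' == 0).
  by rewrite -{2}[x]lunit0 ip_lunit.
rewrite [hess_form _ _](_ : _ =
   p * (V1 t * (- 2 * t ^+ 2)) * hess_form x (fun k l => (k == l)%:R) +
   p * (V1 t * (8 * t ^+ 3) + V2 t * (4 * t ^+ 4)) *
      hess_form x (fun k l => mxvec x 0 k * mxvec x 0 l) +
   q * (V t * t ^+ 2 + 2 * V1 t * t ^+ 3) *
      hess_form x (fun k l => mxvec a 0 k * mxvec x 0 l) +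
   q * (V t * t ^+ 2 + 2 * V1 t * t ^+ 3) *
      hess_form x (fun k l => mxvec x 0 k * mxvec a 0 l) +
   - (p * V t * t ^+ 2) * hess_form x (fun k l => mxvec a 0 k * mxvec a 0 l)).
  rewrite !hess_form_rank1 hess_form_delta (ipC x a) ip_axis !sum_ord4 !lE.
  rewrite !(ipC (lunit _ _)) !ip_axis_lunit /= !mulr0n !mulr1n.
  rewrite -!sqnormE sqnorm_axis sqnorm3.
  rewrite (_ : \sum_l _ = p * (V1 t * (- (2 * t ^+ 2))) * sqnorm x).
    by rewrite sE; field.
  rewrite sqnormE ip_mxvec mulr_sumr.
  transitivity (\sum_l (p * (V1 t * - (2 * t ^+ 2)) * (mxvec x 0 l * mxvec x 0 l) -
      q * t * V t * (mxvec a 0 l * mxvec x 0 l))).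
    by apply: eq_bigr => l _; rewrite -/t; field.
  by rewrite sumrB -!mulr_sumr -!ip_mxvec /a ip_axis mulr0 subr0.
rewrite -!hess_formZ -!hess_formD; congr (hess_form x).
apply/funext => k; apply/funext => l; rewrite -/t.
by field.
Qed.

End Jets.

Lemma continuous_section (S X Y : topologicalType) (f : S * X -> Y) (s : S) :
  continuous f -> continuous (fun y => f (s, y)).
Proof.
move=> cf y; apply: (@continuous_comp _ _ _ (fun y => (s, y)) f); last exact: cf.
by apply: (@cvg_pair _ _ _ _ (nbhs s)) => /=; [exact: cvg_cst|exact: cvg_id].
Qed.

Section TestFunctions.
Context {R : realType} {n : nat}.
Local Notation X := 'M[R]_(n, 4).
Implicit Types (x y : X) (lam : 'rV[R]_3).

Lemma psmooth_smooth (S : topologicalType) (f : S -> X -> R) s :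
  (forall m, psmooth m f) -> smooth (f s).
Proof.
move=> hf.
have aux r m : exists2 f', psmooth m f' & forall s, foldr partial (f s) r = f' s.
  elim: r m => [|k r IH] m; first by exists f.
  have [f' [_ h] E] := IH m.+1; have [f'' [d h'']] := h (hbasis k).
  exists f'' => // s'; rewrite /= E; apply/funext => y.
  by rewrite /partial; case: (d s' y).
move=> r; split.
  move=> y k; have [f' [_ h] E] := aux r 1; have [f'' [d _]] := h (hbasis k).
  by rewrite E; case: (d s y).
have [f' [c _] E] := aux r 0; rewrite E.
exact: (@continuous_section _ _ _ (fun p : S * X => f' p.1 p.2) s c).
Qed.

Lemma psmooth_coord (S : topologicalType) m (i : 'I_n) (j : 'I_4) :
  psmooth m (fun (_ : S) y => y i j).
Proof.
apply: psmooth_linear; first exact: coord_continuous.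
by move=> y v; apply: is_derive_linear => a u w; rewrite !mxE.
Qed.

Lemma psmooth_sqnorm (S : topologicalType) m :
  psmooth m (fun (_ : S) (y : X) => sqnorm y).
Proof.
apply: psmooth_sum => i; apply: psmooth_sum => j.
by apply: psmoothM; exact: psmooth_coord.
Qed.

Lemma psmooth_mxvec (S : topologicalType) m (k : 'I_(n * 4)) :
  psmooth m (fun (_ : S) (y : X) => mxvec y 0 k).
Proof.
case/mxvec_indexP: k => i j.
rewrite (_ : (fun _ _ => _) = (fun (_ : S) (y : X) => y i j)).
  exact: psmooth_coord.
by apply/funext => s; apply/funext => y; rewrite mxvecE.
Qed.

Lemma psmooth_lunit (S : topologicalType) m q i j :
  psmooth m (fun (_ : S) (y : X) => lunit q y i j).
Proof.
have N j' : psmooth m (fun (_ : S) (y : X) => - y i j').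
  rewrite (_ : (fun _ _ => _) = (fun (_ : S) (y : X) => -1 * y i j')).
    by apply: psmoothM; [exact: psmooth_cst|exact: psmooth_coord].
  by apply/funext => s; apply/funext => y; rewrite mulN1r.
have E : (fun (_ : S) (y : X) => lunit q y i j) = (fun _ y =>
    (nth [::] [:: [:: y i 0; y i 1; y i 2; y i 3];
    [:: - y i 1; y i 0; - y i 3; y i 2];
    [:: - y i 2; y i 3; y i 0; - y i 1];
    [:: - y i 3; - y i 2; y i 1; y i 0]] q)`_j).
  by apply/funext => s; apply/funext => y; rewrite mxE.
rewrite {}E; elim/ord4P: q; elim/ord4P: j; try exact: N; exact: psmooth_coord.
Qed.

Lemma psmooth_mxvec_lunit (S : topologicalType) m q (k : 'I_(n * 4)) :
  psmooth m (fun (_ : S) (y : X) => mxvec (lunit q y) 0 k).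
Proof.
case/mxvec_indexP: k => i j.
rewrite (_ : (fun _ _ => _) = (fun (_ : S) (y : X) => lunit q y i j)).
  exact: psmooth_lunit.
by apply/funext => s; apply/funext => y; rewrite mxvecE.
Qed.

Lemma psmooth_laplace_continuous (S : topologicalType) (f : S -> X -> R) :
  psmooth 2 f ->
  continuous (fun p : S * X => laplace_beltrami (@HP_metric R n) (f p.1) p.2).
Proof.
case=> _ hf.
have [f1 hf1] := choice (fun k => hf (hbasis k)).
have hf2' k l : exists f2, (forall s y, is_derive y (hbasis k) (f1 l s) (f2 s y)) /\
    psmooth 0 f2.
  by have [_ [_ h]] := hf1 l; exact: h.
have [f2 hf2] := choice (fun kl => hf2' kl.1 kl.2).
have E : (fun p : S * X => laplace_beltrami (@HP_metric R n) (f p.1) p.2) =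
    (fun p => lb_jet p.2 (fun k => f1 k p.1 p.2) (fun k l => f2 (k, l) p.1 p.2)).
  apply/funext => -[s y] /=.
  apply: (@laplace_beltramiE _ _ (f s) (fun k => f1 k s) (fun k l => f2 (k, l) s)).
    by move=> k y'; have [h _] := hf1 k; exact: h.
  by move=> k l y'; have [h _] := hf2 (k, l); exact: h.
rewrite E.
have h1 k : psmooth 0 (f1 k) by have [_ h] := hf1 k; apply: psmoothS.
have h2 kl : psmooth 0 (f2 kl) by have [_ h] := hf2 kl.
apply: (@psmooth_continuous _ _ _ 0 (fun s y => lb_jet y (fun k => f1 k s y)
  (fun k l => f2 (k, l) s y))).
apply: psmoothM.
  by apply: psmoothD; [exact: psmooth_cst|exact: psmooth_sqnorm].
apply: psmoothD; last first.
  rewrite (_ : (fun _ _ => _) = (fun (s : S) (y : X) =>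
     - 4 * \sum_l mxvec y 0 l * f1 l s y)); last first.
    by apply/funext => s; apply/funext => y; rewrite mulNr.
  apply: psmoothM; first exact: psmooth_cst.
  by apply: psmooth_sum => l; apply: psmoothM => //; exact: psmooth_mxvec.
apply: psmoothD; first exact: psmooth_sum.
apply: psmooth_sum => q; apply: psmooth_sum => k; apply: psmooth_sum => l.
apply: psmoothM; first exact: psmooth_mxvec_lunit.
by apply: psmoothM => //; exact: psmooth_mxvec_lunit.
Qed.

Lemma laplace_beltrami_near0 (f : X -> R) y : (\near y, f y = 0) ->
  laplace_beltrami (@HP_metric R n) f y = 0.
Proof.
move=> /near_join h; rewrite /laplace_beltrami big1 ?mulr0// => k _.
rewrite /partial (@near_eq_derive _ _ _ _ (cst 0)) ?derive_cst//.
near=> y'; rewrite big1 ?mulr0// => l _.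
rewrite /partial (@near_eq_derive _ _ _ _ (cst 0)) ?derive_cst ?mulr0//.
by near: y'.
Unshelve. all: by end_near. Qed.

Lemma psmooth_zc (S : topologicalType) m : psmooth m (fun (_ : S) (y : X) => zc y).
Proof.
rewrite (_ : (fun _ _ => _) = (fun (_ : S) (y : X) => (1 + sqnorm y) `^ (-1))).
  have h1 : psmooth m (fun (_ : S) (y : X) => 1 + sqnorm y).
    by apply: psmoothD; [exact: psmooth_cst|exact: psmooth_sqnorm].
  have := psmooth_comp (smooth_on_powR m (-1)) h1.
  by apply => _ y; exact: sqnorm1_gt0.
by apply/funext => s; apply/funext => y; rewrite powR_inv1// ltW// sqnorm1_gt0.
Qed.

Lemma continuous_zc : continuous (@zc R n).
Proof.
have /psmooth_continuous := psmooth_zc R 0.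
exact: (@continuous_section _ _ _ (fun p : R * X => zc p.2) 0).
Qed.

Lemma continuous_axis lam i j : continuous (fun x : X => axis lam x i j).
Proof.
have E : (fun x : X => axis lam x i j) = (fun x : X => lam 0 0 * lunit 1 x i j +
    lam 0 1 * lunit 2 x i j + lam 0 2 * lunit 3 x i j).
  by apply/funext => x; rewrite /axis !mxE.
have /psmooth_continuous h : psmooth 0 (fun (_ : R) (x : X) => axis lam x i j).
  rewrite [X in psmooth _ X](_ : _ = fun (_ : R) (x : X) => lam 0 0 * lunit 1 x i j +
    lam 0 1 * lunit 2 x i j + lam 0 2 * lunit 3 x i j); last by rewrite E.
  apply: psmoothD; [apply: psmoothD|]; apply: psmoothM;
    solve [exact: psmooth_cst|exact: psmooth_lunit].
exact: (@continuous_section _ _ _ (fun p : R * X => axis lam p.2 i j) 0 h).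
Qed.

Lemma psmooth_phase m lam :
  psmooth m (fun (s : X * R * R) (y : X) => phase lam s.1.1 y).
Proof.
have c11 : continuous (fun s : X * R * R => s.1.1).
  by move=> s; apply: (@continuous_comp _ _ _ fst fst); [exact: cvg_fst|exact: cvg_fst].
apply: psmoothM; first exact: psmooth_cst.
apply: psmoothM.
  apply: psmooth_sum => i; apply: psmooth_sum => j; apply: psmoothM.
    apply: (@psmooth_param _ _ _ _ (fun s : X * R * R => axis lam s.1.1 i j)) => s.
    exact: (@continuous_comp _ _ _ (fun s : X * R * R => s.1.1) (fun x => axis lam x i j) s (c11 s) (@continuous_axis _ _ _ _)).
  exact: psmooth_coord.
apply: psmoothD; last exact: psmooth_zc.
apply: (@psmooth_param _ _ _ _ (fun s : X * R * R => zc s.1.1)) => s.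
exact: (@continuous_comp _ _ _ (fun s : X * R * R => s.1.1) (@zc R n) s (c11 s) (@continuous_zc _)).
Qed.

Lemma psmooth_twisted m lam V : smooth_on [set t : R | 0 < t] m V ->
  psmooth m (fun (s : X * R * R) (y : X) =>
    (s.1.2 * cos (phase lam s.1.1 y) - s.2 * sin (phase lam s.1.1 y)) * V (zc y)).
Proof.
move=> hV; have [hc hs] := smooth_on_cos_sin (R := R) m.
apply: psmoothM; last first.
  by apply: psmooth_comp hV _ _; [exact: psmooth_zc|move=> _ y; exact: zc_gt0].
apply: psmoothD.
  apply: psmoothM.
    apply: (@psmooth_param _ _ _ _ (fun s : X * R * R => s.1.2)) => s.
    by apply: (@continuous_comp _ _ _ fst snd); [exact: cvg_fst|exact: cvg_snd].
  by apply: psmooth_comp hc _ _ => //; exact: psmooth_phase.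
rewrite (_ : (fun _ _ => _) = (fun (s : X * R * R) (y : X) =>
  (-1 * s.2) * sin (phase lam s.1.1 y))); last first.
  by apply/funext => s; apply/funext => y; rewrite mulN1r mulNr.
apply: psmoothM; last by apply: psmooth_comp hs _ _ => //; exact: psmooth_phase.
apply: psmoothM; first exact: psmooth_cst.
by apply: (@psmooth_param _ _ _ _ (fun s : X * R * R => s.2)) => s; exact: cvg_snd.
Qed.

End TestFunctions.

Section CutOff.
Context {R : realType}.

Lemma is_derive_near_eq (f g : R -> R) (t a b : R) : (\near t, f t = g t) ->
  is_derive t (1 : R) f a -> is_derive t (1 : R) g b -> a = b.
Proof.
move=> fg fa [_ <-]; case: (near_eq_is_derive fg fa) => _ <- //.
Qed.

Lemma smooth_on_subset (D E : set R) m (f : R -> R) :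
  E `<=` D -> smooth_on D m f -> smooth_on E m f.
Proof.
move=> ED; elim: m f => [|m IH] f; first by move=> h x /ED; exact: h.
move=> [g [h1 h2]]; exists g; split; last exact: IH.
by move=> x /ED; exact: h1.
Qed.

Context {n : nat}.
Local Notation X := 'M[R]_(n, 4).

Lemma sqnorm_lt_zc (y : X) (a : R) : 0 < a <= 1 -> a^-1 < enorm y -> zc y < a.
Proof.
move=> /andP[a0 a1] ay; rewrite /zc -[ltRHS]invrK ltf_pV2 ?posrE ?invr_gt0 ?sqnorm1_gt0//.
have e1 : 1 <= enorm y by rewrite (le_trans _ (ltW ay))// invf_ge1.
have : sqnorm y = enorm y ^+ 2 by rewrite sqr_sqrtr// sqnorm_ge0.
move=> ->; rewrite (lt_le_trans ay)// expr2.
by rewrite (le_trans (ler_peMr _ e1)) ?(le_trans _ e1)// lerDr.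
Qed.

(* The eigenfunction G(z) is cut off outside {|w|^2 <= rho}, and twisted by    *)
(* the phase of the area increment from x to y.                                *)
Lemma exists_test_function (lam : 'rV[R]_3) (G G1 G2 : R -> R) (B kappa rho : R) :
  0 <= rho -> (forall t, 0 < t <= 1 -> `|G t| <= B) ->
  (forall m, smooth_on [set t : R | 0 < t] m G) ->
  (forall t : R, 0 < t -> is_derive t (1 : R) G (G1 t)) ->
  (forall t : R, 0 < t -> is_derive t (1 : R) G1 (G2 t)) ->
  (forall t : R, 0 < t -> 2 * t * (1 - t) * G2 t +
     (4 * (1 - t) - 4 * n%:R * t) * G1 t
     - 2^-1 * sqnorm lam * ((1 - t) / t) * G t = - kappa * G t) ->
  exists K : X * R * R -> X -> R,
  [/\ [/\ forall s, smooth (K s) /\ compactly_supported (K s),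
      forall s y, `|K s y| <= (`|s.1.2| + `|s.2|) * B,
      continuous (fun p => K p.1 p.2) &
      continuous (fun p => laplace_beltrami (@HP_metric R n) (K p.1) p.2)],
      exists2 M, 0 <= M & forall s y, M < enorm y ->
        K s y = 0 /\ laplace_beltrami (@HP_metric R n) (K s) y = 0,
      forall x p q y, sqnorm y <= rho -> K (x, p, q) y =
        (p * cos (phase lam x y) - q * sin (phase lam x y)) * G (zc y) &
      forall x p q, sqnorm x <= rho ->
        2^-1 * laplace_beltrami (@HP_metric R n) (K (x, p, q)) x =
        - kappa * (p * G (zc x))].
Proof.
move=> rho0 GB Gs hG1 hG2 ode.
pose c := (1 + rho)^-1.
have c0 : 0 < c by rewrite invr_gt0 ltr_pwDl.
have c1 : c <= 1 by rewrite invf_le1 ?ltr_pwDl// lerDl.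
have zcx (x : X) : sqnorm x <= rho -> c <= zc x.
  by move=> h; rewrite lef_pV2 ?posrE ?ltr_pwDl ?sqnorm_ge0// lerD2l.
have [chi [chis chi0 chi1 chi01]] := @exists_smooth_step R (c / 4) (c / 2) ltac:(lra).
have [d1 [hd1 [d2 [hd2 _]]]] := chis 2.
pose V t := chi t * G t.
pose V1 t := chi t * G1 t + G t * d1 t.
pose V2 t := chi t * G2 t + G1 t * d1 t + (G t * d2 t + d1 t * G1 t).
have hV1 (t : R) : 0 < t -> is_derive t (1 : R) V (V1 t).
  by move=> t0; apply: is_derive_prod; [exact: hd1|exact: hG1].
have hV2 (t : R) : 0 < t -> is_derive t (1 : R) V1 (V2 t).
  move=> t0; apply: is_deriveD; apply: is_derive_prod;
    solve [exact: hd1|exact: hG1|exact: hd2|exact: hG2].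
have Vs m : smooth_on [set t : R | 0 < t] m V.
  apply: smooth_onM => //.
  exact: smooth_on_subset (chis m).
have d1E t : c / 2 < t -> d1 t = 0.
  move=> ct.
  apply: (is_derive_near_eq (g := cst (1 : R)) _ (hd1 _ Logic.I) (is_derive_cst _ _ _)).
  by near=> u; rewrite chi1// ltW//; near: u; exact: lt_nbhsr.
have d2E t : c / 2 < t -> d2 t = 0.
  move=> ct.
  apply: (is_derive_near_eq (g := cst (0 : R)) _ (hd2 _ Logic.I) (is_derive_cst _ _ _)).
  by near=> u; rewrite d1E//; near: u; exact: lt_nbhsr.
pose K (s : X * R * R) (y : X) : R :=
  (s.1.2 * cos (phase lam s.1.1 y) - s.2 * sin (phase lam s.1.1 y)) * V (zc y).
have Ks m : psmooth m K by exact: psmooth_twisted.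
have K0 s y : (c / 4)^-1 < enorm y -> K s y = 0.
  move=> cy; rewrite /K /V chi0 ?mul0r ?mulr0//.
  by apply/ltW; apply: sqnorm_lt_zc => //; lra.
exists K; split.
- split.
  + move=> s; split; first exact: psmooth_smooth.
    by exists (c / 4)^-1 => y; exact: K0.
  + move=> [[x p] q] y; rewrite /K /V /= !normrM ler_pM ?mulr_ge0//.
      rewrite (le_trans (ler_normB _ _))// !normrM lerD//.
        by rewrite ler_piMr// ler_norml cos_geN1 cos_le1.
      by rewrite ler_piMr// ler_norml sin_geN1 sin_le1.
    have /andP[h0 h1] := chi01 (zc y).
    rewrite (ger0_norm h0) (le_trans (ler_piMl _ h1))//.
    by rewrite GB// zc_gt0 zc_le1.
  + exact: psmooth_continuous (Ks 0%N).
  + exact: psmooth_laplace_continuous (Ks 2%N).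
- exists (c / 4)^-1; first by rewrite invr_ge0; lra.
  move=> s y cy; split; first exact: K0.
  apply: laplace_beltrami_near0; near=> y'.
  rewrite /K /V chi0 ?mul0r ?mulr0// ltW//; near: y'.
  have zy : zc y < c / 4 by apply: sqnorm_lt_zc => //; lra.
  by apply: (@continuous_zc R n y [set t | t < c / 4]); exact: lt_nbhsl.
- move=> x p q y hy; rewrite /K /V /= chi1 ?mul1r//.
  have := zcx _ hy; lra.
- move=> x p q hx; have cx := zcx _ hx.
  have cz : c / 2 < zc x by lra.
  rewrite (laplace_twisted lam p q x hV1 hV2) /V2 /V1 /V.
  rewrite d1E// d2E// chi1 ?ltW// !mulr0 !mul0r !addr0 !mul1r.
  by rewrite ode ?zc_gt0//; ring.
Unshelve. all: by end_near. Qed.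

End CutOff.

Lemma heine (R : realType) (T V : pseudoMetricType R) (A : set T) (f : T -> V) :
  compact A -> {within A, continuous f} -> forall e : R, 0 < e ->
  exists2 delta : R, 0 < delta & forall x y, A x -> A y -> ball x delta y ->
    ball (f x) e (f y).
Proof.
move=> /compact_near_coveringP cA /subspace_continuousP cf e e0.
pose P (delta : R) (x : T) := A x ->
  forall y, A y -> ball x delta y -> ball (f x) e (f y).
have : \forall d \near (0 : R)^'+, A `<=` P d.
  apply: cA => x Ax.
  have e2 : 0 < e / 2 by rewrite divr_gt0.
  have /(cf x Ax) : nbhs (f x) (ball (f x) (e / 2)) by exact: nbhsx_ballx.
  rewrite /= => /nbhs_ballP [r /= r0 hr].
  have r2 : 0 < r / 2 by rewrite divr_gt0.
  exists (ball x (r / 2), [set d | 0 < d < r / 2]) => /=.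
    split; first exact: nbhsx_ballx.
    near=> d; apply/andP; split; near: d; first exact: nbhs_right_gt.
    exact: nbhs_right_lt.
  move=> [x' d] /= [xx' /andP[d0 dr]] Ax' y Ay x'y.
  have hx' : ball (f x) (e / 2) (f x').
    by apply: hr => //; apply: le_ball xx'; rewrite ler_pdivrMr// ler_pMr// ler1n.
  have hy : ball (f x) (e / 2) (f y).
    apply: hr => //; apply: (@ball_split _ _ x'); first exact: xx'.
    by apply: le_ball x'y; exact: ltW.
  by apply: (@ball_splitr _ _ (f x)).
move=> /nbhs_ballP [r /= r0 hr].
exists (r / 2); first by rewrite divr_gt0.
move=> x y Ax Ay; apply: (hr (r / 2)) => //=.
  by rewrite /ball /= sub0r normrN gtr0_norm ?divr_gt0// ltr_pdivrMr// ltr_pMr// ltr1n.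
by rewrite divr_gt0.
Unshelve. all: by end_near. Qed.

Section Boxes.
Context {R : realType} {m n : nat}.
Local Notation X := 'M[R]_(m, n).

Definition box (b : R) : set X := [set x | forall i j, `|x i j| <= b].

Lemma box_compact b : compact (box b).
Proof.
have cv : continuous (@vec_mx R m n).
  move=> v s /= /nbhs_ballP [e /= e0 es]; apply/nbhs_ballP; exists e => //= u [_ uv].
  by apply: es; split=> // i j; rewrite !mxE; exact: uv.
pose A : set 'rV[R]_(m * n) := [set v | forall i, `[-b, b]%classic (v ord0 i)].
have cA : compact A.
  apply: (@rV_compact _ _ (fun=> `[-b, b]%classic)) => i; exact: segment_compact.
have -> : box b = (@vec_mx R m n) @` A.
  apply/seteqP; split=> x /=.
    move=> hx; exists (mxvec x); last by rewrite mxvecK.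
    move=> k; case/mxvec_indexP: k => i j.
    by rewrite /= mxvecE in_itv /= -ler_norml; exact: hx.
  move=> [v vA <-] i j; rewrite mxE.
  by have := vA (mxvec_index i j); rewrite /= in_itv /= -ler_norml.
apply: (@continuous_compact _ _ (@vec_mx R m n)) => //.
exact: continuous_subspaceT cv.
Qed.

End Boxes.

Section Cells.
Context {R : realType}.

Lemma cells1 (b delta : R) : 0 < delta -> exists L (dec : 'I_L -> R),
  (forall g h v, dec g <= v < dec g + delta -> dec h <= v < dec h + delta -> g = h) /\
  (forall v, `|v| <= b -> exists g, dec g <= v < dec g + delta).
Proof.
move=> d0.
pose dec (g : nat) : R := - b + g%:R * delta.
exists (Num.truncn (2 * b / delta)).+1, (fun g => dec g); split.
  move=> g h v /andP[g1 g2] /andP[h1 h2]; apply/val_inj/eqP.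
  have lt (i j : nat) : dec i < dec j + delta -> (i <= j)%N.
    rewrite /dec -addrA ltrD2l -[X in _ + X]mul1r -mulrDl ltr_pM2r// natr1 ltr_nat.
    by rewrite ltnS.
  rewrite eqn_leq; apply/andP; split; apply: lt.
    exact: le_lt_trans h2.
  exact: le_lt_trans g2.
move=> v; rewrite ler_norml => /andP[v1 v2].
have vd : 0 <= (v + b) / delta by rewrite divr_ge0 ?(ltW d0)//; lra.
have tv : (Num.truncn ((v + b) / delta) < (Num.truncn (2 * b / delta)).+1)%N.
  rewrite ltnS; apply: le_truncn; rewrite ler_pM2r ?invr_gt0//; lra.
exists (Ordinal tv); rewrite /dec /=.
have /andP[h1 h2] := truncn_itv vd.
have vE : v + b = (v + b) / delta * delta by rewrite mulfVK// gt_eqF.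
set g := Num.truncn _ in h1 h2 *.
have l1 : g%:R * delta <= v + b by rewrite vE ler_pM2r.
have l2 : v + b < g.+1%:R * delta by rewrite [ltLHS]vE ltr_pM2r.
rewrite -natr1 mulrDl mul1r in l2.
by apply/andP; split; lra.
Qed.

Lemma cells n (b delta : R) : 0 < delta ->
  exists (T : finType) (dec : T -> 'M[R]_(n, 4) * R * R)
    (C : T -> set ('M[R]_(n, 4) * R * R)),
  [/\ forall g h s, C g s -> C h s -> g = h,
      forall s, box b s.1.1 -> `|s.1.2| <= b -> `|s.2| <= b -> exists g, C g s,
      forall g s, C g s -> ball s delta (dec g) &
      forall d (Omega : measurableType d) (xi : Omega -> 'M[R]_(n, 4) * R * R),
        (forall i j, measurable_fun setT (fun omega => (xi omega).1.1 i j)) ->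
        measurable_fun setT (fun omega => (xi omega).1.2) ->
        measurable_fun setT (fun omega => (xi omega).2) ->
        forall g, measurable [set omega | C g (xi omega)]].
Proof.
move=> d0; have [L [dec [dinj dcov]]] := cells1 b d0.
pose I1 (g : 'I_L) : set R := `[dec g, dec g + delta[%classic.
have I1E g v : I1 g v = (dec g <= v < dec g + delta) :> Prop.
  by rewrite /I1 /= in_itv.
pose T := ({ffun 'I_n * 'I_4 -> 'I_L} * 'I_L * 'I_L)%type.
exists T, (fun g : T => (\matrix_(i, j) dec (g.1.1 (i, j)), dec g.1.2, dec g.2)).
exists (fun (g : T) (s : 'M[R]_(n, 4) * R * R) => (forall i j, I1 (g.1.1 (i, j)) (s.1.1 i j)) /\
  I1 g.1.2 s.1.2 /\ I1 g.2 s.2); split.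
- move=> [[g1 g2] g3] [[h1 h2] h3] [[x p] q] /= [a1 [a2 a3]] [b1 [b2 b3]].
  rewrite !I1E in a2 a3 b2 b3; rewrite (dinj _ _ _ a2 b2) (dinj _ _ _ a3 b3).
  congr (_, _, _); apply/ffunP => -[i j].
  by have := a1 i j; have := b1 i j; rewrite !I1E => h h'; exact: dinj h' h.
- move=> [[x p] q] /= hx hp hq.
  have [g2 G2] := dcov p hp; have [g3 G3] := dcov q hq.
  have [g1 G1] := choice (fun ij : 'I_n * 'I_4 => dcov _ (hx ij.1 ij.2)).
  exists ([ffun ij => g1 ij], g2, g3); rewrite !I1E; split=> //= i j.
  by rewrite ffunE I1E; exact: (G1 (i, j)).
- have I1ball g v : I1 g v -> ball v delta (dec g).
    rewrite I1E => /andP[h1 h2]; rewrite /ball /= ltr_norml; apply/andP; split; lra.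
  move=> g [[x p] q] /= [h1 [h2 h3]]; split; first split => /=.
  + by split => // i j; rewrite mxE; exact: I1ball.
  + exact: I1ball.
  + exact: I1ball.
- move=> d Omega xi m1 m2 m3 g.
  have mI h (f : Omega -> R) : measurable_fun setT f -> measurable [set omega | I1 h (f omega)].
    move=> mf; rewrite -[X in measurable X]setTI; apply: mf => //.
    exact: measurable_itv.
  have -> : [set omega | (forall i j, I1 (g.1.1 (i, j)) ((xi omega).1.1 i j)) /\
      I1 g.1.2 (xi omega).1.2 /\ I1 g.2 (xi omega).2] =
    (\bigcap_(ij in [set: 'I_n * 'I_4]) [set omega | I1 (g.1.1 ij) ((xi omega).1.1 ij.1 ij.2)])
    `&` ([set omega | I1 g.1.2 (xi omega).1.2] `&` [set omega | I1 g.2 (xi omega).2]).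
    apply/seteqP; split => omega /= [h1 [h2 h3]]; split => //.
      by move=> [i j] _; exact: h1.
    by move=> i j; exact: (h1 (i, j)).
  apply: measurableI; last by apply: measurableI; exact: mI.
  apply: fin_bigcap_measurable; first exact: finite_finset.
  by move=> ij _; exact: mI.
Qed.

End Cells.

Section Telescope.
Context {R : realType}.

Lemma expRN_taylor (x : R) : 0 <= x -> `|1 - expR (- x) - x| <= x ^+ 2.
Proof.
move=> x0; have h1 := expR_ge1Dx (- x); have h2 := expR_ge1Dx x.
have h3 : expR (- x) * expR x = 1 by rewrite -expRD addNr expR0.
have e0 := expR_gt0 (- x).
rewrite ler_norml; apply/andP; split; last by rewrite (le_trans _ (sqr_ge0 _)) //; lra.
nra.
Qed.

(* The process is killed when E first fails; this costs at most one term.     *)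
Lemma telescope_killed (N : nat) (kap h B eta : R) (E : nat -> bool)
    (a b d Y : nat -> R) : 0 <= kap -> 0 <= h -> 0 <= B -> 0 <= eta ->
  (forall k, (k < N)%N -> E k.+1 -> E k) ->
  (forall k, (k < N)%N -> E k.+1 -> b k = a k.+1) ->
  (forall k, (k < N)%N -> E k -> `|b k| <= B) ->
  (forall k, (k < N)%N -> E k -> `|a k| <= B) ->
  (forall k, (k < N)%N -> E k ->
    `|b k - a k + kap * h * a k - d k| <= eta) ->
  (forall k, (k < N)%N -> ~~ E k -> d k = 0) ->
  (forall k, Y k = if E k then expR (kap * h * k%:R) * a k else 0) ->
  `|Y N - Y 0%N - \sum_(k < N) expR (kap * h * k.+1%:R) * d k| <=
    expR (kap * h * N%:R) *
      (B * (~~ E N)%:R + N%:R * (eta + (kap * h) ^+ 2 * B)).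
Proof.
move=> kap0 h0 B0 eta0 Edec bE bB aB hd dE YE.
set c := eta + (kap * h) ^+ 2 * B.
have c0 : 0 <= c by rewrite addr_ge0// mulr_ge0// sqr_ge0.
have kh0 : 0 <= kap * h by rewrite mulr_ge0.
suff H k : (k <= N)%N ->
    `|Y k - Y 0%N - \sum_(j < k) expR (kap * h * j.+1%:R) * d j| <=
    expR (kap * h * N%:R) * (B * (~~ E k)%:R + k%:R * c) by exact: H.
elim: k => [|k IH] kN.
  rewrite big_ord0 subrr subr0 normr0 mulr_ge0 ?expR_ge0// mul0r addr0.
  by rewrite mulr_ge0.
rewrite big_ord_recr /=.
have -> : Y k.+1 - Y 0%N - (\sum_(i < k) expR (kap * h * i.+1%:R) * d i +
    expR (kap * h * k.+1%:R) * d k) =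
  (Y k - Y 0%N - \sum_(i < k) expR (kap * h * i.+1%:R) * d i) +
  (Y k.+1 - Y k - expR (kap * h * k.+1%:R) * d k) by ring.
have {}IH := IH (ltnW kN).
apply: le_trans (ler_normD _ _) _.
rewrite [k.+1%:R * c](_ : _ = k%:R * c + c); last by rewrite -natr1 mulrDl mul1r.
set e := expR (kap * h * N%:R) in IH *.
have e0 : 0 <= e by exact: expR_ge0.
have ek : expR (kap * h * k.+1%:R) <= e.
  by rewrite ler_expR ler_wpM2l// ler_nat.
case Ek : (E k); last first.
  have Ek1 : E k.+1 = false by apply/negP => /(Edec _ kN); rewrite Ek.
  have -> : Y k.+1 - Y k - expR (kap * h * k.+1%:R) * d k = 0.
    by rewrite (YE k) (YE k.+1) Ek1 Ek dE ?Ek// mulr0 !subrr.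
  rewrite normr0 addr0; apply: (le_trans IH).
  by rewrite Ek Ek1 ler_wpM2l// lerD2l lerDl.
have step : `|expR (kap * h * k.+1%:R) * b k - expR (kap * h * k%:R) * a k -
    expR (kap * h * k.+1%:R) * d k| <= e * c.
  have -> : expR (kap * h * k%:R) = expR (kap * h * k.+1%:R) * expR (- (kap * h)).
    by rewrite -expRD -natr1; congr expR; ring.
  have -> : expR (kap * h * k.+1%:R) * b k -
      expR (kap * h * k.+1%:R) * expR (- (kap * h)) * a k -
      expR (kap * h * k.+1%:R) * d k = expR (kap * h * k.+1%:R) *
      ((b k - a k + kap * h * a k - d k) +
       (1 - expR (- (kap * h)) - kap * h) * a k) by ring.
  rewrite normrM ger0_norm ?expR_ge0// ler_pM ?expR_ge0//.
  rewrite (le_trans (ler_normD _ _))// lerD ?hd// normrM ler_pM ?aB//.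
  exact: expRN_taylor.
case Ek1 : (E k.+1).
  have -> : Y k.+1 - Y k = expR (kap * h * k.+1%:R) * b k - expR (kap * h * k%:R) * a k.
    by rewrite (YE k) (YE k.+1) Ek1 Ek (bE _ kN Ek1).
  move: IH; rewrite Ek /= mulr0n mulr0 !add0r => IH.
  by rewrite mulrDr lerD.
have -> : Y k.+1 - Y k - expR (kap * h * k.+1%:R) * d k =
    (expR (kap * h * k.+1%:R) * b k - expR (kap * h * k%:R) * a k -
    expR (kap * h * k.+1%:R) * d k) - expR (kap * h * k.+1%:R) * b k.
  by rewrite (YE k) (YE k.+1) Ek1 Ek; ring.
apply: le_trans (lerD (lexx _) (ler_normB _ _)) _.
have hb : `|expR (kap * h * k.+1%:R) * b k| <= e * B.
  by rewrite normrM ger0_norm ?expR_ge0// ler_pM ?expR_ge0// bB.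
move: IH; rewrite Ek /= mulr0n mulr0 add0r => IH.
rewrite /= mulr1n mulr1.
apply: (le_trans (lerD IH (lerD step hb))).
by rewrite !mulrDr addrA addrC lerD2l// addrC.
Qed.

End Telescope.

Section Increments.
Context {R : realType}.
Notation mu := (@lebesgue_measure R).

Lemma integral_increment (phi : R -> R) (s s' c eps : R) :
  {within `[0, +oo[, continuous phi} -> 0 <= s -> s <= s' ->
  (forall u, s <= u <= s' -> `|phi u - c| <= eps) ->
  `|\int[mu]_(u in `[0, s']) phi u - \int[mu]_(u in `[0, s]) phi u - (s' - s) * c|
    <= (s' - s) * eps.
Proof.
move=> cphi s0 ss' hphi.
have cint a b : 0 <= a -> mu.-integrable `[a, b] (EFin \o phi).
  move=> a0; apply: continuous_compact_integrable; first exact: segment_compact.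
  apply: continuous_subspaceW cphi => u /=; rewrite !in_itv /= => /andP[au _].
  by rewrite andbT (le_trans a0).
rewrite Rintegral_itvB//; last exact: cint.
have mI : measurable (`]s, s']%classic : set R) by exact: measurable_itv.
have sub : (`]s, s']%classic : set R) `<=` `[s, s']%classic.
  by move=> u /=; rewrite !in_itv /= => /andP[/ltW -> ->].
have iphi : mu.-integrable `]s, s'] (EFin \o phi).
  by apply: integrableS (cint s s' s0) => // u; exact: sub.
have icst k : mu.-integrable `]s, s'] (EFin \o cst k).
  have h : mu.-integrable `[s, s'] (EFin \o cst k).
    apply: continuous_compact_integrable; first exact: segment_compact.
    by apply: continuous_subspaceT => x; exact: cst_continuous.
  by apply: integrableS h => // u; exact: sub.
have fs : fine (mu `]s, s']) = s' - s.
  rewrite lebesgue_measure_itv /= lte_fin; case: ltP => //=.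
  by move=> s's; apply/eqP; rewrite eq_sym subr_eq0 eq_le s's ss'.
have E k : (s' - s) * k = \int[mu]_(u in `]s, s']) cst k u.
  by rewrite Rintegral_cst// fs mulrC.
have hB := @RintegralB _ _ R mu _ phi (cst c) mI iphi (icst c).
rewrite (E c) (E eps) -hB.
have iB : mu.-integrable `]s, s'] (EFin \o (fun u => phi u - c)).
  have := @integrableB _ _ R mu _ mI _ _ iphi (icst c).
  by apply: eq_integrable => // u _; rewrite /= EFinB.
apply: (le_trans (@le_normr_Rintegral _ _ R mu _ _ mI iB)).
apply: (@le_Rintegral _ _ R mu _ _ (cst eps) mI
  (@integrable_norm _ _ R mu _ _ iB) (icst eps)).
by move=> u /=; rewrite in_itv /= => /andP[u1 u2]; apply: hphi; rewrite u2 ltW.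
Qed.

End Increments.

Section Moduli.
Context {R : realType} {n : nat}.
Local Notation X := 'M[R]_(n, 4).
Local Notation S := (X * R * R)%type.

Definition sbox (b : R) : set S :=
  [set s | box b s.1.1 /\ `|s.1.2| <= b /\ `|s.2| <= b].

Lemma sbox_compact b : compact (sbox b `*` (box b : set X)).
Proof.
apply: compact_setX; last exact: box_compact.
have -> : sbox b = ((box b : set X) `*` `[-b, b]) `*` `[-b, b].
  apply/seteqP; split=> -[[x p] q] /=; rewrite /sbox /= !in_itv /= -!ler_norml.
    by move=> [? []].
  by move=> [[]].
apply: compact_setX; last exact: segment_compact.
by apply: compact_setX; [exact: box_compact|exact: segment_compact].
Qed.

Lemma le_enorm (x : X) i j : `|x i j| <= enorm x.
Proof.
rewrite -sqrtr_sqr ler_sqrt ?sqnorm_ge0//.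
rewrite /sqnorm (bigD1 i)//= (bigD1 j)//= -addrA lerDl addr_ge0//.
  by apply: sumr_ge0 => ? _; rewrite sqr_ge0.
by do 2!apply: sumr_ge0 => ? _; rewrite ?sqr_ge0.
Qed.

Lemma box_ball (b : R) (x y : X) : box b x -> ball x 1 y -> box (b + 1) y.
Proof.
move=> hx [_ h] i j; have := h i j; rewrite /ball /= => hij.
have := hx i j; have := ler_normB (x i j) (x i j - y i j).
rewrite subKr => h1 h2; lra.
Qed.

Lemma sbox_ball (b : R) (s s' : S) : sbox b s -> ball s 1 s' -> sbox (b + 1) s'.
Proof.
move: s s' => [[x p] q] [[x' p'] q'] [/= hx [hp hq]] [[/= bx bp] bq].
split; first exact: box_ball bx.
have H (u v : R) : `|u| <= b -> ball u 1 v -> `|v| <= b + 1.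
  rewrite /ball /= => h1 h2; have := ler_normB u (u - v); rewrite subKr; lra.
by split; [exact: H bp|exact: H bq].
Qed.

Lemma sboxS (b c : R) : b <= c -> sbox b `<=` sbox c.
Proof.
move=> bc [[x p] q] [/= hx [hp hq]]; split; [move=> i j|split] => /=;
  apply: le_trans bc => //; exact: hx.
Qed.

Lemma boxS (b c : R) : b <= c -> (box b : set X) `<=` box c.
Proof. by move=> bc x hx i j; apply: le_trans bc; exact: hx. Qed.

Variable f : S -> X -> R.
Hypothesis fc : continuous (fun p : S * X => f p.1 p.2).

Lemma modulus_local (b eps : R) : 0 < eps -> exists2 delta, 0 < delta &
  forall s s' y y', sbox b s -> box b y -> ball s delta s' -> ball y delta y' ->
    `|f s y - f s' y'| <= eps.
Proof.
move=> e0.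
have [d d0 hd] := heine (@sbox_compact (b + 1)) (@continuous_subspaceT _ _ _ _ fc) e0.
exists (Num.min d 1); first by rewrite lt_min d0 ltr01.
move=> s s' y y' hs hy hss' hyy'.
have b1 : b <= b + 1 by lra.
have hss1 : ball s 1 s' by apply: le_ball hss'; rewrite ge_min lexx orbT.
have hyy1 : ball y 1 y' by apply: le_ball hyy'; rewrite ge_min lexx orbT.
have := hd (s, y) (s', y'); rewrite /ball /= => h; apply: ltW; apply: h.
- by split=> /=; [exact: sboxS hs|exact: boxS hy].
- by split=> /=; [exact: sbox_ball hss1|exact: box_ball hyy1].
- split; apply: le_ball; try exact: hss'; try exact: hyy'.
    by rewrite ge_min lexx.
  by rewrite ge_min lexx.
Qed.

Variable M : R.
Hypothesis M0 : 0 <= M.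
Hypothesis fM : forall s y, M < enorm y -> f s y = 0.

Lemma modulus_param (b eps : R) : 0 < eps -> exists2 delta, 0 < delta &
  forall s s' y, sbox b s -> ball s delta s' -> `|f s y - f s' y| <= eps.
Proof.
move=> e0; have [d d0 hd] := modulus_local (Num.max b M) e0.
exists d => // s s' y hs hss'.
have [My|yM] := ltP M (enorm y); first by rewrite !fM// subrr normr0 ltW.
apply: hd => //.
- by apply: sboxS hs; rewrite le_max lexx.
- move=> i j; apply: (le_trans (le_enorm y i j)).
  by rewrite (le_trans yM)// le_max lexx orbT.
- exact: ballxx.
Qed.

Lemma bounded_param (b : R) : exists C, forall s y, sbox b s -> `|f s y| <= C.
Proof.
have cK := @sbox_compact (Num.max b M).
have [C [_ HC]] := compact_bounded (continuous_compact (continuous_subspaceT fc) cK).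
exists (Num.max 0 (C + 1)) => s y hs.
have [My|yM] := ltP M (enorm y); first by rewrite fM// normr0 le_max lexx.
rewrite le_max; apply/orP; right; apply: (HC (C + 1)); first by lra.
exists (s, y) => //; split=> /=.
  by apply: sboxS hs; rewrite le_max lexx.
move=> i j; apply: (le_trans (le_enorm y i j)).
by rewrite (le_trans yM)// le_max lexx orbT.
Qed.

End Moduli.

Section EntrywiseMeasurable.
Context {R : realType} {d : measure_display} {Omega : measurableType d} {n : nat}.
Local Notation X := 'M[R]_(n, 4).

Definition mx_measurable (x : Omega -> X) : Prop :=
  forall i j, measurable_fun setT (fun omega => x omega i j).

Variables x y : Omega -> X.
Hypotheses (mx : mx_measurable x) (my : mx_measurable y).

Lemma measurable_sqnorm : measurable_fun setT (fun omega => sqnorm (x omega)).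
Proof.
apply: measurable_sum => i; apply: measurable_sum => j.
by apply: measurable_funX; exact: mx.
Qed.

Lemma measurable_zc : measurable_fun setT (fun omega => zc (x omega)).
Proof.
have -> : (fun omega => zc (x omega)) = (fun omega => (1 + sqnorm (x omega)) `^ (-1)).
  by apply/funext => omega; rewrite powR_inv1// ltW// sqnorm1_gt0.
apply: (@measurableT_comp _ _ _ _ _ _ (fun t : R => t `^ (-1))).
  exact: measurable_powR.
by apply: measurable_funD => //; exact: measurable_sqnorm.
Qed.

Lemma measurable_lunit q : mx_measurable (fun omega => lunit q (x omega)).
Proof.
move=> i j.
have mN j' : measurable_fun setT (fun omega => - x omega i j').
  by apply: measurableT_comp => //; exact: mx.
have E : (fun omega => lunit q (x omega) i j) = (fun omega =>
    (nth [::] [:: [:: x omega i 0; x omega i 1; x omega i 2; x omega i 3];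
    [:: - x omega i 1; x omega i 0; - x omega i 3; x omega i 2];
    [:: - x omega i 2; x omega i 3; x omega i 0; - x omega i 1];
    [:: - x omega i 3; - x omega i 2; x omega i 1; x omega i 0]] q)`_j).
  by apply/funext => omega; rewrite mxE.
rewrite {}E; elim/ord4P: q; elim/ord4P: j; try exact: mN; exact: mx.
Qed.

Lemma measurable_axis lam : mx_measurable (fun omega => axis lam (x omega)).
Proof.
move=> i j.
have -> : (fun omega => axis lam (x omega) i j) = (fun omega =>
    lam 0 0 * lunit 1 (x omega) i j + lam 0 1 * lunit 2 (x omega) i j +
    lam 0 2 * lunit 3 (x omega) i j).
  by apply/funext => omega; rewrite /axis !mxE.
by apply: measurable_funD; [apply: measurable_funD|];
  apply: measurable_funM => //; exact: measurable_lunit.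
Qed.

End EntrywiseMeasurable.

Section PhaseMeasurable.
Context {R : realType} {d : measure_display} {Omega : measurableType d} {n : nat}.

Lemma measurable_phase lam (x y : Omega -> 'M[R]_(n, 4)) :
  mx_measurable x -> mx_measurable y ->
  measurable_fun setT (fun omega => phase lam (x omega) (y omega)).
Proof.
move=> mx my; apply: measurable_funM => //; apply: measurable_funM.
  apply: measurable_sum => i; apply: measurable_sum => j.
  by apply: measurable_funM; [exact: measurable_axis|exact: my].
by apply: measurable_funD; exact: measurable_zc.
Qed.

End PhaseMeasurable.

Section DiscretePath.
Context {R : realType} {n : nat}.
Local Notation X := 'M[R]_(n, 4).
Variables (lam : 'rV[R]_3) (theta rho T : R) (N : nat).
Implicit Types (W : R -> X).

Definition mesh (k : nat) : R := T / N%:R * k%:R.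

Definition acc_phase W (k : nat) : R :=
  theta + \sum_(j < k) phase lam (W (mesh j)) (W (mesh j.+1)).

Definition confined W (k : nat) : bool :=
  [forall j : 'I_k.+1, sqnorm (W (mesh j)) <= rho].

Lemma acc_phaseS W k : acc_phase W k.+1 =
  acc_phase W k + phase lam (W (mesh k)) (W (mesh k.+1)).
Proof. by rewrite /acc_phase big_ord_recr addrA. Qed.

Lemma confinedP W k :
  reflect (forall j, (j <= k)%N -> sqnorm (W (mesh j)) <= rho) (confined W k).
Proof.
apply: (iffP forallP) => [h j jk|h j]; first by have := h (Ordinal (jk : (j < k.+1)%N)).
by apply: h; rewrite -ltnS.
Qed.

Lemma confinedS W k : confined W k.+1 -> confined W k.
Proof. by move=> /confinedP h; apply/confinedP => j jk; apply: h; rewrite ltnW. Qed.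

Definition state W k : X * R * R :=
  (W (mesh k), cos (acc_phase W k), sin (acc_phase W k)).

Lemma mesh_ge0 k : 0 <= T -> 0 <= mesh k.
Proof. by move=> T0; rewrite /mesh mulr_ge0// divr_ge0. Qed.

Lemma mesh_le j k : 0 <= T -> (j <= k)%N -> mesh j <= mesh k.
Proof. by move=> T0 jk; rewrite /mesh ler_wpM2l ?divr_ge0// ler_nat. Qed.

Context {d : measure_display} {Omega : measurableType d}.
Variable w : R -> Omega -> X.

Lemma measurable_acc_phase k : (forall j, (j <= k)%N -> mx_measurable (w (mesh j))) ->
  measurable_fun setT (fun omega => acc_phase (w^~ omega) k).
Proof.
elim: k => [|k IH] h.
  rewrite (_ : (fun _ => _) = cst theta) //; apply/funext => omega.
  by rewrite /acc_phase big_ord0 addr0.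
under eq_fun do rewrite acc_phaseS.
apply: measurable_funD; first by apply: IH => j jk; apply: h; rewrite ltnW.
by apply: measurable_phase; apply: h.
Qed.

Lemma measurable_confined k : (forall j, (j <= k)%N -> mx_measurable (w (mesh j))) ->
  measurable [set omega | confined (w^~ omega) k].
Proof.
move=> h.
have -> : [set omega | confined (w^~ omega) k] =
    \bigcap_(j in [set: 'I_k.+1]) [set omega | sqnorm (w (mesh j) omega) <= rho].
  apply/seteqP; split => omega /=; first by move=> /forallP c j _; exact: c.
  by move=> c; apply/forallP => j; exact: c.
apply: fin_bigcap_measurable; first exact: finite_finset.
move=> j _; have := @measurable_sqnorm _ _ _ _ (w (mesh j)) (h _ _).
rewrite -ltnS => /(_ (ltn_ord j)) m.
have -> : [set omega | sqnorm (w (mesh j) omega) <= rho] =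
  setT `&` (fun omega => sqnorm (w (mesh j) omega)) @^-1` `]-oo, rho].
  by rewrite setTI; apply/seteqP; split => omega /=; rewrite in_itv.
exact: m.
Qed.

End DiscretePath.

Section Filtrations.
Context {R : realType} {d : measure_display} {Omega : measurableType d}.

Lemma filtration_measurable (F : R -> set (set Omega)) s (A : set Omega) :
  filtration F -> 0 <= s ->
  measurable (A : set (g_sigma_algebraType (F s))) -> F s A.
Proof.
move=> [h _ _] s0; have sF := h s s0.
by rewrite /measurable /= sigma_algebra_id.
Qed.

Lemma adapted_measurable (F : R -> set (set Omega)) (f : R -> Omega -> R) s u :
  filtration F -> adapted F f -> 0 <= s -> s <= u ->
  measurable_fun (setT : set (g_sigma_algebraType (F u)))
    (f s : g_sigma_algebraType (F u) -> R).
Proof.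
move=> [_ _ h] fF s0 su _ B mB; rewrite setTI.
by apply: sub_sigma_algebra; apply: (h s u s0 su); exact: fF.
Qed.

End Filtrations.

Section Centered.
Context {R : realType} {d : measure_display} {Omega : measurableType d}.
Variable P : probability Omega R.

Definition centered (f : Omega -> R) : Prop :=
  P.-integrable setT (EFin \o f) /\ (\int[P]_omega (f omega)%:E = 0)%E.

Lemma centered0 : centered (fun=> 0).
Proof.
split; last by rewrite integral0.
exact: (finite_measure_integrable_cst P 0).
Qed.

Lemma centeredD f g : centered f -> centered g ->
  centered (fun omega => f omega + g omega).
Proof.
move=> [fi f0] [gi g0].
have E : EFin \o (fun omega => f omega + g omega) = ((EFin \o f) \+ (EFin \o g))%E.
  by apply/funext.
split; first by rewrite E; exact: integrableD.
rewrite -[LHS]/(\int[P]_omega (EFin \o (fun omega => (f omega + g omega)%R)) omega)%E E.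
by rewrite integralD// f0 g0 adde0.
Qed.

Lemma centeredZ c f : centered f -> centered (fun omega => c * f omega).
Proof.
move=> [fi f0].
have E : EFin \o (fun omega => c * f omega) = (fun omega => c%:E * (EFin \o f) omega)%E.
  by apply/funext.
split; first by rewrite E; exact: integrableZl.
rewrite -[LHS]/(\int[P]_omega (EFin \o (fun omega => (c * f omega)%R)) omega)%E E.
by rewrite integralZl// f0 mule0.
Qed.

Lemma centered_sum I (r : seq I) (f : I -> Omega -> R) :
  (forall i, centered (f i)) -> centered (fun omega => \sum_(i <- r) f i omega).
Proof.
move=> h; elim: r => [|i r IH].
  by under [X in centered X]eq_fun do rewrite big_nil; exact: centered0.
by under [X in centered X]eq_fun do rewrite big_cons; exact: centeredD.
Qed.

Lemma centered_martingale (F : R -> set (set Omega)) M s t A :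
  filtration F -> martingale P F M -> 0 <= s -> s <= t -> F s A ->
  centered (fun omega => M t omega * \1_A omega - M s omega * \1_A omega).
Proof.
move=> [_ Fm _] [_ Mi Me] s0 st FA.
have mA : measurable A by exact: Fm FA.
have iM u : 0 <= u -> P.-integrable setT (EFin \o (fun omega => M u omega * \1_A omega)).
  move=> u0; have h : P.-integrable A (EFin \o M u).
    by apply: integrableS (Mi u u0).
  move: h; rewrite integrable_mkcond// => h.
  apply: eq_integrable h => // omega _.
  rewrite restrict_EFin /= /patch indicE; case: ifP => //=.
    by rewrite mulr1.
  by rewrite mulr0.
have t0 := le_trans s0 st.
have E u : 0 <= u -> (\int[P]_omega (M u omega * \1_A omega)%:E =
    \int[P]_(omega in A) (M u omega)%:E)%E.
  move=> u0; rewrite [RHS]integral_mkcond; apply: eq_integral => omega _.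
  rewrite /patch indicE; case: ifP => //=; first by rewrite mulr1.
  by rewrite mulr0.
split.
  have := integrableB measurableT (iM t t0) (iM s s0).
  by apply: eq_integrable => // omega _; rewrite /= EFinB.
under eq_integral do rewrite EFinB.
have fin : (\int[P]_(omega in A) (M s omega)%:E)%E \is a fin_num.
  by rewrite -E//; exact: integrable_fin_num (iM s s0).
rewrite (integralB measurableT (iM t t0) (iM s s0)) /=.
by rewrite (E t t0) (E s s0) (Me s t s0 st A FA) subee.
Qed.

End Centered.

Section Discretization.
Context {R : realType} {n : nat} {d : measure_display} {Omega : measurableType d}.
Local Notation X := 'M[R]_(n, 4).
Variables (P : probability Omega R) (F : R -> set (set Omega)) (w : R -> Omega -> X).
Variables (lam : 'rV[R]_3) (theta kap B rho T : R) (G : R -> R).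
Variable K : X * R * R -> X -> R.
Hypothesis hw : HP_brownian P F w.
Hypotheses (T0 : 0 < T) (rho0 : 0 <= rho) (kap0 : 0 <= kap) (B0 : 0 <= B).
Hypothesis GB : forall t, 0 < t <= 1 -> `|G t| <= B.
Let LK s y := 2^-1 * laplace_beltrami (@HP_metric R n) (K s) y.
Hypothesis Ksmooth : forall s, smooth (K s) /\ compactly_supported (K s).
Hypothesis KB : forall s y, `|K s y| <= (`|s.1.2| + `|s.2|) * B.
Hypothesis Kc : continuous (fun p => K p.1 p.2).
Hypothesis LKc : continuous (fun p => LK p.1 p.2).
Variable M : R.
Hypothesis KM : forall s y, M < enorm y -> K s y = 0.
Hypothesis LKM : forall s y, M < enorm y -> LK s y = 0.
Hypothesis KE : forall x p q y, sqnorm y <= rho -> K (x, p, q) y =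
  (p * cos (phase lam x y) - q * sin (phase lam x y)) * G (zc y).
Hypothesis LKE : forall x p q, sqnorm x <= rho ->
  LK (x, p, q) x = - kap * (p * G (zc x)).

Let mart g t omega := K g (w t omega) -
  \int[lebesgue_measure]_(u in `[0, t]) LK g (w u omega).

Lemma martingale_test g : martingale P F (mart g).
Proof. by case: hw => _ _ _; apply; case: (Ksmooth g). Qed.

(* The total increment of the frozen martingales along the partition.         *)
Definition frozen_sum N (J : finType) (dec : J -> X * R * R)
    (C : J -> set (X * R * R)) omega : R :=
  \sum_(k < N) expR (kap * (T / N%:R) * k.+1%:R) * \sum_(g : J)
    (mart (dec g) (mesh T N k.+1) omega *
       \1_[set omega | confined rho T N (w^~ omega) k /\
                       C g (state lam theta T N (w^~ omega) k)] omega -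
     mart (dec g) (mesh T N k) omega *
       \1_[set omega | confined rho T N (w^~ omega) k /\
                       C g (state lam theta T N (w^~ omega) k)] omega).

Lemma frozen_sum_centered N (J : finType) dec (C : J -> set (X * R * R)) :
  (forall d (O : measurableType d) (xi : O -> X * R * R),
        (forall i j, measurable_fun setT (fun omega => (xi omega).1.1 i j)) ->
        measurable_fun setT (fun omega => (xi omega).1.2) ->
        measurable_fun setT (fun omega => (xi omega).2) ->
        forall g, measurable [set omega | C g (xi omega)]) ->
  centered P (frozen_sum N dec C).
Proof.
move=> mC; have [filt wF _ _] := hw.
apply: centered_sum => k; apply: centeredZ; apply: centered_sum => g.
apply: (centered_martingale filt (martingale_test (dec g))).
- by apply: mesh_ge0; exact: ltW.
- by apply: mesh_le; [exact: ltW|].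
have k0 : 0 <= mesh T N k by apply: mesh_ge0; exact: ltW.
apply: filtration_measurable => //.
have mw j : (j <= k)%N -> mx_measurable (w (mesh T N j) :
    g_sigma_algebraType (F (mesh T N k)) -> X).
  move=> jk i i'; have := @adapted_measurable _ _ _ F (fun t omega => w t omega i i')
    (mesh T N j) (mesh T N k) filt (wF i i').
  by apply; [apply: mesh_ge0; exact: ltW|apply: mesh_le => //; exact: ltW].
have mA := @measurable_acc_phase R n lam theta T N _
  (g_sigma_algebraType (F (mesh T N k))) w k mw.
apply: measurableI.
  exact: (@measurable_confined R n rho T N _ (g_sigma_algebraType (F (mesh T N k))) w k mw).
apply: (mC _ (g_sigma_algebraType (F (mesh T N k)))
  (fun omega => state lam theta T N (w^~ omega) k)) => /=.
- by move=> i j; exact: mw.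
- by apply: (@measurableT_comp _ _ _ _ _ _ (@cos R)) => //; exact: continuous_measurable_fun (@continuous_cos R).
- by apply: (@measurableT_comp _ _ _ _ _ _ (@sin R)) => //; exact: continuous_measurable_fun (@continuous_sin R).
Qed.

Definition disc_error N D omega : R :=
  expR (kap * T) * (cos (acc_phase lam theta T N (w^~ omega) N) * G (zc (w T omega)))
  - cos theta * G 1 - D omega.

Lemma disc_error_bound N (J : finType) (dec : J -> X * R * R)
    (C : J -> set (X * R * R)) (eL : R) omega :
  (0 < N)%N -> 0 <= eL ->
  w 0 omega = 0 -> {within `[0, +oo[, continuous (fun t => w t omega)} ->
  (forall g h s, C g s -> C h s -> g = h) ->
  (forall k, (k < N)%N -> confined rho T N (w^~ omega) k ->
    exists2 g, C g (state lam theta T N (w^~ omega) k) &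
    (forall y, `|K (state lam theta T N (w^~ omega) k) y - K (dec g) y|
       <= N%:R^-1 ^+ 2) /\
    forall u, mesh T N k <= u <= mesh T N k.+1 ->
      `|LK (dec g) (w u omega) -
        LK (state lam theta T N (w^~ omega) k) (w (mesh T N k) omega)| <= eL) ->
  `|disc_error N (frozen_sum N dec C) omega| <=
    4 * B * expR (kap * T) * (~~ confined rho T N (w^~ omega) N)%:R +
    expR (kap * T) * (2 * N%:R^-1 + T * eL + (kap * T) ^+ 2 * (2 * B) * N%:R^-1).
Proof.
move=> N0 eL0 w0 cw Cinj hstep.
set W := w^~ omega; pose h := T / N%:R.
have N0R : 0 < N%:R :> R by rewrite ltr0n.
have h0 : 0 <= h by rewrite divr_ge0// ltW.
pose xi k := state lam theta T N W k.
pose a k := K (xi k) (W (mesh T N k)).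
pose b k := K (xi k) (W (mesh T N k.+1)).
pose dd k := \sum_(g : J) (mart (dec g) (mesh T N k.+1) omega *
       \1_[set omega | confined rho T N (w^~ omega) k /\
                       C g (state lam theta T N (w^~ omega) k)] omega -
     mart (dec g) (mesh T N k) omega *
       \1_[set omega | confined rho T N (w^~ omega) k /\
                       C g (state lam theta T N (w^~ omega) k)] omega).
pose Y k := if confined rho T N W k then expR (kap * h * k%:R) * a k else 0.
have aE k : confined rho T N W k -> a k = cos (acc_phase lam theta T N W k) * G (zc (W (mesh T N k))).
  move=> /confinedP ck; rewrite /a /xi /state KE ?ck//.
  by rewrite phase_diag cos0 sin0 mulr1 mulr0 subr0.
have tele := @telescope_killed R N kap h (2 * B) (2 * N%:R^-1 ^+ 2 + h * eL)
  (confined rho T N W) a b dd Y kap0 h0.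
have KB2 k y : `|K (xi k) y| <= 2 * B.
  apply: (le_trans (KB _ _)); rewrite ler_wpM2r// -[2]/(1 + 1) lerD//=.
    by rewrite ler_norml cos_geN1 cos_le1.
  by rewrite ler_norml sin_geN1 sin_le1.
have {}tele : `|Y N - Y 0%N - \sum_(k < N) expR (kap * h * k.+1%:R) * dd k| <=
    expR (kap * h * N%:R) * (2 * B * (~~ confined rho T N W N)%:R +
      N%:R * (2 * N%:R^-1 ^+ 2 + h * eL + (kap * h) ^+ 2 * (2 * B))).
  apply: tele => //.
  - by rewrite mulr_ge0.
  - by rewrite addr_ge0// mulr_ge0// sqr_ge0.
  - by move=> k _; exact: confinedS.
  - move=> k kN ck1; rewrite aE// /b /xi /state KE; last by move/confinedP: ck1; apply.
    by rewrite acc_phaseS cosD.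
  - by move=> k _ _; exact: KB2.
  - by move=> k _ _; exact: KB2.
  - move=> k kN ck; have [g Cg [hK hL]] := hstep k kN ck.
    have -> : dd k = mart (dec g) (mesh T N k.+1) omega - mart (dec g) (mesh T N k) omega.
      rewrite /dd (bigD1 g)//= big1 ?addr0.
        by rewrite indicE mem_set ?mulr1.
      move=> g' gg'; rewrite indicE memNset ?mulr0 ?subrr// => -[_ Cg'].
      by move/eqP: gg'; apply; exact: Cinj Cg.
    have cphi : {within `[0, +oo[, continuous (fun u => LK (dec g) (w u omega))}.
      have cL : continuous (LK (dec g)).
        exact: (@continuous_section _ _ _ (fun p : X * R * R * X => LK p.1 p.2) (dec g) LKc).
      by move=> u; apply: (@continuous_comp _ _ _ _ (LK (dec g))); [exact: cw|exact: cL].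
    have m0 : 0 <= mesh T N k by apply: mesh_ge0; exact: ltW.
    have mm : mesh T N k <= mesh T N k.+1 by apply: mesh_le; [exact: ltW|].
    have := integral_increment cphi m0 mm hL.
    have -> : mesh T N k.+1 - mesh T N k = h by rewrite /mesh -/h -natr1; ring.
    have cE : kap * h * a k = - (h * LK (xi k) (W (mesh T N k))).
      rewrite /xi /state LKE; last by move/confinedP: ck; apply.
      by rewrite aE//; ring.
    rewrite cE /mart -/(xi k) -/(W _) -/(W _) => hI.
    have := hK (W (mesh T N k.+1)); have := hK (W (mesh T N k)).
    rewrite -/(xi k) -/(a k) -/(b k).
    set I1 := Rintegral _ _ _ in hI *; set I0 := Rintegral _ _ _ in hI *.
    rewrite -/(W _) in hI.
    move=> h1 h2.
    rewrite (_ : _ - _ = (b k - K (dec g) (W (mesh T N k.+1))) -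
      (a k - K (dec g) (W (mesh T N k))) +
      (I1 - I0 - h * LK (xi k) (W (mesh T N k)))); last by ring.
    rewrite (le_trans (ler_normD _ _))// lerD//.
    by rewrite (le_trans (ler_normB _ _))// mulrDl mul1r lerD.
  - move=> k kN /negP nc; rewrite /dd big1// => g _.
    by rewrite indicE memNset ?mulr0 ?subrr// => -[].
have hN : kap * h * N%:R = kap * T by rewrite /h -mulrA mulfVK// gt_eqF.
have Y0 : Y 0%N = cos theta * G 1.
  have m0 : W (mesh T N 0) = 0 by rewrite /mesh mulr0 /W w0.
  have s0 : sqnorm (0 : X) = 0.
    by rewrite /sqnorm; do 2!(rewrite big1// => ? _); rewrite mxE expr0n.
  have c0 : confined rho T N W 0.
    by apply/confinedP => j; rewrite leqn0 => /eqP ->; rewrite m0 s0.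
  rewrite /Y c0 mulr0 expR0 mul1r aE// m0 /acc_phase big_ord0 addr0 /zc s0.
  by rewrite addr0 invr1.
have mN : mesh T N N = T by rewrite /mesh mulfVK// gt_eqF.
rewrite /disc_error.
have -> : expR (kap * T) * (cos (acc_phase lam theta T N (w^~ omega) N) * G (zc (w T omega)))
  - cos theta * G 1 - frozen_sum N dec C omega =
  (Y N - Y 0%N - \sum_(k < N) expR (kap * h * k.+1%:R) * dd k) +
  (expR (kap * T) * (cos (acc_phase lam theta T N W N) * G (zc (W T))) - Y N).
  by rewrite Y0 /frozen_sum /dd /h; ring.
apply: (le_trans (ler_normD _ _)); apply: (le_trans (lerD tele (lexx _))).
have hY : `|expR (kap * T) * (cos (acc_phase lam theta T N W N) * G (zc (W T))) - Y N|
   <= 2 * B * expR (kap * T) * (~~ confined rho T N W N)%:R.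
  rewrite /Y; case: ifPn => cN /=.
    by rewrite aE// mN hN subrr normr0 mulr0.
  rewrite subr0 mulr1 normrM ger0_norm ?expR_ge0// mulrC ler_wpM2r ?expR_ge0//.
  rewrite normrM mulrC (le_trans (ler_piMr _ _))//.
    by rewrite ler_norml cos_geN1 cos_le1.
  rewrite (le_trans (GB _)) ?zc_gt0 ?zc_le1//; move: B0; lra.
apply: (le_trans (lerD (lexx _) hY)); rewrite hN.
rewrite le_eqVlt; apply/orP; left; apply/eqP; rewrite /h; field.
by rewrite gt_eqF.
Qed.

Lemma discretization : exists (C : R) (mdl : R -> R),
  [/\ 0 <= C, forall e, 0 < e -> 0 < mdl e &
  forall N, (0 < N)%N -> exists2 D, centered P D &
  forall omega, w 0 omega = 0 ->
    {within `[0, +oo[, continuous (fun t => w t omega)} ->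
    `|disc_error N D omega| <= 4 * B * expR (kap * T) *
       (~~ confined rho T N (w^~ omega) N)%:R + C /\
    forall e : R, 0 < e -> N%:R^-1 < mdl e ->
      (forall k u, (k < N)%N -> mesh T N k <= u <= mesh T N k.+1 ->
        ball (w (mesh T N k) omega) (mdl e) (w u omega)) ->
      `|disc_error N D omega| <= 4 * B * expR (kap * T) *
       (~~ confined rho T N (w^~ omega) N)%:R + C * (e + N%:R^-1)].
Proof.
pose b := Num.sqrt rho + 1.
have b1 : 1 <= b by rewrite lerDr sqrtr_ge0.
have b0 : 0 <= b by exact: le_trans b1.
have [CL hCL] := bounded_param LKc LKM (b + 1).
have CL0 : 0 <= CL.
  apply: le_trans (hCL (0, 0, 0) 0 _); first exact: normr_ge0.
  split; [move=> i j; rewrite mxE|split] => /=; rewrite normr0; lra.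
have /choice [mdl hmdl] : forall e : R, exists delta : R, 0 < delta /\ (0 < e ->
    forall s s' y y', sbox b s -> box b y -> ball s delta s' -> ball y delta y' ->
    `|LK s y - LK s' y'| <= e).
  move=> e; have [e0|_] := ltP 0 e; last by exists 1.
  by have [delta d0 hd] := modulus_local LKc b e0; exists delta.
pose E := expR (kap * T); pose q := (kap * T) ^+ 2 * (2 * B).
have E0 : 0 <= E by exact: expR_ge0.
have q0 : 0 <= q by rewrite mulr_ge0 ?sqr_ge0// mulr_ge0.
have T0' := ltW T0.
exists (E * (2 + T + T * (2 * CL) + q)), mdl; split.
- by rewrite mulr_ge0// !addr_ge0// !mulr_ge0.
- by move=> e _; case: (hmdl e).
move=> N N0.
have N0R : 0 < N%:R :> R by rewrite ltr0n.
have N1 : N%:R^-1 <= 1 :> R by rewrite invf_le1// ler1n.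
have Ni0 : 0 < N%:R^-1 :> R by rewrite invr_gt0.
have eK : 0 < N%:R^-1 ^+ 2 :> R by rewrite exprn_gt0.
have [dK dK0 hdK] := modulus_param Kc KM b eK.
pose r := Num.min dK N%:R^-1.
have r0 : 0 < r by rewrite lt_min dK0.
have [J [dec [C [Cinj Ccov Cball Cmeas]]]] := @cells R n b r r0.
exists (frozen_sum N dec C); first exact: frozen_sum_centered.
move=> omega w0 cw.
have inbox k : confined rho T N (w^~ omega) k ->
    sbox b (state lam theta T N (w^~ omega) k).
  move=> /confinedP /(_ k (leqnn k)) ck; split => /=.
    move=> i j; apply: (le_trans (le_enorm _ i j)).
    rewrite /enorm (le_trans (_ : _ <= Num.sqrt rho))//; first by rewrite ler_sqrt.
    by rewrite /b; lra.
  by split; apply: le_trans b1; rewrite ler_norml ?cos_geN1 ?cos_le1 ?sin_geN1 ?sin_le1.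
have hcell k : confined rho T N (w^~ omega) k ->
    exists2 g, C g (state lam theta T N (w^~ omega) k) &
      ball (state lam theta T N (w^~ omega) k) r (dec g).
  move=> ck; have [h1 [h2 h3]] := inbox k ck.
  by have [g Cg] := Ccov _ h1 h2 h3; exists g => //; exact: Cball.
have hcK k g : confined rho T N (w^~ omega) k ->
    ball (state lam theta T N (w^~ omega) k) r (dec g) ->
    forall y, `|K (state lam theta T N (w^~ omega) k) y - K (dec g) y| <= N%:R^-1 ^+ 2.
  move=> ck hb y; apply: hdK; first exact: inbox.
  by apply: le_ball hb; rewrite ge_min lexx.
split.
- apply: le_trans (disc_error_bound (eL := 2 * CL) N0 _ w0 cw Cinj _) _.
  + by rewrite mulr_ge0.
  + move=> k kN ck; have [g Cg bg] := hcell k ck; exists g => //.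
    split; first exact: hcK.
    move=> u _; rewrite (le_trans (ler_normB _ _))// mulrDl mul1r lerD//.
      apply: hCL; apply: sbox_ball (inbox k ck) _; apply: le_ball bg.
      by rewrite ge_min N1 orbT.
    by apply: hCL; apply: sboxS (inbox k ck); lra.
  + rewrite lerD2l -/E ler_wpM2l// -/q.
    rewrite addrAC -[_ + T + _]addrA; nra.
- move=> e e0 Ne hosc.
  apply: le_trans (disc_error_bound (eL := e) N0 (ltW e0) w0 cw Cinj _) _.
  + move=> k kN ck; have [g Cg bg] := hcell k ck; exists g => //.
    split; first exact: hcK.
    move=> u hu; rewrite distrC; have [_ hm] := hmdl e; apply: (hm e0).
    * exact: inbox.
    * by have [] := inbox k ck.
    * apply: le_ball bg; apply: le_trans (ltW Ne).
      by rewrite ge_min lexx orbT.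
    * exact: hosc.
  + rewrite lerD2l -/E -[leRHS]mulrA ler_wpM2l// -/q.
    have TC : 0 <= T * (2 * CL) by rewrite !mulr_ge0.
    have e00 := ltW e0; have Ni00 := ltW Ni0; nra.
Qed.

End Discretization.

Section AreaSum.
Context {R : realType} {n : nat}.
Local Notation X := 'M[R]_(n, 4).
Implicit Types (u v : 'rV[R]_4) (W : R -> X).

Definition imdot (lam : 'rV[R]_3) (u : 'rV[R]_4) : R :=
  lam 0 0 * u 0 1 + lam 0 1 * u 0 2 + lam 0 2 * u 0 3.

Lemma imdot_linear lam a u v : imdot lam (a *: u + v) = a * imdot lam u + imdot lam v.
Proof. by rewrite /imdot !mxE; ring. Qed.

Lemma imdot0 lam : imdot lam 0 = 0.
Proof. by rewrite /imdot !mxE !mulr0 !addr0. Qed.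

Lemma imdotD lam u v : imdot lam (u + v) = imdot lam u + imdot lam v.
Proof. by rewrite /imdot !mxE; ring. Qed.

Lemma imdotB lam u v : imdot lam (u - v) = imdot lam u - imdot lam v.
Proof. by rewrite /imdot !mxE; ring. Qed.

Lemma imdotZ lam a u : imdot lam (a *: u) = a * imdot lam u.
Proof. by rewrite /imdot !mxE; ring. Qed.

Lemma imdot_sum lam (I : Type) (r : seq I) (f : I -> 'rV[R]_4) :
  imdot lam (\sum_(i <- r) f i) = \sum_(i <- r) imdot lam (f i).
Proof.
elim: r => [|i r IH]; first by rewrite !big_nil imdot0.
by rewrite !big_cons imdotD IH.
Qed.

Lemma imdot_imquat lam (v : 'rV[R]_3) : imdot lam (imquat v) = dot3 lam v.
Proof. by rewrite /dot3 sum_ord3 /imdot /imquat !mxE. Qed.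

(* Expanding the product, Im(w conj w) and Im(w' conj w') vanish, which leaves *)
(* Im(w' conj w) times the mean of 1/(1 + |w|^2) and 1/(1 + |w'|^2).           *)
Lemma imdot_increment lam (x y : X) :
  let c z j := (1 + sqnorm z)^-1 *: row j z in
  let mean j := 2^-1 *: (c x j + c y j) in
  let dz j := row j y - row j x in
  imdot lam (2^-1 *: \sum_(j < n) (qmul (dz j) (qconj (mean j)) -
     qmul (mean j) (qconj (dz j)))) = phase lam x y.
Proof.
move=> c mean dz; rewrite imdotZ imdot_sum /phase /zc.
congr (_ * _); rewrite /ip mulr_suml; apply: eq_bigr => j _.
rewrite sum_ord4 /axis /imdot /dz /mean /c !mxE /= ?mxE /=.
by field; rewrite !gt_eqF ?sqnorm1_gt0.
Qed.

Definition mesh_seq (T : R) N : seq R := [seq mesh T N k | k <- iota 1 N].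

Lemma nth_mesh_seq T N k : (k <= N)%N -> nth T (0 :: mesh_seq T N) k = mesh T N k.
Proof.
case: k => [|k] kN; first by rewrite /mesh mulr0.
by rewrite /= (nth_map 0%N) ?size_iota// nth_iota.
Qed.

Lemma mesh_seq_partition T N : 0 < T -> (0 < N)%N -> itv_partition 0 T (mesh_seq T N).
Proof.
move=> T0 N0; have N0R : 0 < N%:R :> R by rewrite ltr0n.
split.
  rewrite /mesh_seq; apply/(pathP 0) => i; rewrite size_map size_iota => iN.
  have -> : nth 0 (0 :: [seq mesh T N k | k <- iota 1 N]) i = mesh T N i.
    case: i iN => [|i] iN; first by rewrite /mesh mulr0.
    by rewrite /= (nth_map 0%N) ?size_iota ?(ltnW iN)// nth_iota// ltnW.
  rewrite (nth_map 0%N) ?size_iota// nth_iota// add1n /mesh.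
  by rewrite ltr_pM2l ?divr_gt0// ltr_nat.
rewrite /mesh_seq -[N in iota 1 N](prednK N0) -[(N.-1).+1]addn1 iotaD map_cat last_cat /=.
by rewrite add1n (prednK N0) /mesh mulfVK// gt_eqF.
Qed.

Lemma imdot_area_sum lam W T N :
  imdot lam (area_sum W T (mesh_seq T N)) = acc_phase lam 0 T N W N.
Proof.
rewrite /area_sum /acc_phase add0r exchange_big /= imdotZ imdot_sum mulr_sumr.
rewrite size_map size_iota big_mkord; apply: eq_bigr => k _.
rewrite -imdotZ -imdot_increment.
have E : nth T (mesh_seq T N) k = mesh T N k.+1 := nth_mesh_seq T (ltn_ord k).
by rewrite !nth_mesh_seq ?(ltnW (ltn_ord k))//= E.
Qed.

Lemma imdot_le lam u : `|imdot lam u| <=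
  (`|lam 0 0| + `|lam 0 1| + `|lam 0 2|) * enorm u.
Proof.
rewrite /imdot !mulrDl.
do 2!(apply: (le_trans (ler_normD _ _)); apply: lerD; last first;
  first by rewrite normrM ler_wpM2l// le_enorm).
by rewrite normrM ler_wpM2l// le_enorm.
Qed.

Lemma acc_phase_shift lam theta T N W k :
  acc_phase lam theta T N W k = theta + acc_phase lam 0 T N W k.
Proof. by rewrite /acc_phase add0r. Qed.

Lemma cos_lipschitz (x y : R) : `|cos x - cos y| <= `|x - y|.
Proof.
wlog xy : x y / x <= y.
  move=> H; have [xy|yx] := leP x y; first exact: H.
  by rewrite distrC (distrC x); apply: H; exact: ltW.
have [|c _] := @MVT_segment R (@cos R) (fun s : R => - sin s) x y xy.
  by apply: continuous_subspaceT; exact: continuous_cos.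
move=> E; rewrite distrC E normrM (distrC x) ler_piMl// normrN.
by rewrite ler_norml sin_geN1 sin_le1.
Qed.

End AreaSum.

Section Expectations.
Context {R : realType} {d : measure_display} {Omega : measurableType d}.
Variable P : probability Omega R.

Lemma bounded_integrable (f : Omega -> R) (C : R) :
  measurable_fun setT f -> (forall omega, `|f omega| <= C) ->
  P.-integrable setT (EFin \o f).
Proof.
move=> mf fC; apply: measurable_bounded_integrable => //.
  by rewrite -ge0_fin_numE// fin_num_measure.
exists C; split; first exact: num_real.
by move=> x Cx omega _; exact: le_trans (fC omega) (ltW Cx).
Qed.

Lemma dominated_to0 (V : nat -> Omega -> R) (C : R) :
  (forall N, measurable_fun setT (V N)) ->
  {ae P, forall omega, V^~ omega @ \oo --> (0 : R)} ->
  {ae P, forall omega, forall N, `|V N omega| <= C} ->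
  \int[P]_omega V N omega @[N --> \oo] --> (0 : R).
Proof.
move=> mV V0 VC.
have h1 : {ae P, forall x : Omega, [set: Omega] x ->
    (fun N => (V N x)%:E) @ \oo --> (0 : \bar R)%E}.
  by move: V0; apply: filterS => omega h0 _; apply: cvg_EFin => //; exact: nearW.
have h2 : {ae P, forall x n, [set: Omega] x -> (`|(V n x)%:E| <= C%:E)%E}.
  by move: VC; apply: filterS => omega hC N _; rewrite abse_EFin lee_fin.
have [_ _] := @dominated_convergence _ Omega R P setT measurableT
  (fun N omega => (V N omega)%:E) (cst 0%E) (cst C%:E)
  (fun N => (measurable_EFinP _ _).2 (mV N)) (measurable_cst _) h1
  (finite_measure_integrable_cst P C measurableT) h2.
rewrite integral0 => h; rewrite /Rintegral.
exact: (fine_cvg h).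
Qed.

End Expectations.

Section ExpectationIdentity.
Context {R : realType} {n : nat} {d : measure_display} {Omega : measurableType d}.
Local Notation X := 'M[R]_(n, 4).
Variables (P : probability Omega R) (F : R -> set (set Omega)) (w : R -> Omega -> X).
Variables (lam : 'rV[R]_3) (theta kap B T : R) (G G1 G2 : R -> R).
Hypothesis hw : HP_brownian P F w.
Hypotheses (T0 : 0 < T) (kap0 : 0 <= kap).
Hypothesis GB : forall t, 0 < t <= 1 -> `|G t| <= B.
Hypothesis Gmeas : measurable_fun setT G.
Hypothesis Gs : forall m, smooth_on [set t : R | 0 < t] m G.
Hypothesis hG1 : forall t : R, 0 < t -> is_derive t (1 : R) G (G1 t).
Hypothesis hG2 : forall t : R, 0 < t -> is_derive t (1 : R) G1 (G2 t).
Hypothesis ode : forall t : R, 0 < t -> 2 * t * (1 - t) * G2 t +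
     (4 * (1 - t) - 4 * n%:R * t) * G1 t
     - 2^-1 * sqnorm lam * ((1 - t) / t) * G t = - kap * G t.

Let B0 : 0 <= B.
Proof. by apply: le_trans (GB (t := 1) _); rewrite ?normr_ge0// ltr01 lexx. Qed.

Lemma HP_brownian_measurable u : 0 <= u -> mx_measurable (w u).
Proof.
move=> u0 i j; have [[_ Fm _] wF _ _] := hw => _ A mA; rewrite setTI.
by apply: (Fm u u0); exact: (wF i j u u0).
Qed.

Let E : R := expR (kap * T).
Let E0 : 0 < E. Proof. exact: expR_gt0. Qed.

Definition disc_functional N omega : R :=
  E * (cos (acc_phase lam theta T N (w^~ omega) N) * G (zc (w T omega))).

Let mGz : measurable_fun setT (fun omega => G (zc (w T omega))).
Proof.
apply: (@measurableT_comp _ _ _ _ _ _ G) => //.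
by apply: measurable_zc; apply: HP_brownian_measurable; exact: ltW.
Qed.

Let mesh_meas N j : mx_measurable (w (mesh T N j)).
Proof. by apply: HP_brownian_measurable; apply: mesh_ge0; exact: ltW. Qed.

Lemma measurable_disc_functional N : measurable_fun setT (disc_functional N).
Proof.
apply: measurable_funM => //; apply: measurable_funM => //.
apply: (@measurableT_comp _ _ _ _ _ _ (@cos R)).
  exact: continuous_measurable_fun (@continuous_cos R).
by apply: measurable_acc_phase => j _.
Qed.

Lemma disc_functional_le N omega : `|disc_functional N omega| <= E * B.
Proof.
rewrite normrM gtr0_norm// ler_pM2l// normrM -[leRHS]mul1r ler_pM//.
  by rewrite ler_norml cos_geN1 cos_le1.
by rewrite GB// zc_gt0 zc_le1.
Qed.

Let bad (m N : nat) : set Omega :=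
  [set omega | ~~ confined (m%:R : R) T N (w^~ omega) N].

Let measurable_bad m N : measurable (bad m N).
Proof.
rewrite (_ : bad m N = ~` [set omega | confined (m%:R : R) T N (w^~ omega) N]).
  by apply: measurableC; apply: measurable_confined => j _.
by apply/seteqP; split => omega /= /negP.
Qed.

Let ever_bad m : set Omega := \bigcup_N bad m N.+1.

Let measurable_ever_bad m : measurable (ever_bad m).
Proof. by apply: bigcupT_measurable => N. Qed.

Let good omega := w 0 omega = 0 /\
  {within `[0, +oo[, continuous (fun t => w t omega)}.

Let within_0T omega : good omega -> {within `[0, T], continuous (fun t => w t omega)}.
Proof.
move=> [_]; apply: continuous_subspaceW => u /=; rewrite !in_itv /=.
by move=> /andP[->].
Qed.

Let mesh_in N k : (0 < N)%N -> (k <= N)%N -> `[0, T]%classic (mesh T N k).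
Proof.
move=> N0 kN; rewrite /= in_itv /= mesh_ge0 ?(ltW T0)//=.
rewrite (le_trans (mesh_le _ (ltW T0) kN))// /mesh mulfVK//.
by rewrite gt_eqF// ltr0n.
Qed.

Let path_bounded omega : good omega -> exists m : nat, ~ ever_bad m omega.
Proof.
move=> go; have cs : continuous (@sqnorm R n 4).
  exact: (@continuous_section _ _ _ (fun p : R * X => sqnorm p.2) 0
    (psmooth_continuous (psmooth_sqnorm R 0))).
have cf : {within `[0, T], continuous (fun u => sqnorm (w u omega))}.
  by move=> u; apply: (@continuous_comp _ _ _ _ (@sqnorm R n 4)); [exact: within_0T|exact: cs].
have [c _ hc] := EVT_max (ltW T0) cf.
exists (Num.bound (sqnorm (w c omega))) => -[N _] /= /negP; apply.
apply/confinedP => j jN; apply: (le_trans (hc _ _)).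
  by have := mesh_in (ltn0Sn N) jN.
by apply/ltW/archi_boundP; exact: sqnorm_ge0.
Qed.

Let ever_bad_cvg : fine (P (ever_bad m)) @[m --> \oo] --> (0 : R).
Proof.
have mI : measurable (\bigcap_m ever_bad m) by exact: bigcapT_measurable.
have H : P (\bigcap_m ever_bad m) = 0%E.
  apply: measure_negligible => //; have [_ _ aeg _] := hw.
  apply: negligibleS aeg => omega /= hb go.
  by have [m] := path_bounded go; apply; exact: hb.
have h : P (ever_bad m) @[m --> \oo] --> 0%E.
  rewrite -H; apply: nonincreasing_cvg_mu => //.
    by rewrite -ge0_fin_numE// fin_num_measure.
  move=> m m' mm'; apply/subsetPset => omega [N _ /negP hN]; exists N => //.
  apply/negP => /confinedP c; apply: hN; apply/confinedP => j jN.
  by rewrite (le_trans (c j jN))// ler_nat.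
exact: (fine_cvg h).
Qed.

Let osc omega (e : R) : good omega -> 0 < e ->
  \forall N \near \oo, forall k u, (k < N.+1)%N ->
    mesh T N.+1 k <= u <= mesh T N.+1 k.+1 ->
    ball (w (mesh T N.+1 k) omega) e (w u omega).
Proof.
move=> go e0.
have [delta d0 hd] := heine (@segment_compact R 0 T) (within_0T go) e0.
have Td : 0 < delta / T by rewrite divr_gt0.
near=> N => k u kN /andP[ku uk].
have N0 : (0 < N.+1)%N by [].
have uT : `[0, T]%classic u.
  rewrite /= in_itv /= (le_trans (mesh_ge0 _ _ (ltW T0)) ku)/=.
  by have := mesh_in N0 kN; rewrite /= in_itv /= => /andP[_]; exact: le_trans.
apply: hd => //; first by exact: mesh_in N0 (ltnW kN).
rewrite /ball /= distrC ger0_norm ?subr_ge0//.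
apply: (@le_lt_trans _ _ (mesh T N.+1 k.+1 - mesh T N.+1 k)); first by rewrite lerD2r.
rewrite /mesh -mulrBr -natrB// subSnn mulr1 -ltr_pdivlMl// mulrC.
near: N; exact: near_infty_natSinv_lt (PosNum Td).
Unshelve. all: by end_near. Qed.

Let integrable_disc N : P.-integrable setT (EFin \o disc_functional N).
Proof. exact: bounded_integrable (measurable_disc_functional N) (disc_functional_le N). Qed.

Lemma disc_functional_cvg :
  \int[P]_omega disc_functional N.+1 omega @[N --> \oo] --> cos theta * G 1.
Proof.
set c := cos theta * G 1.
pose pm m := fine (P (ever_bad m)).
have key m (e : R) : 0 < e -> \forall N \near \oo,
    `|\int[P]_omega disc_functional N.+1 omega - c| <= 4 * B * E * pm m + e.
  move=> e0; have m0 : 0 <= m%:R :> R by [].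
  have [K [[Ks KB Kc Lc] [M M0 KM] KE LKE]] :=
    exists_test_function m0 GB Gs hG1 hG2 ode.
  have LKc : continuous (fun p => 2^-1 * laplace_beltrami (@HP_metric R n) (K p.1) p.2).
    move=> p; apply: (@continuousM _ _ (fun=> 2^-1 : R)
      (fun p : X * R * R * X => laplace_beltrami (@HP_metric R n) (K p.1) p.2)); first exact: cst_continuous.
    exact: Lc.
  have LKM s y : M < enorm y -> 2^-1 * laplace_beltrami (@HP_metric R n) (K s) y = 0.
    by move=> My; have [_ ->] := KM s y My; rewrite mulr0.
  have KM' s y : M < enorm y -> K s y = 0 by move=> My; have [] := KM s y My.
  have [C [mdl [C0 mdl0 hN]]] := @discretization R n d Omega P F w lam theta kap B m%:R T G
    K hw T0 m0 kap0 B0 GB Ks KB Kc LKc M KM' LKM KE LKE.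
  have /choice [D hD] : forall N, exists D, centered P D /\
    forall omega, good omega -> 
    `|disc_error w lam theta kap T G N.+1 D omega| <= 4 * B * expR (kap * T) *
       (~~ confined m%:R T N.+1 (w^~ omega) N.+1)%:R + C /\
    forall e : R, 0 < e -> N.+1%:R^-1 < mdl e ->
      (forall k u, (k < N.+1)%N -> mesh T N.+1 k <= u <= mesh T N.+1 k.+1 ->
        ball (w (mesh T N.+1 k) omega) (mdl e) (w u omega)) ->
      `|disc_error w lam theta kap T G N.+1 D omega| <= 4 * B * expR (kap * T) *
       (~~ confined m%:R T N.+1 (w^~ omega) N.+1)%:R + C * (e + N.+1%:R^-1).
    move=> N; have [D cD h] := hN N.+1 (ltn0Sn N).
    by exists D; split=> // omega [w0 cw]; exact: h.
  pose de N omega := disc_error w lam theta kap T G N.+1 (D N) omega.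
  pose bd N omega : R := 4 * B * E * \1_(bad m N.+1) omega.
  pose V N omega := Num.max 0 (`|de N omega| - bd N omega).
  have bdE N omega : bd N omega = 4 * B * expR (kap * T) *
       (~~ confined m%:R T N.+1 (w^~ omega) N.+1)%:R.
    rewrite /bd indicE; congr (_ * _).
    have [cN|cN] := boolP (confined m%:R T N.+1 (w^~ omega) N.+1).
      by rewrite memNset //= => /negP; apply.
    by rewrite mem_set.
  have deE N omega : de N omega = disc_functional N.+1 omega - c - D N omega by [].
  have mD N : measurable_fun setT (D N).
    by have [[/integrableP[/measurable_EFinP h _] _] _] := hD N.
  have iD N : P.-integrable setT (EFin \o D N) by have [[h _] _] := hD N.
  have mde N : measurable_fun setT (de N).
    by apply: measurable_funB => //; apply: measurable_funB => //; exact: measurable_disc_functional.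
  have ide N : P.-integrable setT (EFin \o de N).
    have h1 := integrableB measurableT (integrable_disc N.+1)
      (finite_measure_integrable_cst P c measurableT).
    have h2 := integrableB measurableT h1 (iD N).
    by apply: eq_integrable h2 => // omega _; rewrite /= deE !EFinB.
  have mbd N : measurable_fun setT (bd N).
    by apply: measurable_funM => //; exact: measurable_indic.
  have mV N : measurable_fun setT (V N).
    apply: measurable_maxr => //; apply: measurable_funB => //.
    by apply: measurableT_comp => //; exact: mde.
  have EB : 0 <= 4 * B * E by rewrite !mulr_ge0// ltW.
  have bd0 N omega : 0 <= bd N omega by rewrite /bd mulr_ge0.
  have V0 N omega : 0 <= V N omega by rewrite le_max lexx.
  have Vde N omega : `|V N omega| <= `|de N omega|.
    by rewrite ger0_norm// ge_max normr_ge0/= lerBlDr lerDl.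
  have iV N : P.-integrable setT (EFin \o V N).
    apply: le_integrable (ide N) => //; first exact/measurable_EFinP.
    by move=> omega _; rewrite /= lee_fin.
  have ibd N : P.-integrable setT (EFin \o bd N).
    apply: (@bounded_integrable _ _ _ P (bd N) (4 * B * E)) => // omega.
    by rewrite ger0_norm// /bd ler_piMr// indicE; case: (omega \in bad m N.+1).
  have hV : \int[P]_omega V N omega @[N --> \oo] --> (0 : R).
    have [_ _ aeg _] := hw.
    apply: (@dominated_to0 _ _ _ P V C) => //.
      apply: filterS aeg => omega go; apply/cvgrPdist_le => e' e'0.
      pose e1 := e' / (2 * C + 1).
      have C1 : 0 < 2 * C + 1 by lra.
      have e10 : 0 < e1 by rewrite divr_gt0.
      have h := osc go (mdl0 _ e10).
      near=> N; rewrite sub0r normrN ger0_norm// ge_max (ltW e'0)/= lerBlDl.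
      have [_ hd2] := hD N; have [_ hd3] := hd2 omega go.
      have e1N : N.+1%:R^-1 < e1 by near: N; exact: near_infty_natSinv_lt (PosNum e10).
      rewrite bdE; apply: (le_trans (hd3 e1 e10 _ _)).
      - by near: N; exact: near_infty_natSinv_lt (PosNum (mdl0 _ e10)).
      - by near: N.
      rewrite lerD2l (le_trans (_ : _ <= C * (e1 + e1)))//.
        by rewrite ler_wpM2l// lerD2l ltW.
      have -> : e' = e1 * (2 * C + 1) by rewrite /e1 mulfVK// gt_eqF.
      by nra.
    apply: filterS aeg => omega go N; rewrite ger0_norm// ge_max C0/= lerBlDl.
    have [_ hd2] := hD N; have [hd3 _] := hd2 omega go.
    by rewrite bdE.
  have i2 : P.-integrable setT (EFin \o (fun omega => 4 * B * E * \1_(ever_bad m) omega)).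
    apply: (@bounded_integrable _ _ _ P _ (4 * B * E)).
      by apply: measurable_funM => //; exact: measurable_indic.
    move=> omega; rewrite ger0_norm; last by rewrite mulr_ge0// indicE.
    by rewrite ler_piMr// indicE; case: (omega \in ever_bad m).
  have hI N : `|\int[P]_omega disc_functional N.+1 omega - c| <=
      4 * B * E * pm m + \int[P]_omega V N omega.
    have -> : \int[P]_omega disc_functional N.+1 omega - c = \int[P]_omega de N omega.
      under [RHS]eq_Rintegral do rewrite deE.
      have i1 : P.-integrable setT (EFin \o (fun omega => disc_functional N.+1 omega - c)).
        have h1 := integrableB measurableT (integrable_disc N.+1)
          (finite_measure_integrable_cst P c measurableT).
        by apply: eq_integrable h1 => // omega _; rewrite /= EFinB.
      rewrite (RintegralB measurableT i1 (iD N)).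
      rewrite (RintegralB measurableT (integrable_disc N.+1)
          (finite_measure_integrable_cst P c measurableT)).
      have -> : \int[P]_(omega in setT) cst c omega = c.
        have PT : P setT = 1%E := probability_setT P.
        by rewrite Rintegral_cst//= PT mulr1.
      by have [[_ z] _] := hD N; rewrite /Rintegral z subr0.
    apply: (le_trans (le_normr_Rintegral measurableT (ide N))).
    have -> : 4 * B * E * pm m + \int[P]_omega V N omega =
        \int[P]_omega (4 * B * E * \1_(ever_bad m) omega + V N omega).
      rewrite (RintegralD measurableT i2 (iV N)); congr (_ + _).
      have i3 : P.-integrable setT (EFin \o (\1_(ever_bad m) : Omega -> R)).
        apply: (@bounded_integrable _ _ _ P _ 1); first exact: measurable_indic.
        by move=> omega; rewrite indicE; case: (_ \in _); rewrite ?normr1 ?normr0.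
      rewrite RintegralZl//; congr (_ * _).
      by rewrite /Rintegral integral_indic// setIT.
    apply: le_Rintegral => //.
    - exact: (@integrable_norm _ _ R P _ _ (ide N)).
    - have := integrableD measurableT i2 (iV N).
      by apply: eq_integrable => // omega _.
    - move=> omega _; rewrite (le_trans (_ : _ <= bd N omega + V N omega))//.
        by rewrite -lerBlDl le_max lexx orbT.
      rewrite lerD2r /bd ler_wpM2l// !indicE; have [hb|//] := boolP (omega \in bad m N.+1).
      rewrite mem_set//; exists N => //; exact: set_mem.
  near=> N; apply: (le_trans (hI N)); rewrite lerD2l.
  have : `|0 - \int[P]_omega V N omega| <= e.
    by near: N; move/cvgrPdist_le: hV; exact.
  by rewrite sub0r normrN; apply: le_trans; exact: ler_norm.
apply/cvgrPdist_le => e e0.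
have EB1 : 0 < 4 * B * E + 1 by rewrite ltr_wpDl// !mulr_ge0// ltW.
have e1 : 0 < e / 2 / (4 * B * E + 1) by rewrite !divr_gt0.
have e2 : 0 < e / 2 by rewrite divr_gt0.
have [m _ hm] : \forall m \near \oo, `|0 - pm m| <= e / 2 / (4 * B * E + 1).
  by move/cvgrPdist_le: ever_bad_cvg; exact.
have {}hm := hm m (leqnn m).
have := key m _ e2; apply: filterS => N; rewrite distrC => h.
apply: (le_trans h); rewrite [leRHS](splitr e) lerD2r.
have pm0 : 0 <= pm m by exact: fine_ge0.
move: hm; rewrite sub0r normrN ger0_norm// ler_pdivlMr// => hm.
apply: le_trans hm; rewrite mulrC ler_wpM2l//; lra.
Unshelve. all: by end_near. Qed.

End ExpectationIdentity.

Section AreaExpectation.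
Context {R : realType} {n : nat} {d : measure_display} {Omega : measurableType d}.
Local Notation X := 'M[R]_(n, 4).
Variables (P : probability Omega R) (F : R -> set (set Omega)) (w : R -> Omega -> X).
Variable a : R -> Omega -> 'rV[R]_3.
Variables (lam : 'rV[R]_3) (theta kap B T : R) (G G1 G2 : R -> R).
Hypothesis hw : HP_brownian P F w.
Hypothesis ha : HP_area P w a.
Hypotheses (T0 : 0 < T) (kap0 : 0 <= kap).
Hypothesis GB : forall t, 0 < t <= 1 -> `|G t| <= B.
Hypothesis Gmeas : measurable_fun setT G.
Hypothesis Gs : forall m, smooth_on [set t : R | 0 < t] m G.
Hypothesis hG1 : forall t : R, 0 < t -> is_derive t (1 : R) G (G1 t).
Hypothesis hG2 : forall t : R, 0 < t -> is_derive t (1 : R) G1 (G2 t).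
Hypothesis ode : forall t : R, 0 < t -> 2 * t * (1 - t) * G2 t +
     (4 * (1 - t) - 4 * n%:R * t) * G1 t
     - 2^-1 * sqnorm lam * ((1 - t) / t) * G t = - kap * G t.

Lemma area_sum_re (W : R -> X) N : (area_sum W T (mesh_seq T N) : 'rV[R]_4) 0 0 = 0 :> R.
Proof.
rewrite /area_sum mxE summxE big1 ?mulr0// => j _.
rewrite summxE big1// => k _; rewrite !mxE /=; ring.
Qed.

Lemma measurable_area_dist N : measurable_fun setT (fun omega =>
  enorm (area_sum (w^~ omega : R -> X) T (mesh_seq T N) - imquat (a T omega))).
Proof.
have [ma _] := ha (ltW T0).
pose e (i : 'I_3) : 'rV[R]_3 := delta_mx 0 i.
have E omega : sqnorm (area_sum (w^~ omega : R -> X) T (mesh_seq T N) - imquat (a T omega)) =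
   \sum_(i < 3) (acc_phase (e i) 0 T N (w^~ omega) N - a T omega 0 i) ^+ 2.
  rewrite sum_ord3 -!imdot_area_sum; have := area_sum_re (w^~ omega) N.
  move: (area_sum _ _ _) => u u0.
  by rewrite /sqnorm big_ord1 sum_ord4 /imdot /e !mxE /= u0; ring.
apply: (@measurableT_comp _ _ _ _ _ _ (@Num.sqrt R)).
  exact: continuous_measurable_fun (@sqrt_continuous R).
under eq_fun do rewrite E.
apply: measurable_sum => i; apply: measurable_funX; apply: measurable_funB => //.
apply: measurable_acc_phase => j _; apply: (HP_brownian_measurable hw).
by apply: mesh_ge0; exact: ltW.
Qed.

Let E : R := expR (kap * T).

Lemma measurable_dot3 : measurable_fun setT (fun omega => dot3 lam (a T omega)).
Proof.
have [ma _] := ha (ltW T0).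
by apply: measurable_sum => i; apply: measurable_funM.
Qed.

Lemma measurable_Gz : measurable_fun setT (fun omega => G (zc (w T omega))).
Proof.
apply: (@measurableT_comp _ _ _ _ _ _ G) => //.
by apply: measurable_zc; apply: (HP_brownian_measurable hw); exact: ltW.
Qed.

Lemma measurable_area_functional : measurable_fun setT
  (fun omega => cos (theta + dot3 lam (a T omega)) * G (zc (w T omega))).
Proof.
apply: measurable_funM; last exact: measurable_Gz.
apply: (@measurableT_comp _ _ _ _ _ _ (@cos R)).
  exact: continuous_measurable_fun (@continuous_cos R).
by apply: measurable_funD => //; exact: measurable_dot3.
Qed.

Lemma area_functional_le omega :
  `|cos (theta + dot3 lam (a T omega)) * G (zc (w T omega))| <= B.
Proof.
rewrite normrM -[leRHS]mul1r ler_pM//.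
  by rewrite ler_norml cos_geN1 cos_le1.
by rewrite GB// zc_gt0 zc_le1.
Qed.

Lemma integrable_area_functional : P.-integrable setT
  (EFin \o (fun omega => cos (theta + dot3 lam (a T omega)) * G (zc (w T omega)))).
Proof. exact: bounded_integrable measurable_area_functional area_functional_le. Qed.

Lemma area_expectation :
  \int[P]_omega (cos (theta + dot3 lam (a T omega)) * G (zc (w T omega))) =
  expR (- (kap * T)) * (cos theta * G 1).
Proof.
have B0 : 0 <= B.
  by apply: le_trans (GB (t := 1) _); rewrite ?normr_ge0// ltr01 lexx.
have E0 : 0 < E by exact: expR_gt0.
have [ma hP] := ha (ltW T0).
pose Wf omega := E * (cos (theta + dot3 lam (a T omega)) * G (zc (w T omega))).
have mWf : measurable_fun setT Wf.
  by apply: measurable_funM => //; exact: measurable_area_functional.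
have iWf : P.-integrable setT (EFin \o Wf).
  apply: (@bounded_integrable _ _ _ P Wf (E * B)) => // omega.
  by rewrite normrM gtr0_norm// ler_pM2l// area_functional_le.
have cW := @disc_functional_cvg R n d Omega P F w lam theta kap B T G G1 G2 hw T0 kap0 GB Gmeas Gs hG1 hG2 ode.
pose WN N := disc_functional w lam theta kap T G N.+1.
pose L : R := `|lam 0 0| + `|lam 0 1| + `|lam 0 2|.
have L0 : 0 <= L by rewrite !addr_ge0.
have cW2 : \int[P]_omega WN N omega @[N --> \oo] --> \int[P]_omega Wf omega.
  apply/cvgrPdist_le => e e0.
  have c1 : 0 < E * B * (L + 2) + 1 by rewrite ltr_wpDl// !mulr_ge0 ?addr_ge0// ltW.
  pose e1 := e / (E * B * (L + 2) + 1).
  have e10 : 0 < e1 by rewrite divr_gt0.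
  have [delta d0 hd] := hP e1 e1 e10 e10.
  have dT : 0 < delta / T by rewrite divr_gt0.
  near=> N.
  have N1 : N.+1%:R^-1 < delta / T by near: N; exact: near_infty_natSinv_lt (PosNum dT).
  pose Q := [set omega | (e1 < enorm (area_sum (w ^~ omega) T (mesh_seq T N.+1) -
     imquat (a T omega)))%R].
  have mQ : measurable Q.
    have := @measurable_area_dist N.+1 measurableT `]e1, +oo[%classic.
    rewrite setTI => /(_ (measurable_itv _)).
    rewrite (_ : _ @^-1` _ = Q)//.
    by apply/seteqP; split => omega /=; rewrite in_itv /= andbT.
  have PQ : (P Q <= e1%:E)%E.
    apply: hd; first exact: mesh_seq_partition.
    move=> k; rewrite /mesh_seq size_map size_iota => kN.
    rewrite (nth_mesh_seq _ kN) (nth_mesh_seq _ (ltnW kN)).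
    rewrite /mesh -mulrBr -natrB// subSnn mulr1 -ltr_pdivlMl// mulrC.
    exact: N1.
  have iWN : P.-integrable setT (EFin \o WN N).
    apply: (@bounded_integrable _ _ _ P (WN N) (E * B)).
      exact: (@measurable_disc_functional R n d Omega P F w lam theta kap T G hw T0 Gmeas).
    move=> omega; exact: disc_functional_le.
  have iD : P.-integrable setT (EFin \o (fun omega => Wf omega - WN N omega)).
    have h := integrableB measurableT iWf iWN.
    by apply: eq_integrable h => // omega _; rewrite /= EFinB.
  rewrite -(RintegralB measurableT iWf iWN).
  apply: (le_trans (le_normr_Rintegral measurableT iD)).
  have i1 : P.-integrable setT (EFin \o (\1_Q : Omega -> R)).
    apply: (@bounded_integrable _ _ _ P _ 1); first exact: measurable_indic.
    by move=> omega; rewrite indicE; case: (omega \in Q); rewrite ?normr1 ?normr0.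
  have ic c : P.-integrable setT (EFin \o cst c) := finite_measure_integrable_cst P c measurableT.
  have i2 : P.-integrable setT (EFin \o (fun omega => 2 * (E * B) * \1_Q omega)).
    have h := integrableZl measurableT (2 * (E * B)) i1.
    by apply: eq_integrable h => // omega _.
  have i3 : P.-integrable setT (EFin \o (fun omega => 2 * (E * B) * \1_Q omega +
      cst (E * B * L * e1) omega)).
    have h := integrableD measurableT i2 (ic (E * B * L * e1)).
    by apply: eq_integrable h => // omega _.
  apply: (le_trans (le_Rintegral measurableT (integrable_norm iD) i3 _)).
    move=> omega _ /=; rewrite /Wf /WN /disc_functional -/E -mulrBr -mulrBl normrM.
    rewrite (gtr0_norm E0) normrM.
    have hG : `|G (zc (w T omega))| <= B by rewrite GB// zc_gt0 zc_le1.
    set c1' := `|cos _ - cos _|.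
    have -> : 2 * (E * B) * \1_Q omega + E * B * L * e1 =
        E * ((2 * \1_Q omega + L * e1) * B) by ring.
    rewrite ler_pM2l// ler_pM ?normr_ge0//.
    rewrite indicE; have [oQ|oQ] := boolP (omega \in Q).
      rewrite mulr1 (le_trans (ler_normB _ _))//.
      have h1 (x : R) : `|cos x| <= 1 by rewrite ler_norml cos_geN1 cos_le1.
      have := h1 (theta + dot3 lam (a T omega)).
      have := h1 (acc_phase lam theta T N.+1 (w^~ omega) N.+1).
      have : 0 <= L * e1 by rewrite mulr_ge0// ltW.
      lra.
    rewrite mulr0 add0r (le_trans (cos_lipschitz _ _))//.
    rewrite acc_phase_shift -imdot_area_sum -imdot_imquat.
    rewrite opprD addrACA subrr add0r distrC.
    rewrite -imdotB.
    apply: (le_trans (imdot_le _ _)); rewrite ler_wpM2l// leNgt.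
    by apply/negP => h; move/negP: oQ; apply; exact: mem_set.
  rewrite (RintegralD measurableT i2 (ic _)) RintegralZl//.
  have -> : \int[P]_(omega in setT) cst (E * B * L * e1) omega = E * B * L * e1.
    have PT : P setT = 1%E := probability_setT P.
    by rewrite Rintegral_cst//= PT mulr1.
  rewrite /Rintegral integral_indic// setIT.
  have PQ' : fine (P Q) <= e1.
    by rewrite -lee_fin fineK// fin_num_measure.
  have eE : e = e1 * (E * B * (L + 2) + 1) by rewrite /e1 mulfVK// gt_eqF.
  have EB0 : 0 <= E * B by rewrite mulr_ge0// ltW.
  have PQ0 : 0 <= fine (P Q) by exact: fine_ge0.
  have h1 : 2 * (E * B) * fine (P Q) <= 2 * (E * B) * e1.
    by rewrite ler_wpM2l// mulr_ge0.
  rewrite [leRHS]eE; have := ltW e10; nra.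
have EW : \int[P]_omega Wf omega = E *
    \int[P]_omega (cos (theta + dot3 lam (a T omega)) * G (zc (w T omega))).
  by rewrite /Wf RintegralZl//; exact: integrable_area_functional.
have lim : E * \int[P]_omega (cos (theta + dot3 lam (a T omega)) * G (zc (w T omega))) =
    cos theta * G 1 by rewrite -EW; exact: cvg_unique cW2 cW.
by rewrite -lim expRN mulKf// gt_eqF.
Unshelve. all: by end_near. Qed.

End AreaExpectation.

Section JacobiPolynomials.
Context {R : realType}.
Variables alpha beta : R.

(* The generator in the variable y = sin^2 r.                                 *)
Definition jacL (p : {poly R}) : {poly R} :=
  2 *: ('X * (p^`()^`() - 'X * p^`()^`())) +
  (2 * (alpha + 1)) *: (p^`() - 'X * p^`()) - (2 * (beta + 1)) *: ('X * p^`()).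

Definition jac_rate (k : nat) : R := 2 * k%:R * (k%:R + alpha + beta + 1).

Lemma jacL_horner p y : (jacL p).[y] = 2 * y * (1 - y) * p^`()^`().[y] +
  (2 * (alpha + 1) * (1 - y) - 2 * (beta + 1) * y) * p^`().[y].
Proof. by rewrite /jacL !(hornerD, hornerN, hornerZ, hornerM, hornerX); ring. Qed.

Lemma jacL_coef p k : (jacL p)`_k =
  2 * k.+1%:R * (k.+1%:R + alpha) * p`_k.+1 - jac_rate k * p`_k.
Proof.
have cd (r : {poly R}) i : r^`()`_i = r`_i.+1 * i.+1%:R by rewrite coef_deriv mulr_natr.
rewrite /jacL /jac_rate !coefB coefD !coefZ !coefXM coefB !coefXM !coefB !coefXM !cd.
case: k => [|[|k]] /=; rewrite ?cd; [ring|ring|].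
have e1 : k.+1%:R = k%:R + 1 :> R by rewrite natr1.
have e2 : k.+2%:R = k%:R + 2 :> R by rewrite -addn2 natrD.
have e3 : k.+3%:R = k%:R + 3 :> R by rewrite -addn3 natrD.
by rewrite e1 e2 e3; ring.
Qed.

Variable m : nat.

Fixpoint jac_coef (k : nat) : R :=
  if k is k'.+1 then
    jac_coef k' * ((jac_rate k' - jac_rate m) / (2 * k%:R * (k%:R + alpha)))
  else 1.

Definition jac : {poly R} := \poly_(k < m.+1) jac_coef k.

Hypotheses (alpha0 : 0 <= alpha) (beta0 : 0 <= beta).

Lemma jac_coef_out k : (m < k)%N -> jac_coef k = 0.
Proof.
elim: k => // k IH; rewrite ltnS leq_eqVlt => /predU1P[<-|mk] /=.
  by rewrite subrr mul0r mulr0.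
by rewrite IH// mul0r.
Qed.

Lemma coef_jac k : jac`_k = jac_coef k.
Proof. by rewrite coef_poly; case: ltnP => // mk; rewrite jac_coef_out. Qed.

Lemma jac_coefS k : 2 * k.+1%:R * (k.+1%:R + alpha) * jac_coef k.+1 =
  (jac_rate k - jac_rate m) * jac_coef k.
Proof.
have H (c x e : R) : c != 0 -> c * (x * (e / c)) = e * x by move=> c0; field.
by apply: H; rewrite !mulf_neq0// gt_eqF// ltr_wpDr.
Qed.

Lemma jacL_jac : jacL jac = - jac_rate m *: jac.
Proof.
apply/polyP => k; rewrite jacL_coef coefZ !coef_jac jac_coefS; ring.
Qed.

Lemma horner_jac0 : jac.[0] = 1.
Proof. by rewrite horner_coef0 coef_jac. Qed.

Lemma jac_rate_ge0 k : 0 <= jac_rate k.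
Proof. by rewrite /jac_rate !mulr_ge0// !addr_ge0. Qed.

Lemma jac_rateB k : jac_rate m - jac_rate k =
  2 * (m%:R - k%:R) * (m%:R + k%:R + alpha + beta + 1).
Proof. rewrite /jac_rate; ring. Qed.

Lemma jac_rate_lt k : (k < m)%N -> jac_rate k < jac_rate m.
Proof.
move=> km; rewrite -subr_gt0 jac_rateB mulr_gt0//.
  by rewrite mulr_gt0// subr_gt0 ltr_nat.
by rewrite !ltr_wpDl// ?addr_ge0.
Qed.

Lemma jac_coef_neq0 k : (k <= m)%N -> jac_coef k != 0.
Proof.
elim: k => [|k IH] km /=; first exact: oner_neq0.
rewrite mulf_neq0 ?IH ?(ltnW km)// mulf_neq0//.
  by rewrite lt_eqF// subr_lt0 jac_rate_lt.
by rewrite invr_neq0// !mulf_neq0// gt_eqF// ltr_wpDr.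
Qed.

Let s := alpha + beta + 1.

Lemma jac_coef_le k : (k <= m)%N ->
  `|jac_coef k| <= ((2 * m%:R + s) ^+ k / k`!%:R) ^+ 2.
Proof.
have s0 : 0 <= s by rewrite !addr_ge0.
elim: k => [|k IH] km /=; first by rewrite normr1 expr0 fact0 divr1 expr1n.
rewrite 2!normrM normfV distrC.
rewrite (_ : ((2 * m%:R + s) ^+ k.+1 / k.+1`!%:R) ^+ 2 =
  ((2 * m%:R + s) ^+ k / k`!%:R) ^+ 2 * ((2 * m%:R + s) ^+ 2 / k.+1%:R ^+ 2)); last first.
  rewrite factS natrM (exprS (2 * m%:R + s) k).
  have h : k`!%:R != 0 :> R by rewrite pnatr_eq0 -lt0n fact_gt0.
  have h' : k.+1%:R != 0 :> R by rewrite pnatr_eq0.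
  by move: (_ ^+ k) (k`!%:R) h (k.+1%:R) h' => Z b b0 c c0; field; rewrite b0 c0.
have k1 : 1 <= k.+1%:R :> R by rewrite ler1n.
have k0 : 0 <= k%:R :> R by [].
have mk : k.+1%:R <= m%:R :> R by rewrite ler_nat.
have kS : k.+1%:R = k%:R + 1 :> R by rewrite natr1.
have s1 : 1 <= s by rewrite /s lerDr addr_ge0.
rewrite ler_pM ?mulr_ge0 ?invr_ge0 ?IH ?(ltnW km)// ?normr_ge0//.
rewrite ler_pM ?invr_ge0 ?normr_ge0//.
  rewrite gtr0_norm; last by rewrite subr_gt0 jac_rate_lt.
  have -> : jac_rate m - jac_rate k = 2 * (m%:R - k%:R) * (m%:R + k%:R + s).
    by rewrite jac_rateB /s; ring.
  have Ms : 0 <= m%:R * s by rewrite mulr_ge0.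
  have Ks : 0 <= k%:R * s by rewrite mulr_ge0.
  by move: (s) Ms Ks => S Ms Ks; nra.
rewrite gtr0_norm; last by rewrite !mulr_gt0 ?ltr_wpDr ?ltr0n.
rewrite lef_pV2 ?posrE ?mulr_gt0 ?exprn_gt0 ?ltr_wpDr ?ltr0n//.
have ka : 0 <= k.+1%:R * alpha by rewrite mulr_ge0.
by move: (k.+1%:R) k1 ka => a k1 ka; rewrite expr2; nra.
Qed.

Lemma expR_ge_exp_coeff (x : R) k : 0 <= x -> x ^+ k / k`!%:R <= expR x.
Proof.
move=> x0; case: k => [|k].
  by rewrite expr0 fact0 divr1; apply: le_trans (expR_ge1Dx x); rewrite lerDl.
by apply: le_trans (expR_ge1Dxn k x0); rewrite lerDr.
Qed.

Definition jac_bound : R := expR (5 * m%:R + 2 * s).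

Lemma sum_jac_coef_le : \sum_(k < m.+1) `|jac_coef k| <= jac_bound.
Proof.
have s0 : 0 <= s by rewrite !addr_ge0.
apply: (@le_trans _ _ (\sum_(k < m.+1) expR (2 * (2 * m%:R + s)))).
  apply: ler_sum => k _; apply: (le_trans (jac_coef_le (ltn_ord k))).
  rewrite expRM_natl lerXn2r ?nnegrE ?expR_ge0 ?divr_ge0 ?exprn_ge0 ?addr_ge0//.
  by rewrite expR_ge_exp_coeff// addr_ge0.
rewrite sumr_const card_ord -[X in X <= _]mulr_natl /jac_bound.
rewrite (_ : 5 * m%:R + 2 * s = m%:R + 2 * (2 * m%:R + s)); last by ring.
by rewrite expRD ler_wpM2r ?expR_ge0// -natr1 addrC expR_ge1Dx.
Qed.

Lemma horner_jac y : jac.[y] = \sum_(k < m.+1) jac_coef k * y ^+ k.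
Proof. by rewrite horner_poly. Qed.

Lemma jac_le y : 0 <= y <= 1 -> `|jac.[y]| <= jac_bound.
Proof.
move=> /andP[y0 y1]; rewrite horner_jac; apply: le_trans sum_jac_coef_le.
apply: (le_trans (ler_norm_sum _ _ _)); apply: ler_sum => k _.
by rewrite normrM ler_piMr// ger0_norm ?exprn_ge0// exprn_ile1.
Qed.

Lemma jac_near1 y : 0 <= y <= 1 -> `|jac.[y] - 1| <= y * jac_bound.
Proof.
move=> /andP[y0 y1]; rewrite horner_jac big_ord_recl /= expr0 mulr1 addrAC subrr add0r.
apply: (le_trans (ler_norm_sum _ _ _)).
apply: (@le_trans _ _ (y * \sum_(k < m) `|jac_coef k.+1|)); last first.
  rewrite ler_wpM2l//; apply: le_trans sum_jac_coef_le.
  by rewrite [leRHS]big_ord_recl lerDr.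
rewrite mulr_sumr; apply: ler_sum => k _; rewrite normrM mulrC ler_wpM2r//.
rewrite /bump /= add1n exprS normrM (ger0_norm y0) ler_piMr//.
by rewrite ger0_norm ?exprn_ge0// exprn_ile1.
Qed.

End JacobiPolynomials.

Section JacobiSpan.
Context {R : realType}.
Variables alpha beta : R.
Hypotheses (alpha0 : 0 <= alpha) (beta0 : 0 <= beta).

Lemma jac_span (l1 l2 : {poly R} -> R) :
  (forall c p q, l1 (c *: p + q) = c * l1 p + l1 q) ->
  (forall c p q, l2 (c *: p + q) = c * l2 p + l2 q) ->
  (forall m, l1 (jac alpha beta m) = l2 (jac alpha beta m)) ->
  forall p, l1 p = l2 p.
Proof.
move=> lin1 lin2 eqj.
have l0 : l1 0 = l2 0.
  have e1 : l1 0 = 0.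
    by have := lin1 1 0 0; rewrite scaler0 addr0 mul1r => /eqP; rewrite -subr_eq subrr eq_sym => /eqP.
  have e2 : l2 0 = 0.
    by have := lin2 1 0 0; rewrite scaler0 addr0 mul1r => /eqP; rewrite -subr_eq subrr eq_sym => /eqP.
  by rewrite e1 e2.
suff H N (p : {poly R}) : (size p <= N)%N -> l1 p = l2 p by move=> p; exact: (H (size p)).
elim: N p => [|m IH] p.
  by rewrite leqn0 size_poly_eq0 => /eqP ->.
move=> sp; set c := p`_m / (jac alpha beta m)`_m.
have cm : (jac alpha beta m)`_m != 0 by rewrite coef_jac// jac_coef_neq0.
have -> : p = c *: jac alpha beta m + (p - c *: jac alpha beta m) by rewrite addrC subrK.
rewrite lin1 lin2 eqj IH//.
apply/leq_sizeP => j; rewrite leq_eqVlt => /predU1P[<-|mj].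
  by rewrite coefB coefZ /c mulfVK// subrr.
rewrite coefB coefZ coef_jac// jac_coef_out// mulr0 subr0.
by move/leq_sizeP: sp; apply.
Qed.

End JacobiSpan.

Section SinSquare.
Context {R : realType}.
Implicit Types (p : {poly R}) (r : R).

Definition on_sin2 p r : R := p.[sin r ^+ 2].

Lemma is_derive_sin2 r : is_derive r (1 : R) (fun r : R => sin r ^+ 2) (2 * (sin r * cos r)).
Proof.
apply: is_derive_val (is_derive_pow 1 (is_derive_sin r)) _.
by rewrite expr1 mulrA.
Qed.

Lemma is_derive_on_sin2 p r :
  is_derive r (1 : R) (on_sin2 p) (p^`().[sin r ^+ 2] * (2 * (sin r * cos r))).
Proof.
exact: (is_derive_comp_dir (f := fun r : R => sin r ^+ 2)
  (is_derive_poly p (sin r ^+ 2)) (is_derive_sin2 r)).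
Qed.

Lemma is_derive_sincos r : is_derive r (1 : R) (fun r : R => 2 * (sin r * cos r))
  (2 * (cos r ^+ 2 - sin r ^+ 2)).
Proof.
apply: is_derive_val (is_derive_prod (is_derive_cst (2 : R) r (1 : R))
  (is_derive_prod (is_derive_sin r) (is_derive_cos r))) _.
by rewrite /cst; ring.
Qed.

Lemma is_derive_on_sin2_2 p r : is_derive r (1 : R)
  (fun r : R => p^`().[sin r ^+ 2] * (2 * (sin r * cos r)))
  (p^`()^`().[sin r ^+ 2] * (2 * (sin r * cos r)) ^+ 2 +
   p^`().[sin r ^+ 2] * (2 * (cos r ^+ 2 - sin r ^+ 2))).
Proof.
apply: is_derive_val (is_derive_prod (is_derive_on_sin2 p^`() r) (is_derive_sincos r)) _.
by rewrite /on_sin2; ring.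
Qed.

Lemma continuous_sin2 : continuous (fun r : R => sin r ^+ 2).
Proof.
move=> r; apply: differentiable_continuous; apply/derivable1_diffP.
by case: (is_derive_sin2 r).
Qed.

Lemma continuous_on_sin2 p : continuous (on_sin2 p).
Proof.
move=> r; apply: differentiable_continuous; apply/derivable1_diffP.
by case: (is_derive_on_sin2 p r).
Qed.

Lemma derive1_on_sin2 p : derive1 (on_sin2 p) =
  (fun r : R => p^`().[sin r ^+ 2] * (2 * (sin r * cos r))).
Proof. by apply/funext => r; rewrite derive1E; case: (is_derive_on_sin2 p r). Qed.

Lemma derive1n2_on_sin2 p : derive1n 2 (on_sin2 p) = (fun r : R =>
   p^`()^`().[sin r ^+ 2] * (2 * (sin r * cos r)) ^+ 2 +
   p^`().[sin r ^+ 2] * (2 * (cos r ^+ 2 - sin r ^+ 2))).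
Proof.
rewrite derive1nS derive1n1 derive1_on_sin2; apply/funext => r; rewrite derive1E.
by case: (is_derive_on_sin2_2 p r).
Qed.

Lemma neumann_on_sin2 p : neumann (on_sin2 p).
Proof.
split.
- by move=> r; case: (is_derive_on_sin2 p r).
- by move=> r; rewrite derive1_on_sin2; case: (is_derive_on_sin2_2 p r).
- pose Q : {poly R} := 4 *: ('X * (p^`()^`() - 'X * p^`()^`())) +
    2 *: (p^`() - 2 *: ('X * p^`())).
  rewrite (_ : derive1n 2 _ = on_sin2 Q); first exact: continuous_on_sin2.
  rewrite derive1n2_on_sin2; apply/funext => r.
  rewrite /on_sin2 /Q !(hornerD, hornerN, hornerZ, hornerM, hornerX).
  by rewrite -[cos r ^+ 2](addrK (sin r ^+ 2)) cos2Dsin2 exprMn exprMn -[cos r ^+ 2](addrK (sin r ^+ 2)) cos2Dsin2; ring.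
- by rewrite derive1_on_sin2 sin0 mul0r !mulr0.
- by rewrite derive1_on_sin2 cos_pihalf !mulr0.
Qed.

Lemma sin_gt0_pihalf r : 0 < r < pi / 2 -> 0 < sin r.
Proof.
move=> /andP[r0 r1]; apply: sin_gt0_pi; rewrite r0/=.
by apply: (lt_le_trans r1); rewrite ler_pdivrMr// ler_pMr ?pi_gt0// ler1n.
Qed.

Lemma cos_gt0_pihalf' r : 0 < r < pi / 2 -> 0 < cos r.
Proof.
move=> /andP[r0 r1]; apply: cos_gt0_pihalf; rewrite r1 andbT.
by rewrite (lt_trans _ r0)// oppr_lt0 divr_gt0// pi_gt0.
Qed.

Lemma jacobi_generator_on_sin2 (alpha beta : R) p r : 0 < r < pi / 2 ->
  jacobi_generator alpha beta (on_sin2 p) r = on_sin2 (jacL alpha beta p) r.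
Proof.
move=> hr; rewrite /jacobi_generator derive1n2_on_sin2 derive1_on_sin2.
rewrite /on_sin2 jacL_horner /tan.
have s0 : sin r != 0 by rewrite gt_eqF// sin_gt0_pihalf.
have c0 : cos r != 0 by rewrite gt_eqF// cos_gt0_pihalf'.
have -> : 1 - sin r ^+ 2 = cos r ^+ 2 by rewrite -cos2sin2 ; ring.
by field; rewrite s0 c0.
Qed.

End SinSquare.

Section KernelOperator.
Context {R : realType}.
Notation mu := (@lebesgue_measure R).
Notation I := (`[0, pi / 2]%classic : set R).
Variables (alpha beta : R) (q : R -> R -> R -> R).
Hypothesis J : jacobi_density alpha beta q.

Let mI : measurable I. Proof. exact: measurable_itv. Qed.

Lemma pihalf_gt0 : 0 < pi / 2 :> R. Proof. by rewrite divr_gt0// pi_gt0. Qed.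

Lemma density_integrable t x : 0 < t -> x \in `[0, pi / 2] ->
  mu.-integrable I (EFin \o q t x).
Proof.
move=> t0 xI; apply/integrableP; split.
  by apply/measurable_EFinP; exact: jd_measurable J _ _ t0 xI.
have -> : (\int[mu]_(y in I) `|(EFin \o q t x) y| = 1)%E.
  rewrite -(jd_mass1 J t0 xI); apply: eq_integral => y /set_mem yI /=.
  by rewrite ger0_norm//; apply: (jd_ge0 J t0 xI).
by rewrite ltry.
Qed.

Lemma density_mul_integrable (t x : R) (f : R -> R) (C : R) : 0 < t -> x \in `[0, pi / 2] ->
  measurable_fun I f -> (forall y, I y -> `|f y| <= C) ->
  mu.-integrable I (EFin \o (fun y => q t x y * f y)).
Proof.
move=> t0 xI mf fC.
have i1 := density_integrable t0 xI.
have i2 : mu.-integrable I (fun y => (C%:E * (EFin \o q t x) y)%E).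
  exact: (@integrableZl _ _ R mu _ mI C _ i1).
apply: le_integrable i2 => //.
  by apply/measurable_EFinP; apply: measurable_funM => //; exact: jd_measurable J _ _ t0 xI.
move=> y yI; rewrite /= lee_fin !normrM mulrC.
have q0 : 0 <= q t x y by apply: (jd_ge0 J t0 xI).
rewrite ler_wpM2r// (le_trans (fC y yI))//; exact: ler_norm.
Qed.

Lemma kernel_op_le (t x : R) (f : R -> R) (C : R) : 0 < t -> x \in `[0, pi / 2] ->
  measurable_fun I f -> (forall y, I y -> `|f y| <= C) ->
  `|kernel_op q t f x| <= C.
Proof.
move=> t0 xI mf fC; rewrite /kernel_op.
have i1 := density_integrable t0 xI.
have i2 := density_mul_integrable t0 xI mf fC.
have i3 : mu.-integrable I (EFin \o (fun y => C * q t x y)).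
  have h : mu.-integrable I (fun y => (C%:E * (EFin \o q t x) y)%E).
    exact: (@integrableZl _ _ R mu _ mI C _ i1).
  by apply: eq_integrable h => // y _.
apply: (le_trans (@le_normr_Rintegral _ _ R mu _ _ mI i2)).
apply: (le_trans (@le_Rintegral _ _ R mu _ _ _ mI (@integrable_norm _ _ R mu _ _ i2) i3 _)).
  move=> y yI; rewrite /= normrM mulrC.
  have q0 : 0 <= q t x y by apply: (jd_ge0 J t0 xI).
  by rewrite (ger0_norm q0) ler_wpM2r// fC.
rewrite (@RintegralZl _ _ R mu)//.
by rewrite /Rintegral (jd_mass1 J t0 xI) mulr1.
Qed.

Lemma kernel_op_linear (t x : R) (f g : R -> R) (Cf Cg c : R) : 0 < t -> x \in `[0, pi / 2] ->
  measurable_fun I f -> (forall y, I y -> `|f y| <= Cf) ->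
  measurable_fun I g -> (forall y, I y -> `|g y| <= Cg) ->
  kernel_op q t (fun y => c * f y + g y) x =
  c * kernel_op q t f x + kernel_op q t g x.
Proof.
move=> t0 xI mf fC mg gC; rewrite /kernel_op.
have i1 := density_mul_integrable t0 xI mf fC.
have i2 := density_mul_integrable t0 xI mg gC.
have i3 : mu.-integrable I (EFin \o (fun y => c * (q t x y * f y))).
  have h : mu.-integrable I (fun y => (c%:E * (EFin \o (fun y => (q t x y * f y)%R)) y)%E).
    exact: (@integrableZl _ _ R mu _ mI c _ i1).
  by apply: eq_integrable h => // y _.
rewrite -(@RintegralZl _ _ R mu)// -(@RintegralD _ _ R mu)//.
by apply: eq_Rintegral => y _; rewrite mulrDr mulrCA.
Qed.

End KernelOperator.

Section Eigenfunctions.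
Context {R : realType}.
Notation mu := (@lebesgue_measure R).
Notation I := (`[0, pi / 2]%classic : set R).
Variables (alpha beta : R) (q : R -> R -> R -> R).
Hypothesis J : jacobi_density alpha beta q.

Let ph0 : 0 < pi / 2 :> R := pihalf_gt0.

Lemma norm_le_closed (g : R -> R) (a b C : R) : a < b ->
  {within `[a, b], continuous g} -> (forall x, a < x < b -> `|g x| <= C) ->
  forall x, a <= x <= b -> `|g x| <= C.
Proof.
move=> ab /(continuous_within_itvP _ ab) [_ gl gr] h x /andP[].
rewrite le_eqVlt => /predU1P[<- _|ax].
  have ng : `|g y| @[y --> a^'+] --> `|g a| by exact: cvg_norm.
  apply: (ler_cvg_to ng (cvg_cst C)).
  by near=> y; apply: h; apply/andP; split; near: y; [exact: nbhs_right_gt|exact: nbhs_right_lt].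
rewrite le_eqVlt => /predU1P[->|xb]; last by apply: h; rewrite ax.
have ng : `|g y| @[y --> b^'-] --> `|g b| by exact: cvg_norm.
apply: (ler_cvg_to ng (cvg_cst C)).
by near=> y; apply: h; apply/andP; split; near: y; [exact: nbhs_left_gt|exact: nbhs_left_lt].
Unshelve. all: by end_near. Qed.

Lemma within_measurable (f : R -> R) : {within I, continuous f} -> measurable_fun I f.
Proof. by move=> cf; apply: subspace_continuous_measurable_fun => //; exact: measurable_itv. Qed.

Lemma within_bounded (f : R -> R) : {within I, continuous f} ->
  exists2 C, 0 <= C & forall y, I y -> `|f y| <= C.
Proof.
move=> cf; have cf' : {within I, continuous (fun y => `|f y|)}.
  by move=> y; apply: (@continuous_comp _ _ _ _ (fun z : R => `|z|)); [exact: cf|exact: norm_continuous].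
have [c _ hc] := EVT_max (ltW ph0) cf'.
by exists `|f c| => // y yI; exact: hc.
Qed.

Let zI : (0 : R) \in `[0, pi / 2]%R. Proof. by rewrite in_itv /= lexx ltW. Qed.

Lemma kernel_op_eigen (f : R -> R) (a t : R) : neumann f -> 0 <= a ->
  (forall x, 0 < x < pi / 2 -> jacobi_generator alpha beta f x = - a * f x) ->
  0 < t -> kernel_op q t f 0 = expR (- (a * t)) * f 0.
Proof.
move=> nf a0 ev t0.
have cf : {within I, continuous f}.
  apply: continuous_subspaceT => x; apply: differentiable_continuous.
  by apply/derivable1_diffP; case: nf.
have [C C0 fC] := within_bounded cf.
have mf := within_measurable cf.
suff H (e : R) : 0 < e -> `|kernel_op q t f 0 - expR (- (a * t)) * f 0| <= e * t.
  apply/eqP; rewrite -subr_eq0 -normr_le0; apply/ler_addgt0Pl => e e0; rewrite addr0.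
  have := H (e / t); rewrite mulfVK ?gt_eqF//; apply; exact: divr_gt0.
move=> e0; have e2 : 0 < e / 2 by rewrite divr_gt0.
have [delta d0 hd] := jd_generator J nf e2.
have c1 : 0 < 2 * (a ^+ 2 * C + 1) by rewrite mulr_gt0// ltr_wpDl// mulr_ge0// sqr_ge0.
have d1 : 0 < Num.min delta (e / (2 * (a ^+ 2 * C + 1))) / t.
  by rewrite divr_gt0// lt_min d0 divr_gt0.
near \oo => N.
have N0 : 0 < N.+1%:R :> R by [].
pose h := t / N.+1%:R.
have h0 : 0 < h by rewrite divr_gt0.
have hN : N.+1%:R^-1 < Num.min delta (e / (2 * (a ^+ 2 * C + 1))) / t.
  by near: N; exact: near_infty_natSinv_lt (PosNum d1).
have : h < Num.min delta (e / (2 * (a ^+ 2 * C + 1))).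
  by rewrite /h mulrC -ltr_pdivlMr.
rewrite lt_min => /andP[hdel he].
have one x : I x -> `|kernel_op q h f x - expR (- (a * h)) * f x| <= e * h.
  move=> xI; pose g x := kernel_op q h f x - expR (- (a * h)) * f x.
  have cg : {within I, continuous g}.
    apply: within_continuousB; first exact: jd_feller J _ _ h0 cf.
    move=> y; apply: (@continuous_comp _ _ _ _ (fun z : R => expR (- (a * h)) * z)).
      exact: cf.
    exact: mulrl_continuous.
  move: xI; rewrite /= in_itv /=; apply: (norm_le_closed ph0 cg) => {}x xo.
  have xI : x \in `]0, pi / 2[%R by rewrite in_itv.
  have fx : `|f x| <= C by apply: fC; rewrite /= in_itv /=; case/andP: xo => /ltW -> /ltW ->.
  have := hd h x h0 hdel xI; rewrite ev// => h1.
  have -> : g x = h * ((kernel_op q h f x - f x) / h - - a * f x) +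
      (1 - expR (- (a * h)) - a * h) * f x.
    by rewrite /g; field; rewrite gt_eqF.
  apply: (le_trans (ler_normD _ _)); rewrite (normrM h) (gtr0_norm h0) (normrM (1 - _ - _)).
  have ah0 : 0 <= a * h by rewrite mulr_ge0// ltW.
  have h2 : `|1 - expR (- (a * h)) - a * h| * `|f x| <= (a * h) ^+ 2 * C.
    by rewrite ler_pM// expRN_taylor.
  have h3 : h * (a ^+ 2 * C) <= e / 2.
    have : h * (2 * (a ^+ 2 * C + 1)) < e by rewrite -ltr_pdivlMr.
    lra.
  have h4 : (a * h) ^+ 2 * C = h * (h * (a ^+ 2 * C)) by ring.
  have h5 : h * (h * (a ^+ 2 * C)) <= h * (e / 2) by rewrite ler_wpM2l// ltW.
  have h6 : h * `|(kernel_op q h f x - f x) / h - - a * f x| <= h * (e / 2).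
    by rewrite ler_wpM2l// ltW.
  lra.
have step k : `|kernel_op q (h * k.+1%:R) f 0 - expR (- (a * (h * k.+1%:R))) * f 0| <=
    e * (h * k.+1%:R).
  elim: k => [|k IH]; first by rewrite mulr1; apply: one; rewrite /= in_itv /= lexx ltW.
  have hk0 : 0 < h * k.+1%:R by rewrite mulr_gt0.
  have -> : h * k.+2%:R = h * k.+1%:R + h by rewrite -[k.+2]addn1 natrD mulrDr mulr1.
  have cK : {within I, continuous (kernel_op q h f)} by exact: jd_feller J _ _ h0 cf.
  rewrite (jd_semigroup J hk0 h0 zI cf).
  pose g x := kernel_op q h f x - expR (- (a * h)) * f x.
  have mg : measurable_fun I g.
    apply: measurable_funB; first exact: within_measurable.
    by apply: measurable_funM.
  have -> : kernel_op q (h * k.+1%:R) (kernel_op q h f) 0 =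
      expR (- (a * h)) * kernel_op q (h * k.+1%:R) f 0 + kernel_op q (h * k.+1%:R) g 0.
    rewrite -(kernel_op_linear J _ hk0 zI mf fC mg one).
    rewrite /kernel_op; apply: eq_Rintegral => y _; rewrite /g.
    by rewrite addrC subrK.
  have hg := kernel_op_le J hk0 zI mg one.
  have -> : expR (- (a * (h * k.+1%:R + h))) =
      expR (- (a * h)) * expR (- (a * (h * k.+1%:R))).
    by rewrite -expRD; congr expR; ring.
  rewrite addrAC -[expR _ * expR _ * _]mulrA -mulrBr.
  apply: (le_trans (ler_normD _ _)); rewrite normrM (ger0_norm (expR_ge0 _)).
  rewrite [leRHS]mulrDr lerD// (le_trans _ IH)// ler_piMl//.
  by rewrite -expR0 ler_expR oppr_le0 mulr_ge0// ltW.
by have := step N; rewrite /h mulfVK// gt_eqF.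
Unshelve. all: by end_near. Qed.

Hypotheses (alpha0 : 0 <= alpha) (beta0 : 0 <= beta).

Lemma kernel_op_jac m t : 0 < t ->
  kernel_op q t (on_sin2 (jac alpha beta m)) 0 = expR (- (jac_rate alpha beta m * t)).
Proof.
move=> t0; rewrite (@kernel_op_eigen _ (jac_rate alpha beta m))//.
- by rewrite /on_sin2 sin0 expr0n /= horner_jac0 mulr1.
- exact: neumann_on_sin2.
- exact: jac_rate_ge0.
- move=> x xo; rewrite jacobi_generator_on_sin2// /on_sin2 jacL_jac//.
  by rewrite hornerZ.
Qed.

End Eigenfunctions.

Section Bernstein.
Context {R : realType}.
Implicit Types (N : nat) (h : nat -> R).

(* The expectation of h(k) for k binomial with parameters N and 'X, computed  *)
(* by conditioning on the first trial.                                        *)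
Fixpoint bernstein N h : {poly R} :=
  if N is N'.+1 then
    'X * bernstein N' (fun k => h k.+1) + (1 - 'X) * bernstein N' h
  else (h 0)%:P.

Lemma bernsteinS N h (x : R) : (bernstein N.+1 h).[x] =
  x * (bernstein N (fun k => h k.+1)).[x] + (1 - x) * (bernstein N h).[x].
Proof. by rewrite /= !(hornerD, hornerN, hornerM, hornerX, hornerC). Qed.

Lemma bernstein_le N h h' (x : R) : 0 <= x <= 1 ->
  (forall k, (k <= N)%N -> h k <= h' k) ->
  (bernstein N h).[x] <= (bernstein N h').[x].
Proof.
move=> /andP[x0 x1]; elim: N h h' => [|N IH] h h' hh.
  by rewrite /= !hornerC hh.
rewrite !bernsteinS lerD// ler_wpM2l ?subr_ge0//; apply: IH => k kN; apply: hh => //.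
exact: leqW.
Qed.

Lemma bernstein_lin N h h' (a x : R) :
  (bernstein N (fun k => a * h k + h' k)).[x] =
  a * (bernstein N h).[x] + (bernstein N h').[x].
Proof.
elim: N h h' => [|N IH] h h'; first by rewrite /= !hornerC.
by rewrite !bernsteinS !IH; ring.
Qed.

Lemma bernstein_cst N (a x : R) : (bernstein N (fun=> a)).[x] = a.
Proof. by elim: N => [|N IH]; rewrite ?bernsteinS ?IH /= ?hornerC//; ring. Qed.

Lemma bernstein_var N (c x : R) : (bernstein N (fun k => (k%:R - c) ^+ 2)).[x] =
  N%:R * x * (1 - x) + (N%:R * x - c) ^+ 2.
Proof.
elim: N c => [|N IH] c; first by rewrite /= hornerC; ring.
rewrite bernsteinS IH.
have -> : (fun k => (k.+1%:R - c) ^+ 2) = (fun k => (k%:R - (c - 1)) ^+ 2) :> (nat -> R).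
  by apply/funext => k; rewrite -natr1; ring.
by rewrite IH -natr1; ring.
Qed.

Lemma poly_approx (g : R -> R) : {within `[0, 1]%classic, continuous g} ->
  forall e : R, 0 < e -> exists p : {poly R}, forall x, 0 <= x <= 1 ->
  `|p.[x] - g x| <= e.
Proof.
move=> cg e e0; have e2 : 0 < e / 2 by rewrite divr_gt0.
have [delta d0 hd] := heine (@segment_compact R 0 1) cg e2.
have cng : {within `[0, 1]%classic, continuous (fun y => `|g y|)}.
  by move=> y; apply: (@continuous_comp _ _ _ _ (fun z : R => `|z|)); [exact: cg|exact: norm_continuous].
have [c _ hc] := EVT_max (@ler01 R) cng.
pose M := `|g c| + 1.
have M0 : 0 < M by rewrite ltr_wpDl.
have gM x : 0 <= x <= 1 -> `|g x| <= M.
  by move=> x01; rewrite (le_trans (hc x _)) ?in_itv// lerDl.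
have d2 : 0 < delta ^+ 2 by rewrite exprn_gt0.
have b0 : 0 < e * delta ^+ 2 / (4 * M) by rewrite divr_gt0// ?mulr_gt0.
near \oo => N.
have hN : N.+1%:R^-1 < e * delta ^+ 2 / (4 * M).
  by near: N; exact: near_infty_natSinv_lt (PosNum b0).
exists (bernstein N.+1 (fun k => g (k%:R / N.+1%:R))) => x x01.
have N0 : 0 < N.+1%:R :> R by [].
have kb (k : nat) : (k <= N.+1)%N -> 0 <= (k%:R / N.+1%:R : R) <= 1.
  by move=> kN; rewrite divr_ge0//= ler_pdivrMr// mul1r ler_nat.
pose A := 2 * M / (N.+1%:R * delta) ^+ 2.
have A0 : 0 <= A by apply: divr_ge0; [rewrite mulr_ge0// ltW|exact: sqr_ge0].
have key (k : nat) : (k <= N.+1)%N ->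
    `|g (k%:R / N.+1%:R) - g x| <= A * (k%:R - N.+1%:R * x) ^+ 2 + e / 2.
  move=> kN; have [hx|hx] := ltP `|x - k%:R / N.+1%:R| delta.
    have := hd x (k%:R / N.+1%:R); rewrite /= !in_itv /= => /(_ x01 (kb _ kN)).
    rewrite /ball /= => /(_ hx) /ltW; rewrite distrC => h1.
    by apply: (le_trans h1); rewrite lerDr mulr_ge0// sqr_ge0.
  have h1 : `|g (k%:R / N.+1%:R) - g x| <= 2 * M.
    by have := gM _ (kb _ kN); have := gM _ x01; have := ler_normB (g (k%:R / N.+1%:R)) (g x); lra.
  apply: (le_trans h1); rewrite -[leLHS]addr0 lerD ?(ltW e2)//.
  rewrite /A -mulrA ler_peMr ?mulr_ge0 ?(ltW M0)//.
  rewrite mulrC ler_pdivlMr ?mul1r ?exprn_gt0 ?mulr_gt0//.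
  rewrite -[leRHS]real_normK ?num_real// lerXn2r ?nnegrE ?mulr_ge0 ?(ltW d0)//.
  have -> : `|k%:R - N.+1%:R * x| = N.+1%:R * `|x - k%:R / N.+1%:R|.
    rewrite -{2}(gtr0_norm N0) -normrM distrC; congr (`|_|).
    by field; rewrite gt_eqF.
  by rewrite ler_pM2l.
have up := @bernstein_le N.+1 (fun k => g (k%:R / N.+1%:R))
  (fun k => A * (k%:R - N.+1%:R * x) ^+ 2 + (e / 2 + g x)) x x01.
have lo := @bernstein_le N.+1 (fun k => - A * (k%:R - N.+1%:R * x) ^+ 2 + (g x - e / 2))
  (fun k => g (k%:R / N.+1%:R)) x x01.
rewrite bernstein_lin bernstein_cst bernstein_var subrr expr0n /= addr0 in up.
rewrite bernstein_lin bernstein_cst bernstein_var subrr expr0n /= addr0 in lo.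
have var : A * (N.+1%:R * x * (1 - x)) <= e / 2.
  case/andP: (x01) => x0 x1.
  have h1 : A * (N.+1%:R * x * (1 - x)) <= A * N.+1%:R.
    by rewrite ler_wpM2l// -mulrA ler_piMr// mulr_ile1// ?subr_ge0// lerBlDr lerDl.
  apply: (le_trans h1).
  have -> : A * N.+1%:R = N.+1%:R^-1 * (2 * M / delta ^+ 2).
    by rewrite /A; field; rewrite !gt_eqF.
  rewrite -ler_pdivlMr ?divr_gt0 ?mulr_gt0//.
  apply: (le_trans (ltW hN)); rewrite le_eqVlt; apply/orP; left; apply/eqP.
  by field; rewrite !gt_eqF.
rewrite ler_distl; apply/andP; split.
  have : (bernstein N.+1 (fun k => g (k%:R / N.+1%:R))).[x] >=
      - A * (N.+1%:R * x * (1 - x)) + (g x - e / 2).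
    by apply: lo => k /key; rewrite ler_distl => /andP[+ _]; lra.
  rewrite mulNr; lra.
have : (bernstein N.+1 (fun k => g (k%:R / N.+1%:R))).[x] <=
    A * (N.+1%:R * x * (1 - x)) + (e / 2 + g x).
  by apply: up => k /key; rewrite ler_distl => /andP[_]; lra.
lra.
Unshelve. all: by end_near. Qed.

End Bernstein.

Lemma integrable_mul_bounded (R : realType) (d : measure_display) (T : measurableType d)
    (m : {measure set T -> \bar R}) (D : set T) (f h : T -> R) (C : R) :
  measurable D -> m.-integrable D (EFin \o f) -> measurable_fun D h ->
  (forall x, D x -> `|h x| <= C) -> m.-integrable D (EFin \o (fun x => f x * h x)).
Proof.
move=> mD fi mh hC.
have i2 : m.-integrable D (fun x => (C%:E * (EFin \o f) x)%E) by exact: integrableZl.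
apply: le_integrable i2 => //.
  apply/measurable_EFinP; apply: measurable_funM => //.
  by apply/measurable_EFinP; exact: measurable_int fi.
move=> x xD; rewrite /= lee_fin !normrM mulrC ler_wpM2r//.
by rewrite (le_trans (hC x xD))// ler_norm.
Qed.

Section PolynomialTestFunctions.
Context {R : realType} {d1 d2 : measure_display}.
Context {T1 : measurableType d1} {T2 : measurableType d2}.
Variables (m1 : {measure set T1 -> \bar R}) (m2 : {measure set T2 -> \bar R}).
Variables (D1 : set T1) (D2 : set T2) (mD1 : measurable D1) (mD2 : measurable D2).
Variables (f1 Y1 : T1 -> R) (f2 Y2 : T2 -> R).
Hypotheses (i1 : m1.-integrable D1 (EFin \o f1)) (i2 : m2.-integrable D2 (EFin \o f2)).
Hypotheses (mY1 : measurable_fun D1 Y1) (mY2 : measurable_fun D2 Y2).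
Hypotheses (Y1b : forall x, D1 x -> 0 <= Y1 x <= 1)
  (Y2b : forall x, D2 x -> 0 <= Y2 x <= 1).

Let approx d (T : measurableType d) (m : {measure set T -> \bar R}) (D : set T)
    (mD : measurable D) (f Y : T -> R) (fi : m.-integrable D (EFin \o f))
    (mY : measurable_fun D Y) (Yb : forall x, D x -> 0 <= Y x <= 1)
    (g p : R -> R) (e : R) : continuous g -> continuous p ->
  (forall y, 0 <= y <= 1 -> `|p y - g y| <= e) ->
  `|(\int[m]_(x in D) (f x * p (Y x))) - \int[m]_(x in D) (f x * g (Y x))| <=
    e * \int[m]_(x in D) `|f x|.
Proof.
move=> cg cp pg.
have int h : continuous h -> m.-integrable D (EFin \o (fun x => f x * h (Y x))).
  move=> ch.
  have chn : {within `[0, 1]%classic, continuous (fun y : R => `|h y|)}.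
    apply: continuous_subspaceT => y.
    by apply: (@continuous_comp _ _ _ _ (fun z : R => `|z|)); [exact: ch|exact: norm_continuous].
  have [c _ hc] := EVT_max (@ler01 R) chn.
  apply: (@integrable_mul_bounded _ _ _ _ _ _ _ `|h c|) => //.
    by apply: measurableT_comp => //; exact: continuous_measurable_fun.
  by move=> x Dx; apply: hc; rewrite in_itv /= Yb.
rewrite -RintegralB ?int//.
have i3 : m.-integrable D (EFin \o (fun x => f x * p (Y x) - f x * g (Y x))).
  apply: eq_integrable (integrableB mD (int p cp) (int g cg)) => // y _.
have i4 : m.-integrable D (EFin \o (fun x => e * `|f x|)).
  apply: eq_integrable (integrableZl mD e (integrable_norm fi)) => // y _.
have h := le_normr_Rintegral mD i3; apply: (le_trans h).
rewrite -RintegralZl//; last exact: integrable_norm.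
apply: le_Rintegral => //; first exact: (integrable_norm i3).
move=> x Dx; rewrite -mulrBr normrM mulrC ler_wpM2r//.
by rewrite pg// Yb.
Qed.

Lemma poly_test_ext (g : R -> R) :
  (forall p : {poly R}, \int[m1]_(x in D1) (f1 x * p.[Y1 x]) =
    \int[m2]_(x in D2) (f2 x * p.[Y2 x])) -> continuous g ->
  \int[m1]_(x in D1) (f1 x * g (Y1 x)) = \int[m2]_(x in D2) (f2 x * g (Y2 x)).
Proof.
move=> hp cg; apply/eqP; rewrite -subr_eq0 -normr_le0; apply/ler_addgt0Pl => e e0.
rewrite addr0.
set N1 := \int[m1]_(x in D1) `|f1 x|; set N2 := \int[m2]_(x in D2) `|f2 x|.
have N10 : 0 <= N1 by apply: Rintegral_ge0.
have N20 : 0 <= N2 by apply: Rintegral_ge0.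
have N0 : 0 < N1 + N2 + 1 by rewrite ltr_wpDl// addr_ge0.
have [p hpg] := poly_approx (continuous_subspaceT cg) (divr_gt0 e0 N0).
have cp : continuous (fun y => p.[y]) by exact: continuous_horner.
have a1 := approx mD1 i1 mY1 Y1b cg cp hpg.
have a2 := approx mD2 i2 mY2 Y2b cg cp hpg.
rewrite hp in a1.
have h : e / (N1 + N2 + 1) * (N1 + N2 + 1) = e by rewrite mulfVK// gt_eqF.
have h1 : 0 <= e / (N1 + N2 + 1) by rewrite divr_ge0// ltW.
rewrite -/N1 -/N2 in a1 a2.
move: a1 a2; rewrite !ler_norml => /andP[a1 a1'] /andP[a2 a2'].
by apply/andP; split; nra.
Qed.

End PolynomialTestFunctions.

Section Rays.
Context {R : realType}.

(* A nondecreasing sequence of continuous functions with limit the indicator  *)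
(* of y < min(c, 1), each vanishing in a neighbourhood of 1.                  *)
Definition ray (c : R) (N : nat) (y : R) : R :=
  Num.min 1 (N%:R * Num.max 0 (Num.min c (1 - N.+1%:R^-1) - y)).

Lemma ray_ge0 c N y : 0 <= ray c N y.
Proof. by rewrite le_min ler01 mulr_ge0// le_max lexx. Qed.

Lemma ray_le1 c N y : ray c N y <= 1.
Proof. by rewrite ge_min lexx. Qed.

Lemma ray_eq0 c N y : 1 - N.+1%:R^-1 <= y -> ray c N y = 0.
Proof.
move=> h; rewrite /ray (_ : Num.max 0 _ = 0) ?mulr0; last first.
  by apply/max_idPl; rewrite subr_le0 (le_trans _ h)// ge_min lexx orbT.
by apply/min_idPr.
Qed.

Lemma continuous_ray c N : continuous (ray c N).
Proof.
move=> y.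
have h3 : {for y, continuous (fun y : R => Num.min c (1 - N.+1%:R^-1) - y)}.
  by apply: continuousB; [exact: cst_continuous|exact: id].
have h2 : {for y, continuous (fun y : R => Num.max 0 (Num.min c (1 - N.+1%:R^-1) - y))}.
  by apply: (@continuous_max _ _ (fun=> 0) _ y _ h3); exact: cst_continuous.
have h1 : {for y, continuous (fun y : R =>
    N%:R * Num.max 0 (Num.min c (1 - N.+1%:R^-1) - y))}.
  by apply: continuousM h2; exact: cst_continuous.
by apply: (@continuous_min _ _ (fun=> 1) _ y _ h1); exact: cst_continuous.
Qed.

Lemma ray_mono c M N y : (M <= N)%N -> ray c M y <= ray c N y.
Proof.
move=> MN; rewrite /ray le_min ge_min lexx /= ge_min; apply/orP; right.
apply: ler_pM => //; first by rewrite le_max lexx.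
  by rewrite ler_nat.
rewrite ge_max le_max lexx /= le_max; apply/orP; right.
rewrite lerD2r le_min ge_min lexx /= ge_min; apply/orP; right.
by rewrite lerD2l lerN2 lef_pV2 ?posrE// ler_nat.
Qed.

Lemma cvg_ray (c y : R) : y < 1 ->
  ray c N y @[N --> \oo] --> ((y < c)%R%:R : R).
Proof.
move=> y1; have [yc|cy] := ltP y c; last first.
  apply: cvg_near_cst; apply: nearW => N; rewrite /ray.
  rewrite (_ : Num.max 0 _ = 0) ?mulr0; last first.
    by apply/max_idPl; rewrite subr_le0 (le_trans _ cy)// ge_min lexx.
  by apply/min_idPr.
have [e [e0 e1 e2]] : exists e : R, [/\ 0 < e, e <= c - y & e <= (1 - y) / 2].
  exists (Num.min (c - y) ((1 - y) / 2)); split.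
  - by rewrite lt_min subr_gt0 yc /= divr_gt0// subr_gt0.
  - by rewrite ge_min lexx.
  - by rewrite ge_min lexx orbT.
apply: cvg_near_cst; near=> N; apply/min_idPl.
have h1 : N.+1%:R^-1 < e by near: N; exact: near_infty_natSinv_lt (PosNum e0).
have h2 : e^-1 <= N%:R by near: N; exact: nbhs_infty_ger.
have ey : e <= Num.max 0 (Num.min c (1 - N.+1%:R^-1) - y).
  rewrite le_max; apply/orP; right; rewrite lerBrDr le_min.
  by apply/andP; split; [lra|move: (N.+1%:R^-1) h1 => v h1; lra].
apply: (@le_trans _ _ (e^-1 * e)); first by rewrite mulVf ?gt_eqF.
by apply: ler_pM => //; rewrite ?invr_ge0 ltW.
Unshelve. all: by end_near. Qed.

End Rays.

Section Determinacy.
Context {R : realType} {d1 d2 : measure_display}.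
Context {T1 : measurableType d1} {T2 : measurableType d2}.
Variables (m1 : {measure set T1 -> \bar R}) (m2 : {measure set T2 -> \bar R}).
Variables (D1 : set T1) (D2 : set T2) (mD1 : measurable D1) (mD2 : measurable D2).
Variables (f1 r1 : T1 -> R) (f2 r2 : T2 -> R).
Hypotheses (mf1 : measurable_fun D1 f1) (mf2 : measurable_fun D2 f2).
Hypotheses (f1_ge0 : forall x, D1 x -> 0 <= f1 x) (f2_ge0 : forall x, D2 x -> 0 <= f2 x).
Hypotheses (mr1 : measurable_fun D1 r1) (mr2 : measurable_fun D2 r2).
Hypotheses (r1b : forall x, D1 x -> 0 <= r1 x < pi / 2)
  (r2b : forall x, D2 x -> 0 <= r2 x < pi / 2).
Hypothesis fin1 : (\int[m1]_(x in D1) (f1 x)%:E < +oo)%E.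
Hypothesis rays : forall c N,
  (\int[m1]_(x in D1) (f1 x * ray c N (sin (r1 x) ^+ 2))%:E =
   \int[m2]_(x in D2) (f2 x * ray c N (sin (r2 x) ^+ 2))%:E)%E.

Lemma sin2_lt (x y : R) : 0 <= x <= pi / 2 -> 0 <= y <= pi / 2 ->
  (sin x ^+ 2 < sin y ^+ 2) = (x < y).
Proof.
move=> /andP[x0 x1] /andP[y0 y1].
have b (z : R) : 0 <= z -> z <= pi / 2 -> z \in `[- (pi / 2), pi / 2]%R.
  by move=> z0 z1; rewrite in_itv /= z1 andbT (le_trans _ z0)// oppr_le0 (le_trans z0).
have s (z : R) : 0 <= z -> z <= pi / 2 -> 0 <= sin z.
  move=> z0 z1; apply: sin_ge0_pi; rewrite z0 /=; apply: (le_trans z1).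
  by rewrite ler_pdivrMr// ler_peMr ?pi_ge0// ler1n.
by rewrite ltr_pXn2r ?nnegrE ?s// ltr_sin ?b.
Qed.

Lemma sin2_lt1 (x : R) : 0 <= x < pi / 2 -> sin x ^+ 2 < 1.
Proof.
move=> /andP[x0 x1]; rewrite -[X in _ < X](expr1n _ 2) -sin_pihalf sin2_lt ?x1//.
  by rewrite x0 ltW.
by rewrite lexx andbT divr_ge0// pi_ge0.
Qed.

Let cvg_rays d (T : measurableType d) (m : {measure set T -> \bar R}) (D : set T)
    (mD : measurable D) (f r : T -> R) (mf : measurable_fun D f)
    (f0 : forall x, D x -> 0 <= f x) (mr : measurable_fun D r)
    (rb : forall x, D x -> 0 <= r x < pi / 2) (c : R) :
  (\int[m]_(x in D) (f x * ray c N (sin (r x) ^+ 2))%:E @[N --> \oo] -->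
   \int[m]_(x in D `&` (fun x => (sin (r x) ^+ 2)%R) @^-1` `]-oo, c[) (f x)%:E)%E.
Proof.
have ms : measurable_fun D (fun x => sin (r x) ^+ 2).
  apply: measurable_funX; apply: measurableT_comp => //.
  by apply: continuous_measurable_fun; exact: continuous_sin.
have -> : (\int[m]_(x in D `&` (fun x => (sin (r x) ^+ 2)%R) @^-1` `]-oo, c[) (f x)%:E =
    \int[m]_(x in D) (f x * (sin (r x) ^+ 2 < c)%R%:R)%:E)%E.
  rewrite integral_mkcondr; apply: eq_integral => x _.
  rewrite /patch; have [xc|xc] := boolP (sin (r x) ^+ 2 < c).
    by rewrite mem_set ?mulr1//= in_itv /= xc.
  by rewrite memNset ?mulr0//= in_itv /= (negbTE xc).
pose G N x := (f x * ray c N (sin (r x) ^+ 2))%:E.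
have -> : (\int[m]_(x in D) (f x * (sin (r x) ^+ 2 < c)%R%:R)%:E =
    \int[m]_(x in D) (fun x => limn (G ^~ x)) x)%E.
  apply: eq_integral => x /set_mem Dx; apply/esym/cvg_lim => //.
  apply: cvg_EFin; first exact: nearW.
  by apply: cvgM; [exact: cvg_cst|apply: cvg_ray; apply: sin2_lt1; exact: rb].
apply: (@cvg_monotone_convergence _ T R m D mD G).
- move=> N; apply/measurable_EFinP; apply: measurable_funM => //.
  by apply: measurableT_comp ms; apply: continuous_measurable_fun; exact: continuous_ray.
- by move=> N x Dx; rewrite lee_fin mulr_ge0 ?f0// ray_ge0.
- by move=> x Dx M N MN; rewrite lee_fin ler_wpM2l ?f0// ray_mono.
Qed.

Let finite1 (A : set T1) : measurable A -> A `<=` D1 ->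
  (\int[m1]_(x in A) (f1 x)%:E \is a fin_num)%E.
Proof.
move=> mA AD; rewrite ge0_fin_numE; last first.
  by apply: integral_ge0 => x /AD Dx; rewrite lee_fin f1_ge0.
apply: le_lt_trans fin1; apply: ge0_subset_integral => //.
  exact/measurable_EFinP.

Qed.

Lemma integral_preimage_eq (B : set R) : measurable B ->
  (\int[m1]_(x in D1 `&` r1 @^-1` B) (f1 x)%:E =
   \int[m2]_(x in D2 `&` r2 @^-1` B) (f2 x)%:E)%E.
Proof.
have ray_eq (c : R) :
    (\int[m1]_(x in D1 `&` (fun x => (sin (r1 x) ^+ 2)%R) @^-1` `]-oo, c[) (f1 x)%:E =
     \int[m2]_(x in D2 `&` (fun x => (sin (r2 x) ^+ 2)%R) @^-1` `]-oo, c[) (f2 x)%:E)%E.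
  have h1 := @cvg_rays _ _ m1 _ mD1 _ _ mf1 f1_ge0 mr1 r1b c.
  have h2 := @cvg_rays _ _ m2 _ mD2 _ _ mf2 f2_ge0 mr2 r2b c.
  rewrite (_ : (fun N => _) = (fun N =>
    \int[m2]_(x in D2) (f2 x * ray c N (sin (r2 x) ^+ 2))%:E)%E) in h1; last first.
    by apply/funext => N; exact: rays.
  exact: cvg_unique h1 h2.
have interval T (D : set T) (r : T -> R) (rb : forall x, D x -> 0 <= r x < pi / 2) b :
    D `&` r @^-1` `]-oo, b[ = D `&` (fun x => (sin (r x) ^+ 2)%R) @^-1`
      `]-oo, (if b < 0 then 0 else if b <= pi / 2 then sin b ^+ 2 else 1)[.
  apply/seteqP; split=> x [Dx]; rewrite /= !in_itv /= => h; split=> //.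
    case: ifPn h => [b0 h|]; [|rewrite -leNgt => b0; case: ifPn => [b1|_] h].
    - by have /andP[/le_lt_trans/(_ h)] := rb _ Dx; rewrite ltNge (ltW b0).
    - by rewrite sin2_lt// ?b0//; have /andP[-> /ltW] := rb _ Dx.
    - by rewrite sin2_lt1// rb.
  case: ifPn h => [b0|]; [|rewrite -leNgt => b0; case: ifPn => [b1|]].
  - by rewrite ltNge sqr_ge0.
  - by rewrite sin2_lt// ?b0//; have /andP[-> /ltW] := rb _ Dx.
  - by rewrite -ltNge => b1 _; have /andP[_ h] := rb _ Dx; exact: lt_trans h b1.
have key b : (\int[m1]_(x in D1 `&` r1 @^-1` `]-oo, b[) (f1 x)%:E =
   \int[m2]_(x in D2 `&` r2 @^-1` `]-oo, b[) (f2 x)%:E)%E.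
  by rewrite (interval _ D1 r1 r1b) (interval _ D2 r2 r2b).
have mpre1 (A : set R) : measurable A -> measurable (D1 `&` r1 @^-1` A) by exact: mr1.
have mpre2 (A : set R) : measurable A -> measurable (D2 `&` r2 @^-1` A) by exact: mr2.
have keyT : (\int[m1]_(x in D1) (f1 x)%:E = \int[m2]_(x in D2) (f2 x)%:E)%E.
  have h T (D : set T) (r : T -> R) (rb : forall x, D x -> 0 <= r x < pi / 2) :
      D `&` r @^-1` `]-oo, pi / 2[ = D.
    apply/seteqP; split=> [x []//|x Dx]; split=> //=; rewrite in_itv /=.
    by have /andP[] := rb _ Dx.
  by have := key (pi / 2); rewrite (h _ D1 r1 r1b) (h _ D2 r2 r2b).
move=> mB; apply: (@dynkin_induction _ R (@RGenInftyO.G R) (fun B =>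
  (\int[m1]_(x in D1 `&` r1 @^-1` B) (f1 x)%:E =
   \int[m2]_(x in D2 `&` r2 @^-1` B) (f2 x)%:E)%E)).
- exact: RGenInftyO.measurableE.
- move=> _ _ [x ->] [y ->]; exists (Num.min x y).
  apply/seteqP; split=> z /=; rewrite !in_itv /= lt_min => //.
    by move=> [-> ->].
  by move=> /andP[].
- by rewrite !preimage_setT !setIT.
- by move=> _ [x ->]; exact: key.
- move=> S mS hS.
  have split d (T : measurableType d) (m : {measure set T -> \bar R}) (D : set T)
      (mD : measurable D) (f r : T -> R) (mf : measurable_fun D f)
      (f0 : forall x, D x -> 0 <= f x) (mr : measurable_fun D r) :
      (\int[m]_(x in D) (f x)%:E = \int[m]_(x in D `&` r @^-1` S) (f x)%:E +
        \int[m]_(x in D `&` r @^-1` (~` S)) (f x)%:E)%E.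
    rewrite -ge0_integral_setU//.
    + by rewrite -setIUr -preimage_setU setUv preimage_setT setIT.
    + exact: mr.
    + by apply: mr => //; exact: measurableC.
    + rewrite -setIUr -preimage_setU setUv preimage_setT setIT.
      exact/measurable_EFinP.
    + by move=> x [] [Dx _]; rewrite lee_fin f0.
    + by apply/disj_setPS => x [[_ h] [_ h']].
  move: keyT; rewrite (split _ _ m1 D1 mD1 f1 r1)// (split _ _ m2 D2 mD2 f2 r2)// -hS.
  have := finite1 (mpre1 _ mS) (@subIsetl _ _ _).
  by rewrite ![(integral m1 (D1 `&` r1 @^-1` S) _ + _)%E]addeC => fin /(congr1 (fun z =>
    z - \int[m1]_(x in D1 `&` r1 @^-1` S) (f1 x)%:E)%E); rewrite !addeK.
- move=> F mF tF hF; rewrite !preimage_bigcup !setI_bigcupr.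
  rewrite !ge0_integral_bigcup//.
  + by apply: eq_eseriesr => k _; exact: hF.
  + by move=> k; exact: mpre2.
  + apply: (measurable_funS mD2); first by move=> x [k _ []].
    exact/measurable_EFinP.
  + by move=> x [k _ [Dx _]]; rewrite lee_fin f2_ge0.
  + apply/trivIsetP => i j _ _ ij; rewrite setIACA setIid -preimage_setI.
    by move/trivIsetP : tF => /(_ i j I I ij) ->; rewrite preimage_set0 setI0.
  + by move=> k; exact: mpre1.
  + apply: (measurable_funS mD1); first by move=> x [k _ []].
    exact/measurable_EFinP.
  + by move=> x [k _ [Dx _]]; rewrite lee_fin f1_ge0.
  + apply/trivIsetP => i j _ _ ij; rewrite setIACA setIid -preimage_setI.
    by move/trivIsetP : tF => /(_ i j I I ij) ->; rewrite preimage_set0 setI0.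
- have E := RGenInftyO.measurableE R; have : (@ocitv R).-sigma.-measurable B by exact: mB.
  by rewrite E.
Qed.

End Determinacy.

Section SinCosBounds.
Context {R : realType}.
Implicit Types x : R.

Lemma cos_ge_cos1 x : 0 <= x <= 1 -> cos 1 <= cos x.
Proof.
move=> /andP[x0 x1]; have p1 : 1 <= pi :> R by rewrite (le_trans _ (@pi_ge2 R))// ler1n.
rewrite le_eqVlt; have [->|x1'] := eqVneq x 1; first by rewrite eqxx.
apply/orP; right; rewrite ltr_cos ?in_itv /= ?x0 ?ler01 ?p1//.
  by rewrite lt_neqAle x1'.
by rewrite (le_trans x1).
Qed.

Lemma sin_linear_bounds x : 0 <= x <= 1 -> x * cos 1 <= sin x <= x.
Proof.
move=> /andP[x0 x1].
have [c] := @MVT_segment R sin cos 0 x x0 (fun y _ => is_derive_sin y)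
  (continuous_subspaceT (@continuous_sin R)).
rewrite in_itv /= sin0 !subr0 => /andP[c0 cx] ->.
have c1 : cos 1 <= cos c by apply: cos_ge_cos1; rewrite c0 (le_trans cx).
apply/andP; split; first by rewrite mulrC ler_wpM2r.
by rewrite ler_piMl// cos_le1.
Qed.

End SinCosBounds.

Section AbsPower.
Context {R : realType}.

Lemma continuous_norm_powR (c : R) : 0 < c -> continuous (fun x : R => `|x| `^ c).
Proof.
move=> c0 x; have [->|x0] := eqVneq x 0.
  apply/cvgrPdist_lt => e e0; rewrite normr0 powR0 ?gt_eqF//.
  have d0 : 0 < e `^ c^-1 by rewrite powR_gt0.
  near=> y; rewrite sub0r normrN ger0_norm ?powR_ge0//.
  have hy : `|y| < e `^ c^-1.
    by near: y; apply/nbhs_ballP; exists (e `^ c^-1) => //= z; rewrite /ball /= sub0r normrN.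
  have -> : e = (e `^ c^-1) `^ c by rewrite -powRrM mulVf ?gt_eqF// powRr1// ltW.
  by rewrite gt0_ltr_powR// nnegrE ?normr_ge0 ?powR_ge0.
apply: (@continuous_comp _ _ _ _ (fun z : R => z `^ c)).
  exact: norm_continuous.
apply: differentiable_continuous; apply/derivable1_diffP.
by have [] := @is_derive1_powR R c `|x| _; rewrite ?normr_gt0.
Unshelve. all: by end_near. Qed.

Lemma continuous_norm_powR_sin (r c : R) : 0 < c ->
  {for r, continuous (fun r : R => `|sin r| `^ c)}.
Proof.
move=> c0; apply: (@continuous_comp _ _ _ _ (fun x : R => `|x| `^ c)).
  exact: continuous_sin.
exact: continuous_norm_powR.
Qed.

Lemma continuous_norm_powR_cos (r c : R) : 0 < c ->
  {for r, continuous (fun r : R => `|cos r| `^ c)}.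
Proof.
move=> c0; apply: (@continuous_comp _ _ _ _ (fun x : R => `|x| `^ c)).
  exact: continuous_cos.
exact: continuous_norm_powR.
Qed.

Lemma is_derive_norm_powR (c x : R) : 0 < x ->
  is_derive x (1 : R) (fun x : R => `|x| `^ c) (c * x `^ (c - 1)).
Proof.
move=> x0; apply: near_eq_is_derive (is_derive1_powR c x0).
by near=> y; rewrite gtr0_norm//; near: y; exact: lt_nbhsr.
Unshelve. all: by end_near. Qed.

End AbsPower.

Section Weight.
Context {R : realType}.
Variables alpha beta : R.
Hypotheses (alpha0 : 0 <= alpha) (beta0 : 0 <= beta).
Notation mu := (@lebesgue_measure R).
Notation I := (`[0, pi / 2]%classic : set R).

(* The absolute values make the weight continuous on the whole line.          *)
Definition jac_weight (r : R) : R :=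
  `|sin r| `^ (2 * alpha + 1) * `|cos r| `^ (2 * beta + 1).

Lemma jac_weight_ge0 r : 0 <= jac_weight r.
Proof. by rewrite mulr_ge0// powR_ge0. Qed.

Let ea : 0 < 2 * alpha + 1. Proof. by rewrite ltr_wpDl// mulr_ge0. Qed.
Let eb : 0 < 2 * beta + 1. Proof. by rewrite ltr_wpDl// mulr_ge0. Qed.

Lemma continuous_jac_weight : continuous jac_weight.
Proof.
move=> r; have h := continuousM (@continuous_norm_powR_sin R r _ ea) (@continuous_norm_powR_cos R r _ eb).
exact: h.
Qed.

Lemma integrable_segment (f : R -> R) (a b : R) : continuous f ->
  mu.-integrable `[a, b] (EFin \o f).
Proof.
move=> cf; apply: continuous_compact_integrable; first exact: segment_compact.
exact: continuous_subspaceT.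
Qed.

Definition jac_flux (D : {poly R}) (r : R) : R :=
  `|sin r| `^ (2 * alpha + 2) * `|cos r| `^ (2 * beta + 2) * on_sin2 D r.

Lemma continuous_jac_flux D : continuous (jac_flux D).
Proof.
have ea' : 0 < 2 * alpha + 2 by rewrite ltr_wpDl// mulr_ge0.
have eb' : 0 < 2 * beta + 2 by rewrite ltr_wpDl// mulr_ge0.
move=> r; have h := continuousM (continuousM (@continuous_norm_powR_sin R r _ ea')
  (@continuous_norm_powR_cos R r _ eb')) (@continuous_on_sin2 R D r).
exact: h.
Qed.

Lemma is_derive_jac_flux D r : 0 < r < pi / 2 ->
  is_derive r (1 : R) (jac_flux D) (jac_weight r *
   on_sin2 (((2 * (alpha + 1)) *: (1 - 'X) - (2 * (beta + 1)) *: 'X) * D +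
     2 *: ('X * (1 - 'X) * D^`())) r).
Proof.
move=> r0; have s0 := sin_gt0_pihalf r0; have c0 := cos_gt0_pihalf' r0.
have d1 := is_derive_comp_dir (f := sin) (is_derive_norm_powR (2 * alpha + 2) s0) (is_derive_sin r).
have d2 := is_derive_comp_dir (f := cos) (is_derive_norm_powR (2 * beta + 2) c0) (is_derive_cos r).
apply: is_derive_val (is_derive_prod (is_derive_prod d1 d2) (is_derive_on_sin2 D r)) _.
rewrite /jac_weight /on_sin2 /= !(gtr0_norm s0, gtr0_norm c0).
have e1 : sin r `^ (2 * alpha + 2) = sin r * sin r `^ (2 * alpha + 1).
  by rewrite -(mulr_powRB1 (ltW s0)) ?ltr_wpDl ?mulr_ge0//; congr (_ * _ `^ _); ring.
have e2 : cos r `^ (2 * beta + 2) = cos r * cos r `^ (2 * beta + 1).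
  by rewrite -(mulr_powRB1 (ltW c0)) ?ltr_wpDl ?mulr_ge0//; congr (_ * _ `^ _); ring.
have e3 : 2 * alpha + 2 - 1 = 2 * alpha + 1 by ring.
have e4 : 2 * beta + 2 - 1 = 2 * beta + 1 by ring.
rewrite e1 e2 e3 e4 !(hornerD, hornerN, hornerZ, hornerM, hornerX, hornerC).
have -> : 1 - sin r ^+ 2 = cos r ^+ 2 by rewrite -cos2sin2; ring.
move: (_ `^ _) (_ `^ _) => u v; ring.
Qed.

Lemma jac_green p g :
  \int[mu]_(r in I) (jac_weight r * on_sin2 (jacL alpha beta p * g - p * jacL alpha beta g) r) = 0.
Proof.
set Q := _ - _.
have cw : continuous (fun r => jac_weight r * on_sin2 Q r).
  by move=> r; apply: continuousM; [exact: continuous_jac_weight|exact: continuous_on_sin2].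
pose D := p^`() * g - p * g^`().
have dQ r : 0 < r < pi / 2 ->
    is_derive r (1 : R) (jac_flux D) (jac_weight r * on_sin2 Q r).
  move=> hr; apply: is_derive_val (is_derive_jac_flux D hr) _.
  rewrite /on_sin2; congr (_ * _); rewrite /Q /D.
  rewrite !(derivD, derivN, derivM, deriv_mulC).
  by rewrite !(hornerD, hornerN, hornerZ, hornerM, hornerX, hornerC, jacL_horner); ring.
have := @continuous_FTC2 R (fun r => jac_weight r * on_sin2 Q r) (jac_flux D) 0 (pi / 2)
  (pihalf_gt0) (continuous_subspaceT cw).
rewrite /Rintegral => ->.
- rewrite /jac_flux sin0 cos_pihalf normr0 !powR0 ?gt_eqF ?ltr_wpDl ?mulr_ge0//.
  by rewrite mulr0 !mul0r /= subrr.
- split.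
  + by move=> r; rewrite in_itv /= => hr; case: (dQ r hr).
  + by apply: cvg_at_right_filter; exact: continuous_jac_flux.
  + by apply: cvg_at_left_filter; exact: continuous_jac_flux.
- by move=> r; rewrite in_itv /= => hr; rewrite derive1E; case: (dQ r hr).
Qed.

Definition jac_gram (p g : {poly R}) : R :=
  \int[mu]_(r in I) (jac_weight r * on_sin2 (p * g) r).

Lemma jac_gram_integrable p :
  mu.-integrable I (EFin \o (fun r => jac_weight r * on_sin2 p r)).
Proof.
apply: integrable_segment => r.
by apply: continuousM; [exact: continuous_jac_weight|exact: continuous_on_sin2].
Qed.

Lemma jac_orthogonal m k : m != k -> jac_gram (jac alpha beta m) (jac alpha beta k) = 0.
Proof.
move=> mk; have mI : measurable I by exact: measurable_itv.
have := jac_green (jac alpha beta m) (jac alpha beta k); rewrite !jacL_jac//.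
have -> : (- jac_rate alpha beta m *: jac alpha beta m) * jac alpha beta k -
    jac alpha beta m * (- jac_rate alpha beta k *: jac alpha beta k) =
    (jac_rate alpha beta k - jac_rate alpha beta m) *: (jac alpha beta m * jac alpha beta k).
  by rewrite -scalerAl -scalerAr -scalerBl; congr (_ *: _); ring.
rewrite (_ : (\int[mu]_(r in I) _) = (jac_rate alpha beta k - jac_rate alpha beta m) *
    jac_gram (jac alpha beta m) (jac alpha beta k)); last first.
  rewrite /jac_gram -(@RintegralZl _ _ R mu)//; last exact: jac_gram_integrable.
  by apply: eq_Rintegral => r _; rewrite /on_sin2 hornerZ; ring.
move=> /eqP; rewrite mulf_eq0 => /orP[|/eqP //]; rewrite subr_eq0 => /eqP E.
have [km|mk'|E'] := ltngtP m k; last by rewrite E' eqxx in mk.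
  by have := jac_rate_lt alpha0 beta0 km; rewrite E ltxx.
by have := jac_rate_lt alpha0 beta0 mk'; rewrite E ltxx.
Qed.

Lemma jac_gram_lower : exists2 c : R, 0 < c & forall m,
  c * (jac_bound alpha beta m)^-1 `^ (2 * alpha + 2) <= jac_gram (jac alpha beta m) (jac alpha beta m).
Proof.
have k0 := @cos1_gt0 R.
pose c := 16^-1 * ((cos 1 / 4) `^ (2 * alpha + 1) * cos 1 `^ (2 * beta + 1)) : R.
exists c => [|m]; first by rewrite mulr_gt0// mulr_gt0// powR_gt0// divr_gt0.
set B := jac_bound alpha beta m.
have B1 : 1 <= B by rewrite -expR0 ler_expR !addr_ge0// mulr_ge0// !addr_ge0.
have B0 : 0 < B by rewrite (lt_le_trans ltr01).
pose rho := B^-1 / 2; have rho0 : 0 < rho by rewrite divr_gt0// invr_gt0.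
have rho1 : rho <= 2^-1 by rewrite /rho ler_pdivrMr// mulVf// invf_le1.
have mJ : measurable (`[rho / 2, rho] : set R) by exact: measurable_itv.
have mI : measurable I by exact: measurable_itv.
have JI : `[rho / 2, rho] `<=` I.
  move=> x; rewrite /= !in_itv /= => /andP[x0 x1]; apply/andP; split.
    by rewrite (le_trans _ x0)// divr_ge0// ltW.
  by rewrite (le_trans x1)// (le_trans rho1)// (le_trans _ (@pihalf_ge1 R))// invf_le1// ler1n.
pose K := (rho / 2 * cos 1) `^ (2 * alpha + 1) * cos 1 `^ (2 * beta + 1) * 4^-1.
have low (x : R) : `[rho / 2, rho]%classic x ->
    K <= jac_weight x * on_sin2 (jac alpha beta m * jac alpha beta m) x.
  rewrite /= in_itv /= => /andP[x0 x1].
  have x0' : 0 <= x by rewrite (le_trans _ x0)// divr_ge0// ltW.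
  have x1' : x <= 1 by rewrite (le_trans x1)// (le_trans rho1)// invf_le1// ler1n.
  have x01 : 0 <= x <= 1 by rewrite x0'.
  have /andP[sl su] := sin_linear_bounds x01.
  have cl := cos_ge_cos1 x01.
  have s0 : 0 <= sin x by rewrite (le_trans _ sl)// mulr_ge0// ltW.
  have c0 : 0 <= cos x by rewrite (le_trans _ cl)// ltW.
  apply: ler_pM.
  - by rewrite mulr_ge0// powR_ge0.
  - by rewrite invr_ge0.
  - rewrite /jac_weight !ger0_norm//; apply: ler_pM; rewrite ?powR_ge0//.
      apply: ge0_ler_powR; rewrite ?nnegrE//; first exact: ltW.
        by apply: mulr_ge0; [apply: divr_ge0 => //; exact: ltW|exact: ltW].
      by rewrite (le_trans _ sl)// ler_wpM2r// ltW.
    by apply: ge0_ler_powR; rewrite ?nnegrE//; exact: ltW.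
  - rewrite /on_sin2 hornerM.
    have y01 : 0 <= sin x ^+ 2 <= 1 by rewrite sqr_ge0 expr_le1// (le_trans su).
    have := jac_near1 m alpha0 beta0 y01.
    have : sin x ^+ 2 * B <= 2^-1.
      apply: (@le_trans _ _ (rho * B)); last by rewrite /rho mulrAC mulVf ?gt_eqF// mul1r.
      rewrite ler_wpM2r ?(ltW B0)// expr2 (@le_trans _ _ (sin x))// ?(le_trans su)//.
      by rewrite ler_piMl// (le_trans su).
    rewrite -/B ler_distl => h /andP[h1 _].
    have h2 : 2^-1 <= (jac alpha beta m).[sin x ^+ 2] by lra.
    have -> : 4^-1 = 2^-1 * 2^-1 :> R by field.
    by apply: ler_pM.
have i1 := jac_gram_integrable (jac alpha beta m * jac alpha beta m).
have i2 : mu.-integrable `[rho / 2, rho]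
    (EFin \o (fun r => jac_weight r * on_sin2 (jac alpha beta m * jac alpha beta m) r)).
  exact: (@integrableS _ _ R mu _ _ _ mI mJ JI i1).
have i3 : mu.-integrable `[rho / 2, rho] (EFin \o cst K).
  by apply: integrable_segment; exact: cst_continuous.
have -> : c * B^-1 `^ (2 * alpha + 2) = \int[mu]_(r in `[rho / 2, rho]) cst K r.
  rewrite Rintegral_cst//= lebesgue_measure_itv /= lte_fin ltr_pdivrMr// ltr_pMr ?ltr1n//=.
  have -> : B^-1 `^ (2 * alpha + 2) = B^-1 * B^-1 `^ (2 * alpha + 1).
    rewrite -(mulr_powRB1 (x := B^-1)) ?invr_ge0 ?(ltW B0) ?ltr_wpDl ?mulr_ge0//.
    by congr (_ * _ `^ _); ring.
  have -> : K = (B^-1 `^ (2 * alpha + 1) * (cos 1 / 4) `^ (2 * alpha + 1)) *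
      cos 1 `^ (2 * beta + 1) * 4^-1.
    rewrite /K -powRM ?invr_ge0 ?(ltW B0) ?divr_ge0 ?(ltW k0)//.
    by congr (_ `^ _ * _ * _); rewrite /rho; field; rewrite gt_eqF.
  rewrite /c /rho; move: (_ `^ _) (_ `^ _) (_ `^ _) => u v z; field.
  by rewrite gt_eqF.
apply: (@le_trans _ _ (\int[mu]_(r in `[rho / 2, rho])
   (jac_weight r * on_sin2 (jac alpha beta m * jac alpha beta m) r))).
  by apply: (@le_Rintegral _ _ R mu _ _ _ mJ i3 i2) => x; exact: low.
rewrite /jac_gram /Rintegral fine_le//.
- exact: integrable_fin_num.
- exact: integrable_fin_num.
- apply: ge0_subset_integral => //.
    by case/integrableP: i1.
  move=> x _; rewrite lee_fin mulr_ge0 ?jac_weight_ge0// /on_sin2 hornerM -expr2 sqr_ge0//.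
Qed.

End Weight.

Lemma geometric_series_limit (R : realType) (u : nat -> R -> R) (C z : R) :
  0 <= z < 1 -> (forall m r, `|u m r| <= C * z ^+ m) -> (forall m, continuous (u m)) ->
  exists H : R -> R, continuous H /\
    forall N r, `|H r - \sum_(m < N) u m r| <= C * z ^+ N / (1 - z).
Proof.
move=> /andP[z0 z1] ub cu.
have C0 : 0 <= C by have := le_trans (normr_ge0 _) (ub 0%N 0); rewrite expr0 mulr1.
have z1' : `|z| < 1 by rewrite ger0_norm.
have z1'' : 0 < 1 - z by rewrite subr_gt0.
pose S r := series (fun m => u m r).
have cvS r : cvgn (S r).
  apply: normed_cvg; apply: (@series_le_cvg _ _ (geometric C z)).
  - by move=> m; exact: normr_ge0.
  - by move=> m; rewrite geometric_ge0.
  - by move=> m; exact: ub.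
  - exact: is_cvg_geometric_series.
have near M N r : (N <= M)%N -> `|S r M - S r N| <= C * z ^+ N / (1 - z).
  move=> NM; rewrite /S sub_series NM; apply: (le_trans (ler_norm_sum _ _ _)).
  apply: (@le_trans _ _ (\sum_(N <= k < M) C * z ^+ k)); first exact: ler_sum.
  rewrite -mulr_sumr -mulrA ler_wpM2l// -(subnKC NM) geometric_partial_tail.
  have [->|z0'] := eqVneq z 0.
    rewrite subr0 invr1 mulr1 /series /=.
    case: (M - N)%N => [|k]; first by rewrite big_geq// exprn_ge0.
    by rewrite big_nat_recl// expr0 mulr1 big1 ?addr0// => i _; rewrite exprS mul0r mulr0.
  by apply: geometric_le_lim => //; [rewrite exprn_ge0|rewrite lt_neqAle eq_sym z0'].
pose H r := limn (S r).
have HS N r : `|H r - \sum_(m < N) u m r| <= C * z ^+ N / (1 - z).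
  have -> : \sum_(m < N) u m r = S r N by rewrite /S /series /= big_mkord.
  have c1 : `|S r M - S r N| @[M --> \oo] --> `|H r - S r N|.
    by apply: cvg_norm; apply: cvgB; [exact: cvS|exact: cvg_cst].
  apply: (ler_cvg_to c1 (cvg_cst _)).
  by near=> M; apply: near; near: M; exact: nbhs_infty_ge.
exists H; split=> // r.
apply/cvgrPdist_lt => e e0.
have e3 : 0 < e / 3 by rewrite divr_gt0.
have cz : C * z ^+ N / (1 - z) @[N --> \oo] --> 0.
  rewrite -[0](mul0r (1 - z)^-1); apply: cvgM; last exact: cvg_cst.
  exact: cvg_geometric.
have [N hN] : exists N, C * z ^+ N / (1 - z) < e / 3.
  have /cvgrPdist_lt /(_ _ e3) [N _ hN] := cz.
  exists N; have := hN N (leqnn N); rewrite /= sub0r normrN; apply: le_lt_trans.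
  exact: ler_norm.
have cS : {for r, continuous (fun r => \sum_(m < N) u m r)}.
  elim: N {hN} => [|N IH].
    by rewrite (_ : (fun _ => _) = cst 0); [exact: cst_continuous|apply/funext => y; rewrite big_ord0].
  rewrite (_ : (fun _ => _) = (fun y => (\sum_(m < N) u m y) + u N y)); last first.
    by apply/funext => y; rewrite big_ord_recr.
  have h := continuousD IH (cu N r); exact: h.
have /cvgrPdist_lt /(_ _ e3) := cS; apply: filterS => y hy.
have h1 := le_lt_trans (HS N r) hN; have h2 := le_lt_trans (HS N y) hN.
have -> : H r - H y = (H r - \sum_(m < N) u m r) - (H y - \sum_(m < N) u m y) +
    (\sum_(m < N) u m r - \sum_(m < N) u m y) by ring.
apply: (le_lt_trans (ler_normD _ _)).
have := ler_normB (H r - \sum_(m < N) u m r) (H y - \sum_(m < N) u m y).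
lra.
Unshelve. all: by end_near. Qed.

Section Positivity.
Context {R : realType}.
Notation mu := (@lebesgue_measure R).
Notation I := (`[0, pi / 2]%classic : set R).

Lemma Rintegral_gt0_point (G : R -> R) (r : R) : mu.-integrable I (EFin \o G) ->
  (forall x, I x -> 0 <= G x) -> 0 < r < pi / 2 -> {for r, continuous G} -> 0 < G r ->
  0 < \int[mu]_(x in I) G x.
Proof.
move=> iG G0 /andP[r0 r1] cG Gr.
have mI : measurable I by exact: measurable_itv.
have G2 : 0 < G r / 2 by rewrite divr_gt0.
have /cvgrPdist_lt /(_ _ G2) /nbhs_ballP [e /= e0 he] := cG.
pose d := Num.min (e / 2) (Num.min (r / 2) ((pi / 2 - r) / 2)).
have d0 : 0 < d by rewrite !lt_min !divr_gt0// subr_gt0.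
have [de dr dp] : [/\ d <= e / 2, d <= r / 2 & d <= (pi / 2 - r) / 2].
  by split; rewrite /d !ge_min lexx ?orbT.
have mJ : measurable (`[r - d, r + d] : set R) by exact: measurable_itv.
have JI : `[r - d, r + d] `<=` I.
  by move=> x; rewrite /= !in_itv /= => /andP[x0 x1]; apply/andP; split; lra.
have low (x : R) : `[r - d, r + d]%classic x -> G r / 2 <= G x.
  rewrite /= in_itv /= => /andP[x0 x1].
  have : ball r e x by rewrite /ball /= ltr_distl; apply/andP; split; lra.
  by move=> /he /=; rewrite ltr_distl => /andP[h1 h2]; lra.
have i2 := @integrableS _ _ R mu _ _ _ mI mJ JI iG.
have i3 : mu.-integrable `[r - d, r + d] (EFin \o cst (G r / 2)).
  by apply: integrable_segment; exact: cst_continuous.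
apply: (@lt_le_trans _ _ (\int[mu]_(x in `[r - d, r + d]) cst (G r / 2) x)).
  rewrite Rintegral_cst//= lebesgue_measure_itv /= lte_fin.
  rewrite ifT /=; first by rewrite mulr_gt0//; lra.
  lra.
apply: (@le_trans _ _ (\int[mu]_(x in `[r - d, r + d]) G x)).
  by apply: (@le_Rintegral _ _ R mu _ _ _ mJ i3 i2) => x; exact: low.
rewrite /Rintegral fine_le//.
- exact: integrable_fin_num.
- exact: integrable_fin_num.
- by apply: ge0_subset_integral => //; case/integrableP: iG.

Qed.

Lemma test_sin2_le0 (v : R -> R) : mu.-integrable I (EFin \o v) ->
  {in `]0, pi / 2[, continuous v} ->
  (forall g : R -> R, continuous g -> \int[mu]_(x in I) (v x * g (sin x ^+ 2)) = 0) ->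
  forall r, 0 < r < pi / 2 -> v r <= 0.
Proof.
move=> iv cv h r /andP[r0 r1]; rewrite leNgt; apply/negP => vr.
have mI : measurable I by exact: measurable_itv.
have rI : r \in `]0, pi / 2[ by rewrite in_itv /= r0.
have /cvgrPdist_lt /(_ _ vr) /nbhs_ballP [e /= e0 he] := cv r rI.
pose d := Num.min (e / 2) (Num.min (r / 2) ((pi / 2 - r) / 2)).
have d0 : 0 < d by rewrite !lt_min !divr_gt0// subr_gt0.
have [de dr dp] : [/\ d <= e / 2, d <= r / 2 & d <= (pi / 2 - r) / 2].
  by split; rewrite /d !ge_min lexx ?orbT.
pose g (y : R) := Num.max 0 (Num.min (y - sin (r - d) ^+ 2) (sin (r + d) ^+ 2 - y)).
have cg : continuous g.
  move=> y.
  have h1 : {for y, continuous (fun y : R => y - sin (r - d) ^+ 2)}.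
    by apply: continuousB; [exact: id|exact: cst_continuous].
  have h2 : {for y, continuous (fun y : R => sin (r + d) ^+ 2 - y)}.
    by apply: continuousB; [exact: cst_continuous|exact: id].
  have h3 := @continuous_min _ _ _ _ y h1 h2.
  by apply: (@continuous_max _ _ (fun=> 0) _ y _ h3); exact: cst_continuous.
have g0 y : 0 <= g y by rewrite le_max lexx.
have gout x : I x -> ~~ (r - d < x < r + d) -> g (sin x ^+ 2) = 0.
  rewrite /= in_itv /= => /andP[x0 x1]; rewrite negb_and -!leNgt => hx.
  apply/max_idPl; rewrite ge_min !subr_le0.
  case/orP: hx => hx; apply/orP; [left|right].
    by rewrite leNgt sin2_lt -?leNgt//; apply/andP; split; lra.
  by rewrite leNgt sin2_lt -?leNgt//; apply/andP; split; lra.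
have vin x : r - d < x < r + d -> 0 < v x.
  move=> /andP[x0 x1]; have : ball r e x by rewrite /ball /= ltr_distl; apply/andP; split; lra.
  by move=> /he /=; rewrite ltr_distl => /andP[h1 h2]; lra.
have gr : 0 < g (sin r ^+ 2).
  rewrite /g lt_max; apply/orP; right; rewrite lt_min !subr_gt0.
  by apply/andP; split; (rewrite sin2_lt; [|apply/andP; split|apply/andP; split]); lra.
have cgs : continuous (fun x : R => g (sin x ^+ 2)).
  move=> x; have hc := @continuous_comp _ _ _ (fun x : R => sin x ^+ 2) g x (@continuous_sin2 R x) (cg _).
  exact: hc.
have [C C0 hC] := within_bounded (continuous_subspaceT cgs).
have := @Rintegral_gt0_point (fun x => v x * g (sin x ^+ 2)) r.
rewrite h// ltxx => F; suff : false by []; apply: F.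
- apply: (@integrable_mul_bounded _ _ _ _ _ _ _ C) => //.
  by apply: measurable_funTS; exact: continuous_measurable_fun.
- move=> x xI; have [/vin/ltW vx|/gout->//] := boolP (r - d < x < r + d); last by rewrite mulr0.
  by rewrite mulr_ge0.
- by rewrite r0.
- have hc := continuousM (cv r rI) (cgs r); exact: hc.
- by rewrite mulr_gt0.
Qed.

End Positivity.

Section HeatKernel.
Context {R : realType}.
Notation mu := (@lebesgue_measure R).
Notation I := (`[0, pi / 2]%classic : set R).
Variables (alpha beta : R) (q : R -> R -> R -> R) (t : R).
Hypothesis J : jacobi_density alpha beta q.
Hypotheses (alpha0 : 0 <= alpha) (beta0 : 0 <= beta) (t0 : 0 < t).

Let mI : measurable I. Proof. exact: measurable_itv. Qed.
Let zI : (0 : R) \in `[0, pi / 2]%R.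
Proof. by rewrite in_itv /= lexx ltW// pihalf_gt0. Qed.
Let p (m : nat) := jac alpha beta m.
Let a (m : nat) := jac_rate alpha beta m.
Let h (m : nat) := jac_gram alpha beta (p m) (p m).
Let w := jac_weight alpha beta.
Let z : R := expR (- 1).

Let z01 : 0 <= z < 1. Proof. by rewrite expR_ge0 -expR0 ltr_expR oppr_lt0 /=. Qed.

Let h_gt0 m : 0 < h m.
Proof.
have [c c0 hc] := jac_gram_lower alpha0 beta0.
by rewrite (lt_le_trans _ (hc m))// mulr_gt0// powR_gt0// invr_gt0 expR_gt0.
Qed.

Definition jac_heat_term (m : nat) (r : R) : R :=
  expR (- (a m * t)) / h m * on_sin2 (p m) r.

Let term_bound : exists C, forall m r, `|jac_heat_term m r| <= C * z ^+ m.
Proof.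
have [c c0 hc] := jac_gram_lower alpha0 beta0.
pose s := alpha + beta + 1; have s0 : 0 <= s by rewrite !addr_ge0.
pose K := 2 * alpha + 3; pose L := 5 * K + 1.
pose E := L ^+ 2 / (8 * t) + 2 * s * K.
exists (c^-1 * expR E) => m r.
have sin01 : 0 <= sin r ^+ 2 <= 1.
  by rewrite sqr_ge0 -(cos2Dsin2 r) lerDr sqr_ge0.
rewrite /jac_heat_term normrM normrM normfV (ger0_norm (expR_ge0 _)) (gtr0_norm (h_gt0 m)).
have B0 : 0 < jac_bound alpha beta m by exact: expR_gt0.
have hb : (h m)^-1 <= c^-1 * expR ((5 * m%:R + 2 * s) * (2 * alpha + 2)).
  have -> : expR ((5 * m%:R + 2 * s) * (2 * alpha + 2)) =
      jac_bound alpha beta m `^ (2 * alpha + 2).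
    by rewrite /jac_bound -/s /powR gt_eqF ?expR_gt0// expRK mulrC.
  rewrite -[leRHS]invrK invfM invrK lef_pV2 ?posrE ?h_gt0 ?mulr_gt0 ?invr_gt0 ?powR_gt0//.
  apply: le_trans (hc m); rewrite ler_wpM2l ?(ltW c0)//.
  by rewrite -[in leRHS](powR_inv1 (ltW B0)) -powRrM mulN1r powRN.
have jb := jac_le m alpha0 beta0 sin01.
have m0 : 0 <= m%:R :> R by [].
apply: (@le_trans _ _ (expR (- (a m * t)) * (c^-1 * expR ((5 * m%:R + 2 * s) * (2 * alpha + 2))) *
    jac_bound alpha beta m)).
  rewrite ler_pM ?mulr_ge0 ?expR_ge0 ?invr_ge0 ?(ltW (h_gt0 m))//.
  by rewrite ler_wpM2l ?expR_ge0.
rewrite /jac_bound -/s /z -expRM_natl mulrCA -!mulrA ler_wpM2l ?invr_ge0 ?(ltW c0)//.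
rewrite -!expRD ler_expR.
have a2 : 2 * m%:R ^+ 2 * t <= a m * t.
  rewrite ler_wpM2r ?(ltW t0)// /a /jac_rate expr2 !mulrA ler_wpM2l ?mulr_ge0//.
  by rewrite -!addrA lerDl !addr_ge0.
have sq : 0 <= 2 * t * (m%:R - L / (4 * t)) ^+ 2 by rewrite mulr_ge0 ?sqr_ge0// mulr_ge0// ltW.
have sqE : 2 * t * (m%:R - L / (4 * t)) ^+ 2 = 2 * m%:R ^+ 2 * t - L * m%:R + L ^+ 2 / (8 * t).
  by field; rewrite gt_eqF.
rewrite sqE /L /K in sq; rewrite /E /L /K; move: (_ / (8 * t)) sq => Q sq.
by move: a2; rewrite /a /jac_rate; lra.
Qed.

Let cont_term m : continuous (jac_heat_term m).
Proof.
move=> r; have hc := continuousM (@cst_continuous R R (expR (- (a m * t)) / h m) r)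
  (@continuous_on_sin2 R (p m) r).
exact: hc.
Qed.

Let moment (H : R -> R) : continuous H ->
  (exists C, forall N r, `|H r - \sum_(m < N) jac_heat_term m r| <= C * z ^+ N / (1 - z)) ->
  forall k, \int[mu]_(r in I) (H r * w r * on_sin2 (p k) r) = expR (- (a k * t)).
Proof.
move=> cH [C HC] k.
have cw : continuous w by exact: continuous_jac_weight.
have cont (u : R -> R) : continuous u -> continuous (fun r => u r * w r * on_sin2 (p k) r).
  move=> cu r; have hc := continuousM (continuousM (cu r) (cw r)) (@continuous_on_sin2 R (p k) r).
  exact: hc.
have csum N : continuous (fun r => \sum_(m < N) jac_heat_term m r).
  move=> r; elim: N => [|N IH].
    by rewrite (_ : (fun _ => _) = cst 0); [exact: cst_continuous|apply/funext => y; rewrite big_ord0].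
  rewrite (_ : (fun _ => _) = (fun y => (\sum_(m < N) jac_heat_term m y) + jac_heat_term N y)); last first.
    by apply/funext => y; rewrite big_ord_recr.
  have hc := continuousD IH (@cont_term N r); exact: hc.
have int N : \int[mu]_(r in I) ((\sum_(m < N) jac_heat_term m r) * w r * on_sin2 (p k) r) =
    \sum_(m < N) expR (- (a m * t)) / h m * jac_gram alpha beta (p m) (p k).
  elim: N => [|N IH].
    rewrite big_ord0 (_ : (\int[mu]_(r in I) _) = \int[mu]_(r in I) cst 0 r); last first.
      by apply: eq_Rintegral => r _; rewrite big_ord0 !mul0r.
    by rewrite Rintegral_cst//= mul0r.
  rewrite big_ord_recr /= -IH /jac_gram -(@RintegralZl _ _ R mu)//; last exact: jac_gram_integrable.
  have i1 := @integrable_segment R _ 0 (pi / 2) (cont _ (csum N)).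
  have i2 := @integrable_segment R _ 0 (pi / 2) (cont _ (@cont_term N)).
  have i3 : mu.-integrable I (EFin \o (fun x => expR (- (a N * t)) / h N *
      (jac_weight alpha beta x * on_sin2 (p N * p k) x))).
    apply: eq_integrable i2 => // y _; rewrite /= /jac_heat_term /on_sin2 hornerM /w.
    by congr EFin; ring.
  rewrite -(@RintegralD _ _ R mu)//.
  apply: eq_Rintegral => r _; rewrite big_ord_recr /= /jac_heat_term /on_sin2 hornerM /w; ring.
have intk N : (k < N)%N ->
    \int[mu]_(r in I) ((\sum_(m < N) jac_heat_term m r) * w r * on_sin2 (p k) r) =
    expR (- (a k * t)).
  move=> kN; rewrite int (bigD1 (Ordinal kN))//= big1 ?addr0.
    by rewrite -/(h k) mulfVK// gt_eqF.
  move=> i ik; rewrite jac_orthogonal ?mulr0//.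
pose M := \int[mu]_(r in I) `|w r * on_sin2 (p k) r|.
have iM := @jac_gram_integrable R alpha beta alpha0 beta0 (p k).
have close N : (k < N)%N ->
    `|\int[mu]_(r in I) (H r * w r * on_sin2 (p k) r) - expR (- (a k * t))| <=
    C * z ^+ N / (1 - z) * M.
  move=> kN; rewrite -(intk N kN).
  have i1 := @integrable_segment R _ 0 (pi / 2) (cont _ (csum N)).
  have i2 := @integrable_segment R _ 0 (pi / 2) (cont _ cH).
  rewrite -(@RintegralB _ _ R mu)//.
  have i3 : mu.-integrable I (EFin \o (fun r => H r * w r * on_sin2 (p k) r -
      (\sum_(m < N) jac_heat_term m r) * w r * on_sin2 (p k) r)).
    have h0 := @integrableB _ _ R mu _ mI _ _ i2 i1.
    by apply: eq_integrable h0 => // y _; rewrite /= EFinB.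
  have h0 := @le_normr_Rintegral _ _ R mu _ _ mI i3; apply: (le_trans h0).
  rewrite /M -(@RintegralZl _ _ R mu)//; last exact: (@integrable_norm _ _ R mu _ _ iM).
  have i4 : mu.-integrable I (EFin \o (fun r => C * z ^+ N / (1 - z) * `|w r * on_sin2 (p k) r|)).
    have h1 := @integrableZl _ _ R mu _ mI (C * z ^+ N / (1 - z)) _ (@integrable_norm _ _ R mu _ _ iM).
    by apply: eq_integrable h1 => // y _.
  apply: (@le_Rintegral _ _ R mu _ _ _ mI (@integrable_norm _ _ R mu _ _ i3) i4) => r _ /=.
  have -> : H r * w r * on_sin2 (p k) r - (\sum_(m < N) jac_heat_term m r) * w r * on_sin2 (p k) r =
      (H r - \sum_(m < N) jac_heat_term m r) * (w r * on_sin2 (p k) r) by ring.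
  by rewrite normrM ler_wpM2r.
have cz : C * z ^+ N / (1 - z) * M @[N --> \oo] --> 0.
  rewrite -[0](mul0r M); apply: cvgM; last exact: cvg_cst.
  rewrite -[0](mul0r (1 - z)^-1); apply: cvgM; last exact: cvg_cst.
  by apply: cvg_geometric; case/andP: z01 => z0 z1; rewrite ger0_norm.
apply/eqP; rewrite -subr_eq0 -normr_le0.
apply: (ler_cvg_to (cvg_cst _) cz).
by near=> N; apply: close; near: N; exact: nbhs_infty_gt.
Unshelve. all: by end_near. Qed.

Lemma heat_kernel : exists H : R -> R, [/\ continuous H, 0 < H 0 &
  forall r, 0 < r < pi / 2 -> q t 0 r = H r * jac_weight alpha beta r].
Proof.
have [C ub] := term_bound.
have [H [cH HC]] := geometric_series_limit z01 ub cont_term.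
have cw : continuous w by exact: continuous_jac_weight.
have cHw : continuous (fun r => H r * w r).
  by move=> r; have hc := continuousM (cH r) (cw r); exact: hc.
exists H; split=> //.
- have c0 : 0 < 1 / h 0 by rewrite divr_gt0.
  have lo N : (0 < N)%N -> 1 / h 0 <= \sum_(m < N) jac_heat_term m 0.
    case: N => // N _; rewrite big_ord_recl {1}/jac_heat_term /on_sin2 sin0 expr0n /=.
    rewrite horner_jac0 mulr1 /a /jac_rate mulr0 !mul0r oppr0 expR0 lerDl.
    apply: sumr_ge0 => i _; rewrite /jac_heat_term /on_sin2 sin0 expr0n /= horner_jac0 mulr1.
    by rewrite divr_ge0 ?expR_ge0// ltW.
  apply: (lt_le_trans c0).
  have cz : 1 / h 0 - C * z ^+ N / (1 - z) @[N --> \oo] --> 1 / h 0.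
    rewrite -[X in _ --> X]subr0; apply: cvgB; first exact: cvg_cst.
    rewrite -[0](mul0r (1 - z)^-1); apply: cvgM; last exact: cvg_cst.
    by apply: cvg_geometric; case/andP: z01 => z0 z1; rewrite ger0_norm.
  apply: (ler_cvg_to cz (cvg_cst _)).
  near=> N; have /lo h1 : (0 < N)%N by near: N; exact: nbhs_infty_gt.
  by have := HC N 0; rewrite ler_distl => /andP[h2 _]; lra.
have mom := moment cH (ex_intro _ C HC).
have iHw := @integrable_segment R _ 0 (pi / 2) cHw.
have iq := density_integrable J t0 zI.
have sin01 (r : R) : I r -> 0 <= sin r ^+ 2 <= 1.
  by move=> _; rewrite sqr_ge0 -(cos2Dsin2 r) lerDr sqr_ge0.
have ms : measurable_fun I (fun r : R => sin r ^+ 2).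
  by apply: measurable_funTS; apply: continuous_measurable_fun; exact: continuous_sin2.
have mp (P : {poly R}) : measurable_fun I (on_sin2 P).
  by apply: measurable_funTS; apply: continuous_measurable_fun; exact: continuous_on_sin2.
have bp (P : {poly R}) : exists2 B, 0 <= B & forall y, I y -> `|on_sin2 P y| <= B.
  exact: within_bounded (continuous_subspaceT (@continuous_on_sin2 R P)).
have polys (P : {poly R}) : \int[mu]_(r in I) (H r * w r * P.[sin r ^+ 2]) =
    \int[mu]_(r in I) (q t 0 r * P.[sin r ^+ 2]).
  apply: (@jac_span R alpha beta alpha0 beta0
    (fun P => \int[mu]_(r in I) (H r * w r * P.[sin r ^+ 2]))
    (fun P => \int[mu]_(r in I) (q t 0 r * P.[sin r ^+ 2]))).
  - move=> c P1 P2.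
    have cont (Q : {poly R}) : mu.-integrable I (EFin \o (fun r => H r * w r * Q.[sin r ^+ 2])).
      have [B B0 hB] := bp Q.
      have h1 := @integrable_mul_bounded R _ _ mu I _ _ B mI iHw (mp Q) hB; exact: h1.
    have i1 : mu.-integrable I (EFin \o (fun r => c * (H r * w r * P1.[sin r ^+ 2]))).
      have h1 := @integrableZl _ _ R mu _ mI c _ (cont P1).
      by apply: eq_integrable h1 => // y _.
    rewrite -(@RintegralZl _ _ R mu)//.
    rewrite -(@RintegralD _ _ R mu)//.
    by apply: eq_Rintegral => r _; rewrite hornerD hornerZ; ring.
  - move=> c P1 P2; have [B1 _ h1] := bp P1; have [B2 _ h2] := bp P2.
    have := @kernel_op_linear R alpha beta q J t 0 _ _ _ _ c t0 zI (mp P1) h1 (mp P2) h2.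
    rewrite /kernel_op /on_sin2 => <-.
    by apply: eq_Rintegral => r _; rewrite hornerD hornerZ.
  - by move=> k; rewrite mom -(kernel_op_jac J alpha0 beta0 k t0).
have tests := fun g => @poly_test_ext R _ _ _ _ mu mu I I mI mI _ _ _ _ iHw iq ms ms sin01 sin01 g polys.
have bg (g : R -> R) : continuous g -> exists2 B, 0 <= B & forall y, I y -> `|g (sin y ^+ 2)| <= B.
  move=> cg; apply: within_bounded; apply: continuous_subspaceT => x.
  have hc := @continuous_comp _ _ _ (fun x : R => sin x ^+ 2) g x (@continuous_sin2 R x) (cg _).
  exact: hc.
have mg (g : R -> R) : continuous g -> measurable_fun I (fun r => g (sin r ^+ 2)).
  by move=> cg; apply: measurableT_comp => //; exact: continuous_measurable_fun.
have le (u v : R -> R) (iu : mu.-integrable I (EFin \o u)) (iv : mu.-integrable I (EFin \o v)) :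
    {in `]0, pi / 2[, continuous u} -> {in `]0, pi / 2[, continuous v} ->
    (forall g : R -> R, continuous g -> \int[mu]_(r in I) (u r * g (sin r ^+ 2)) =
      \int[mu]_(r in I) (v r * g (sin r ^+ 2))) ->
    forall r, 0 < r < pi / 2 -> u r <= v r.
  move=> cu cv huv r hr; rewrite -subr_le0.
  apply: (@test_sin2_le0 R (fun r => u r - v r)) => //.
  - have h0 := @integrableB _ _ R mu _ mI _ _ iu iv.
    by apply: eq_integrable h0 => // y _; rewrite /= EFinB.
  - by move=> x xI; have hc := continuousB (cu x xI) (cv x xI); exact: hc.
  - move=> g cg; have [B _ hB] := bg g cg.
    have i1 := @integrable_mul_bounded R _ _ mu I _ _ B mI iu (mg g cg) hB.
    have i2 := @integrable_mul_bounded R _ _ mu I _ _ B mI iv (mg g cg) hB.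
    rewrite (_ : (\int[mu]_(x in I) _) = \int[mu]_(x in I) (u x * g (sin x ^+ 2) - v x * g (sin x ^+ 2))).
      by rewrite (@RintegralB _ _ R mu)// huv// subrr.
    by apply: eq_Rintegral => x _; rewrite mulrBl.
have cq := jd_continuous J t0 zI.
move=> r hr; apply/eqP; rewrite eq_le; apply/andP; split.
  by apply: (le _ _ iq iHw _ _ _ r hr) => [x /cq//|x _|g cg]; [exact: cHw|rewrite tests].
by apply: (le _ _ iHw iq _ _ _ r hr) => [x _|x /cq//|g cg]; [exact: cHw|rewrite tests].
Unshelve. all: by end_near. Qed.

End HeatKernel.

Section ChangeOfVariable.
Import HBNNSimple.
Context {R : realType} {d1 d2 : measure_display}.
Context {T1 : measurableType d1} {T2 : measurableType d2}.
Variables (m1 : {measure set T1 -> \bar R}) (m2 : {measure set T2 -> \bar R}).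
Variables (D1 : set T1) (D2 : set T2) (mD1 : measurable D1) (mD2 : measurable D2).
Variables (f1 r1 : T1 -> R) (f2 r2 : T2 -> R).
Hypotheses (mf1 : measurable_fun D1 f1) (mf2 : measurable_fun D2 f2).
Hypotheses (f1_ge0 : forall x, D1 x -> 0 <= f1 x) (f2_ge0 : forall x, D2 x -> 0 <= f2 x).
Hypotheses (mr1 : measurable_fun D1 r1) (mr2 : measurable_fun D2 r2).
Hypothesis sets : forall B : set R, measurable B ->
  (\int[m1]_(x in D1 `&` r1 @^-1` B) (f1 x)%:E =
   \int[m2]_(x in D2 `&` r2 @^-1` B) (f2 x)%:E)%E.

Let simple d (T : measurableType d) (m : {measure set T -> \bar R}) (D : set T)
    (mD : measurable D) (f r : T -> R) (mf : measurable_fun D f)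
    (f0 : forall x, D x -> 0 <= f x) (mr : measurable_fun D r) (h : {nnsfun R >-> R}) :
  (\int[m]_(x in D) (f x * h (r x))%:E =
   \sum_(y \in range h) (y%:E * \int[m]_(x in D `&` r @^-1` (h @^-1` [set y])) (f x)%:E))%E.
Proof.
have mi (y : R) : measurable_fun D (fun x => \1_(h @^-1` [set y]) (r x) : R).
  by apply: measurableT_comp => //; exact: measurable_indic.
transitivity (\int[m]_(x in D) (\sum_(y \in range h)
    (f x * (y * \1_(h @^-1` [set y]) (r x)))%:E))%E.
  by apply: eq_integral => x _; rewrite {1}fimfunE mulr_fsumr// fsumEFin.
rewrite ge0_integral_fsum//; last 2 first.
- move=> y; apply/measurable_EFinP; apply: measurable_funM => //.
  exact: measurable_funM.
- by move=> y x Dx; rewrite lee_fin mulr_ge0 ?f0//; have := nnfun_muleindic_ge0 h y (r x); rewrite lee_fin.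
apply: eq_fsbigr => y /set_mem [z _ hz].
have y0 : 0 <= y by rewrite -hz.
have pE x : (((EFin \o f) \_ (r @^-1` (h @^-1` [set y]))) x =
    (f x * \1_(h @^-1` [set y]) (r x))%:E)%E.
  rewrite indicE patchE.
  have [rx|rx] := boolP (r x \in h @^-1` [set y]).
    by rewrite ifT ?mulr1// mem_set//; exact: set_mem rx.
  rewrite ifF ?mulr0//; apply/negbTE; apply: contra rx => /set_mem rx.
  exact: mem_set.
rewrite integral_mkcondr.
under [in RHS]eq_integral => x _ do rewrite pE.
rewrite -ge0_integralZl//.
- by apply: eq_integral => x _; rewrite -EFinM; congr EFin; ring.
- by apply/measurable_EFinP; apply: measurable_funM.
- by move=> x Dx; rewrite lee_fin mulr_ge0 ?f0// indicE.
Qed.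

Let cvg_simple d (T : measurableType d) (m : {measure set T -> \bar R}) (D : set T)
    (mD : measurable D) (f r : T -> R) (mf : measurable_fun D f)
    (f0 : forall x, D x -> 0 <= f x) (mr : measurable_fun D r)
    (g : R -> R) (mg : measurable_fun setT (EFin \o g)) (g0 : forall x, 0 <= g x) :
  (\int[m]_(x in D) (f x * nnsfun_approx measurableT mg N (r x))%:E @[N --> \oo] -->
   \int[m]_(x in D) (f x * g (r x))%:E)%E.
Proof.
pose G N x := (f x * nnsfun_approx measurableT mg N (r x))%:E.
have -> : (\int[m]_(x in D) (f x * g (r x))%:E =
    \int[m]_(x in D) (fun x => limn (G ^~ x)) x)%E.
  apply: eq_integral => x /set_mem Dx; apply/esym/cvg_lim => //.
  have h1 : (EFin \o (fun N => nnsfun_approx measurableT mg N (r x))) @ \oo --> (g (r x))%:E.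
    by apply: (@cvg_nnsfun_approx _ _ R setT measurableT (EFin \o g) mg) => // z _; rewrite lee_fin.
  by rewrite /G; under eq_fun do rewrite EFinM; rewrite EFinM; apply: cvgeZl.
apply: (@cvg_monotone_convergence _ T R m D mD G).
- move=> N; apply/measurable_EFinP; apply: measurable_funM => //.
  exact: measurableT_comp.
- by move=> N x Dx; rewrite lee_fin mulr_ge0 ?f0.
- move=> x Dx M N MN; rewrite lee_fin ler_wpM2l ?f0//.
  exact/lefP/nd_nnsfun_approx.
Qed.

Lemma integral_weight_comp (g : R -> R) : measurable_fun setT g -> (forall x, 0 <= g x) ->
  (\int[m1]_(x in D1) (f1 x * g (r1 x))%:E = \int[m2]_(x in D2) (f2 x * g (r2 x))%:E)%E.
Proof.
move=> mg g0; have mg' : measurable_fun setT (EFin \o g) by exact/measurable_EFinP.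
have h1 := @cvg_simple _ _ m1 _ mD1 _ _ mf1 f1_ge0 mr1 g mg' g0.
have h2 := @cvg_simple _ _ m2 _ mD2 _ _ mf2 f2_ge0 mr2 g mg' g0.
rewrite (_ : (fun N => _) = (fun N => \int[m2]_(x in D2)
    (f2 x * nnsfun_approx measurableT mg' N (r2 x))%:E)%E) in h1; last first.
  apply/funext => N; rewrite (@simple _ _ m1 _ mD1 _ _ mf1 f1_ge0 mr1).
  rewrite (@simple _ _ m2 _ mD2 _ _ mf2 f2_ge0 mr2); apply: eq_fsbigr => y _.
  by rewrite sets.
exact: cvg_unique h1 h2.
Qed.

End ChangeOfVariable.

Section TwistedEigenfunctions.
Context {R : realType}.
Implicit Types Q : {poly R}.

Lemma smooth_on_horner (D : set R) m Q : smooth_on D m (fun x => Q.[x]).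
Proof.
elim/poly_ind: Q => [|Q c IH].
  rewrite (_ : (fun _ => _) = (fun=> 0)); first exact: smooth_on_cst.
  by apply/funext => x; rewrite horner0.
rewrite (_ : (fun _ => _) = (fun x => Q.[x] * (1 * x + 0) + c)).
  by apply: smooth_onD; [apply: smooth_onM => //; exact: smooth_on_affine|exact: smooth_on_cst].
by apply/funext => x; rewrite hornerD hornerM hornerX hornerC mul1r addr0.
Qed.

Definition twisted (b : R) Q (z : R) : R := z `^ b * Q.[z].

Lemma is_derive_twisted (b z : R) Q : 0 < z ->
  is_derive z (1 : R) (twisted b Q) (b * twisted (b - 1) Q z + twisted b Q^`() z).
Proof.
move=> z0; apply: is_derive_val (is_derive_prod (is_derive1_powR b z0) (is_derive_poly Q z)) _.
by rewrite /twisted; ring.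
Qed.

Lemma is_derive_twisted2 (b z : R) Q : 0 < z ->
  is_derive z (1 : R) (fun z => b * twisted (b - 1) Q z + twisted b Q^`() z)
    (b * ((b - 1) * twisted (b - 1 - 1) Q z + twisted (b - 1) Q^`() z) +
     (b * twisted (b - 1) Q^`() z + twisted b Q^`()^`() z)).
Proof.
move=> z0; apply: is_derive_val (is_deriveD
  (is_deriveZ b (is_derive_twisted (b - 1) Q z0)) (is_derive_twisted b Q^`() z0)) _.
by [].
Qed.

Lemma measurable_twisted b Q : measurable_fun setT (twisted b Q).
Proof.
apply: measurable_funM; first exact: measurable_powR.
by apply: continuous_measurable_fun; exact: continuous_horner.
Qed.

Lemma smooth_on_twisted b Q m : smooth_on [set z : R | 0 < z] m (twisted b Q).
Proof. by apply: smooth_onM; [exact: smooth_on_powR|exact: smooth_on_horner]. Qed.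

(* [2 b (2 b + 2)] is the eigenvalue of the fibre part: the two terms in      *)
(* [(1 - z) / z] cancel.                                                      *)
Lemma twisted_ode (n : nat) (b L kap z : R) (p : {poly R}) : 0 < z ->
  L = 2 * b * (2 * b + 2) ->
  jacL (2 * n%:R - 1) (2 * b + 1) p = - kap *: p ->
  let Q := p \Po (1 - 'X) in
  2 * z * (1 - z) * (b * ((b - 1) * twisted (b - 1 - 1) Q z + twisted (b - 1) Q^`() z) +
     (b * twisted (b - 1) Q^`() z + twisted b Q^`()^`() z)) +
  (4 * (1 - z) - 4 * n%:R * z) * (b * twisted (b - 1) Q z + twisted b Q^`() z)
  - 2^-1 * L * ((1 - z) / z) * twisted b Q z = - (kap + 4 * n%:R * b) * twisted b Q z.
Proof.
move=> z0 LE /(congr1 (fun r : {poly R} => r.[1 - z])); rewrite jacL_horner hornerZ => ode Q.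
have zn : z != 0 by rewrite gt_eqF.
have dq (r : {poly R}) : (r \Po (1 - 'X))^`() = - (r^`() \Po (1 - 'X)).
  by rewrite deriv_comp derivB derivX derivC sub0r mulrN mulr1.
have hq (r : {poly R}) : (r \Po (1 - 'X)).[z] = r.[1 - z].
  by rewrite horner_comp hornerD hornerN hornerX hornerC.
have Q1 : Q^`().[z] = - p^`().[1 - z] by rewrite /Q dq hornerN hq.
have Q2 : Q^`()^`().[z] = p^`()^`().[1 - z] by rewrite /Q dq derivN dq opprK hq.
rewrite /twisted Q1 Q2 {Q1 Q2} /Q hq.
have step c : z `^ c = z `^ (c - 1) * z.
  have := @powRD R z (c - 1) 1; rewrite zn implybT powRr1 ?(ltW z0)// subrK; exact.
have e1 := step (b - 1).
have e0 : z `^ b = z `^ (b - 1 - 1) * z ^+ 2 by rewrite (step b) e1; ring.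
rewrite e0 e1 LE.
move: (z `^ _) (p.[_]) (p^`().[_]) (p^`()^`().[_]) ode => u P0 P1 P2 ode.
have {}ode : 2 * (1 - z) * z * P2 = - kap * P0 - (2 * (2 * n%:R) * z - 2 * (2 * b + 2) * (1 - z)) * P1.
  by rewrite -ode; ring.
have -> : 2 * z * (1 - z) * (b * ((b - 1) * (u * P0) + u * z * - P1) +
    (b * (u * z * - P1) + u * z ^+ 2 * P2)) +
  (4 * (1 - z) - 4 * n%:R * z) * (b * (u * z * P0) + u * z ^+ 2 * - P1) -
  2^-1 * (2 * b * (2 * b + 2)) * ((1 - z) / z) * (u * z ^+ 2 * P0) =
  u * z ^+ 2 * (2 * (1 - z) * z * P2) +
  2 * z * (1 - z) * (b * ((b - 1) * (u * P0) + u * z * - P1) +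
    b * (u * z * - P1)) +
  (4 * (1 - z) - 4 * n%:R * z) * (b * (u * z * P0) + u * z ^+ 2 * - P1) -
  b * (2 * b + 2) * (1 - z) * u * z * P0 by field.
rewrite ode; ring.
Qed.

End TwistedEigenfunctions.

Section RadialCoordinate.
Context {R : realType} {n : nat}.
Implicit Types w : 'M[R]_(n, 4).

Lemma cos_HP_radius_gt0 w : 0 < cos (HP_radius w).
Proof. by rewrite cos_gt0_pihalf// /HP_radius atan_gtNpi2 atan_ltpi2. Qed.

Lemma cos2_HP_radius w : cos (HP_radius w) ^+ 2 = zc w.
Proof.
rewrite /HP_radius cos_atan /enorm exprVn !sqr_sqrtr ?sqnorm_ge0//.
by rewrite addr_ge0 ?sqnorm_ge0.
Qed.

Lemma sin2_HP_radius w : sin (HP_radius w) ^+ 2 = 1 - zc w.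
Proof. by rewrite -cos2_HP_radius -(cos2Dsin2 (HP_radius w)); ring. Qed.

Lemma powR_zc w (m : R) : zc w `^ (m / 2) = cos (HP_radius w) `^ m.
Proof.
rewrite -cos2_HP_radius -powR_mulrn ?(ltW (cos_HP_radius_gt0 w))// -powRrM.
by congr (_ `^ _); field.
Qed.

Lemma HP_radius_itv w : 0 <= HP_radius w < pi / 2.
Proof.
by rewrite /HP_radius atan_ltpi2 andbT -atan0 le_atan// sqrtr_ge0.
Qed.

End RadialCoordinate.

Section PolynomialExpectation.
Context {R : realType} {n : nat} {d : measure_display} {Omega : measurableType d}.
Variables (P : probability Omega R) (F : R -> set (set Omega)) (w : R -> Omega -> 'M[R]_(n, 4)).
Variables (a : R -> Omega -> 'rV[R]_3) (lam : 'rV[R]_3) (theta t nu : R) (q : R -> R -> R -> R).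
Hypothesis hn : (0 < n)%N.
Hypothesis hw : HP_brownian P F w.
Hypothesis ha : HP_area P w a.
Hypotheses (t0 : 0 < t) (nu0 : 0 <= nu).
Hypothesis nuE : sqnorm lam = nu * (nu + 2).
Hypothesis J : jacobi_density (2 * n%:R - 1) (nu + 1) q.
Notation mu := (@lebesgue_measure R).
Notation I := (`[0, pi / 2]%classic : set R).
Notation alpha := (2 * n%:R - 1 : R).
Notation rho omega := (HP_radius (w t omega)).

Let n1 : 1 <= n%:R :> R. Proof. by rewrite ler1n. Qed.
Let alpha0 : 0 <= alpha. Proof. by have := n1; lra. Qed.
Let beta0 : 0 <= nu + 1. Proof. by rewrite addr_ge0. Qed.

Lemma measurable_HP_radius : measurable_fun setT (fun omega => rho omega).
Proof.
apply: (@measurableT_comp _ _ _ _ _ _ (@atan R)).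
  by apply: continuous_measurable_fun; exact: continuous_atan.
rewrite (_ : (fun _ => _) = (fun omega => sqnorm (w t omega) `^ 2^-1)); last first.
  by apply/funext => omega; rewrite powR12_sqrt// sqnorm_ge0.
apply: (@measurableT_comp _ _ _ _ _ _ (fun x : R => x `^ 2^-1)); first exact: measurable_powR.
by apply: measurable_sqnorm; apply: (HP_brownian_measurable hw); exact: ltW.
Qed.

Let sin01 (x : R) : 0 <= sin x ^+ 2 <= 1.
Proof. by rewrite sqr_ge0 -(cos2Dsin2 x) lerDr sqr_ge0. Qed.

Let f1 omega := cos (theta + dot3 lam (a t omega)) * cos (rho omega) `^ nu.
Let f2 r := expR (- (2 * n%:R * nu * t)) * cos theta * q t 0 r.

Lemma area_expectation_jac m :
  \int[P]_omega (f1 omega * (jac alpha (nu + 1) m).[sin (rho omega) ^+ 2]) =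
  expR (- ((jac_rate alpha (nu + 1) m + 2 * n%:R * nu) * t)) * cos theta.
Proof.
pose p := jac alpha (nu + 1) m; pose Q := p \Po (1 - 'X); pose b := nu / 2.
have b2 : 2 * b = nu by rewrite /b mulrC mulfVK.
have hQ (z : R) : Q.[z] = p.[1 - z].
  by rewrite /Q horner_comp hornerD hornerN hornerX hornerC.
have kE : 4 * n%:R * b = 2 * n%:R * nu by rewrite -b2; ring.
have k0 : 0 <= jac_rate alpha (nu + 1) m + 4 * n%:R * b.
  by rewrite kE addr_ge0 ?jac_rate_ge0// !mulr_ge0.
have bound z : 0 < z <= 1 -> `|twisted b Q z| <= jac_bound alpha (nu + 1) m.
  move=> /andP[z0 z1]; rewrite /twisted normrM hQ -[leRHS]mul1r ler_pM//.
    rewrite ger0_norm ?powR_ge0// -[leRHS](powRr0 z).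
    by apply: ger_powR; rewrite ?z0//; rewrite divr_ge0.
  by apply: jac_le => //; rewrite subr_ge0 z1 lerBlDr lerDl ltW.
have ode (z : R) (z0 : 0 < z) := @twisted_ode R n b (sqnorm lam) (jac_rate alpha (nu + 1) m) z p z0.
have := @area_expectation R n d Omega P F w a lam theta _ _ t (twisted b Q) _ _
  hw ha t0 k0 bound (measurable_twisted b Q) (smooth_on_twisted b Q)
  (fun z z0 => is_derive_twisted b Q z0) (fun z z0 => is_derive_twisted2 b Q z0)
  (fun z z0 => ode z z0 _ _).
have -> : twisted b Q 1 = 1 by rewrite /twisted powR1 mul1r hQ subrr horner_jac0.
rewrite kE mulr1 => <-.
- apply: eq_Rintegral => omega _; rewrite /f1 /twisted powR_zc hQ sin2_HP_radius.
  by rewrite mulrA.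
- by rewrite b2 nuE.
- by rewrite b2 jacL_jac.
Qed.

Let mI : measurable I. Proof. exact: measurable_itv. Qed.
Let zI : (0 : R) \in `[0, pi / 2]%R.
Proof. by rewrite in_itv /= lexx ltW// pihalf_gt0. Qed.

Let mf1 : measurable_fun setT f1.
Proof.
apply: measurable_funM.
  apply: (@measurableT_comp _ _ _ _ _ _ (@cos R)).
    exact: continuous_measurable_fun (@continuous_cos R).
  by apply: measurable_funD => //; exact: (measurable_dot3 lam ha t0).
apply: (@measurableT_comp _ _ _ _ _ _ (fun x : R => x `^ nu)); first exact: measurable_powR.
apply: (@measurableT_comp _ _ _ _ _ _ (@cos R)); last exact: measurable_HP_radius.
exact: continuous_measurable_fun (@continuous_cos R).
Qed.

Let f1_le omega : `|f1 omega| <= 1.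
Proof.
rewrite normrM -[leRHS]mul1r ler_pM//; first by rewrite ler_norml cos_geN1 cos_le1.
rewrite ger0_norm ?powR_ge0// -[leRHS](powRr0 (cos (rho omega))).
by apply: ger_powR; rewrite ?cos_HP_radius_gt0 ?cos_le1.
Qed.

Let if1 : P.-integrable setT (EFin \o f1).
Proof. exact: bounded_integrable mf1 f1_le. Qed.

Let if2 : mu.-integrable I (EFin \o f2).
Proof.
have h := @integrableZl _ _ R mu _ mI (expR (- (2 * n%:R * nu * t)) * cos theta) _
  (density_integrable J t0 zI).
by apply: eq_integrable h => // y _.
Qed.

Let ms1 : measurable_fun setT (fun omega => sin (rho omega) ^+ 2).
Proof.
apply: (@measurableT_comp _ _ _ _ _ _ (fun x : R => sin x ^+ 2)); last exact: measurable_HP_radius.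
exact: continuous_measurable_fun (@continuous_sin2 R).
Qed.

Let ms2 : measurable_fun I (fun r : R => sin r ^+ 2).
Proof. by apply: measurable_funTS; apply: continuous_measurable_fun; exact: continuous_sin2. Qed.

Let bounded_poly (p : {poly R}) : exists B, forall y : R, 0 <= y <= 1 -> `|p.[y]| <= B.
Proof.
have chn : {within `[0, 1]%classic, continuous (fun y : R => `|p.[y]|)}.
  apply: continuous_subspaceT => y.
  have h := @continuous_comp _ _ _ (fun y : R => p.[y]) (fun z : R => `|z|) y
    (@continuous_horner R p y) (@norm_continuous _ _ _).
  exact: h.
have [c _ hc] := EVT_max (@ler01 R) chn.
by exists `|p.[c]| => y y01; apply: hc; rewrite in_itv.
Qed.

Lemma area_expectation_poly (p : {poly R}) :
  \int[P]_omega (f1 omega * p.[sin (rho omega) ^+ 2]) =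
  \int[mu]_(r in I) (f2 r * p.[sin r ^+ 2]).
Proof.
have i1 (p' : {poly R}) : P.-integrable setT (EFin \o (fun omega => f1 omega * p'.[sin (rho omega) ^+ 2])).
  have [B hB] := bounded_poly p'.
  apply: (@integrable_mul_bounded R _ _ P setT _ _ B measurableT if1).
    by apply: measurableT_comp => //; exact: continuous_measurable_fun (@continuous_horner R p').
  by move=> omega _; apply: hB.
have i2 (p' : {poly R}) : mu.-integrable I (EFin \o (fun r => f2 r * p'.[sin r ^+ 2])).
  have [B hB] := bounded_poly p'.
  apply: (@integrable_mul_bounded R _ _ mu I _ _ B mI if2).
    by apply: measurableT_comp => //; exact: continuous_measurable_fun (@continuous_horner R p').
  by move=> r _; apply: hB.
apply: (@jac_span R alpha (nu + 1) alpha0 beta0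
  (fun p => \int[P]_omega (f1 omega * p.[sin (rho omega) ^+ 2]))
  (fun p => \int[mu]_(r in I) (f2 r * p.[sin r ^+ 2]))).
- move=> c p1 p2.
  have i3 : P.-integrable setT (EFin \o (fun omega => c * (f1 omega * p1.[sin (rho omega) ^+ 2]))).
    have h1 := @integrableZl _ _ R P _ measurableT c _ (i1 p1).
    by apply: eq_integrable h1 => // y _.
  rewrite -(@RintegralZl _ _ R P)// -(@RintegralD _ _ R P)//.
  by apply: eq_Rintegral => r _; rewrite hornerD hornerZ; ring.
- move=> c p1 p2.
  have i3 : mu.-integrable I (EFin \o (fun r => c * (f2 r * p1.[sin r ^+ 2]))).
    have h1 := @integrableZl _ _ R mu _ mI c _ (i2 p1).
    by apply: eq_integrable h1 => // y _.
  rewrite -(@RintegralZl _ _ R mu)// -(@RintegralD _ _ R mu)//.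
  by apply: eq_Rintegral => r _; rewrite hornerD hornerZ; ring.
- move=> m; rewrite area_expectation_jac.
  have h := kernel_op_jac J alpha0 beta0 m t0.
  rewrite (_ : (\int[mu]_(r in I) _) = \int[mu]_(r in I) (expR (- (2 * n%:R * nu * t)) * cos theta *
      (q t 0 r * on_sin2 (jac alpha (nu + 1) m) r))); last first.
    by apply: eq_Rintegral => r _; rewrite /f2 /on_sin2 -!mulrA.
  have [B hB] := bounded_poly (jac alpha (nu + 1) m).
  have i3 : mu.-integrable I (EFin \o (fun r => q t 0 r * on_sin2 (jac alpha (nu + 1) m) r)).
    apply: (@density_mul_integrable R alpha (nu + 1) q J t 0 _ B t0 zI).
      by apply: measurable_funTS; apply: continuous_measurable_fun; exact: continuous_on_sin2.
    by move=> r _; apply: hB.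
  rewrite (@RintegralZl _ _ R mu)//.
  move: h; rewrite /kernel_op => ->.
  rewrite mulrDl opprD expRD; ring.
Qed.

Lemma area_expectation_test (g : R -> R) : continuous g ->
  \int[P]_omega (f1 omega * g (sin (rho omega) ^+ 2)) =
  \int[mu]_(r in I) (f2 r * g (sin r ^+ 2)).
Proof.
exact: (@poly_test_ext R _ _ _ _ P mu setT I measurableT mI _ _ _ _ if1 if2 ms1 ms2
  (fun _ _ => sin01 _) (fun _ _ => sin01 _) g area_expectation_poly).
Qed.

End PolynomialExpectation.

Section RayTest.
Context {R : realType}.

(* The floor under [1 - y] is only reached where [ray] vanishes.              *)
Definition ray_test (nu c : R) (N : nat) (y : R) : R :=
  ray c N y * Num.max N.+1%:R^-1 (1 - y) `^ (- (nu / 2)).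

Lemma continuous_ray_test nu c N : continuous (ray_test nu c N).
Proof.
move=> y.
have h1 : {for y, continuous (fun y : R => 1 - y)}.
  by apply: continuousB; [exact: cst_continuous|exact: id].
have h2 : {for y, continuous (fun y : R => Num.max N.+1%:R^-1 (1 - y))}.
  by apply: (@continuous_max _ _ (fun=> N.+1%:R^-1) _ y _ h1); exact: cst_continuous.
have h3 : {for (Num.max N.+1%:R^-1 (1 - y)), continuous (fun x : R => x `^ (- (nu / 2)))}.
  apply: differentiable_continuous; apply/derivable1_diffP.
  by have [] := @is_derive1_powR R (- (nu / 2)) (Num.max N.+1%:R^-1 (1 - y)) _; rewrite ?lt_max ?invr_gt0 ?ltr0n.
have h4 := @continuous_comp _ _ _ (fun y : R => Num.max N.+1%:R^-1 (1 - y))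
  (fun x : R => x `^ (- (nu / 2))) y h2 h3.
have h5 := continuousM (@continuous_ray R c N y) h4; exact: h5.
Qed.

Lemma ray_test_cos nu c N (r : R) : 0 <= r < pi / 2 ->
  ray_test nu c N (sin r ^+ 2) = (cos r `^ nu)^-1 * ray c N (sin r ^+ 2).
Proof.
move=> /andP[r0 r1]; rewrite /ray_test.
have c0 : 0 < cos r.
  by rewrite cos_gt0_pihalf// r1 andbT (lt_le_trans _ r0)// oppr_lt0 pihalf_gt0.
have [h|h] := leP (1 - N.+1%:R^-1) (sin r ^+ 2); first by rewrite ray_eq0// mul0r mulr0.
have cE : 1 - sin r ^+ 2 = cos r ^+ 2 by rewrite -(cos2Dsin2 r); ring.
have -> : Num.max N.+1%:R^-1 (1 - sin r ^+ 2) = cos r ^+ 2.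
  rewrite -cE; apply/max_idPr; move: (N.+1%:R^-1) h => v h; lra.
rewrite mulrC -powRN -powR_mulrn ?(ltW c0)// -powRrM; congr (_ `^ _ * _).
by field.
Qed.

End RayTest.

Section Conclusion.
Context {R : realType} {n : nat} {d : measure_display} {Omega : measurableType d}.
Variables (P : probability Omega R) (F : R -> set (set Omega)) (w : R -> Omega -> 'M[R]_(n, 4)).
Variables (a : R -> Omega -> 'rV[R]_3) (lam : 'rV[R]_3) (t nu : R) (q1 qn : R -> R -> R -> R).
Hypothesis hn : (0 < n)%N.
Hypothesis hw : HP_brownian P F w.
Hypothesis ha : HP_area P w a.
Hypotheses (t0 : 0 < t) (nu0 : 0 <= nu).
Hypothesis nuE : sqnorm lam = nu * (nu + 2).
Notation alpha := (2 * n%:R - 1 : R).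
Hypothesis J1 : jacobi_density alpha 1 q1.
Hypothesis Jn : jacobi_density alpha (nu + 1) qn.
Notation mu := (@lebesgue_measure R).
Notation I := (`[0, pi / 2]%classic : set R).
Notation D := (`[0, pi / 2[%classic : set R).
Notation rho := (fun omega => HP_radius (w t omega)).
Notation X := (fun omega => dot3 lam (a t omega)).

Let alpha0 : 0 <= alpha.
Proof. have : 1 <= n%:R :> R by rewrite ler1n. lra. Qed.
Let nu1 : 0 <= nu + 1. Proof. by rewrite addr_ge0. Qed.
Let mI : measurable I. Proof. exact: measurable_itv. Qed.
Let mD : measurable D. Proof. exact: measurable_itv. Qed.
Let DI : D `<=` I.
Proof. by move=> x; rewrite /= !in_itv /= => /andP[-> /ltW ->]. Qed.
Let zI : (0 : R) \in `[0, pi / 2]%R.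
Proof. by rewrite in_itv /= lexx ltW// pihalf_gt0. Qed.

Definition bridge_factor (r : R) : R := expR (- (2 * n%:R * nu * t)) / (cos r `^ nu).
Notation psi := bridge_factor.
Notation h1 := (q1 t 0).
Notation hb := (qn t 0).

Let mrho : measurable_fun setT rho := measurable_HP_radius hw t0.

Let iI (f : R -> R) : mu.-integrable I (EFin \o f) ->
  (\int[mu]_(r in D) (f r)%:E = (\int[mu]_(r in I) f r)%:E)%E.
Proof.
move=> fi; rewrite integral_itv_bndo_bndc.
  by rewrite /Rintegral fineK//; exact: integrable_fin_num.
have h := @integrableS _ _ R mu _ _ _ mI mD DI fi.
exact: measurable_int h.
Qed.

Lemma rays_eq (kappa theta c : R) N :
  (\int[P]_(omega in setT) ((1 + kappa * cos (theta + X omega)) * ray c N (sin (rho omega) ^+ 2))%:E =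
   \int[mu]_(r in D) ((h1 r + kappa * cos theta * (psi r * hb r)) * ray c N (sin r ^+ 2))%:E)%E.
Proof.
have J1' : jacobi_density alpha (0 + 1) q1 by rewrite add0r.
have s0 : sqnorm (0 : 'rV[R]_3) = 0 * (0 + 2).
  by rewrite mul0r /sqnorm big1// => i _; rewrite big1// => j _; rewrite mxE expr0n.
have E1 := @area_expectation_test R n d Omega P F w a 0 0 t 0 q1 hn hw ha t0 (lexx 0) s0 J1'
  (ray c N) (@continuous_ray R c N).
have E2 := @area_expectation_test R n d Omega P F w a lam theta t nu qn hn hw ha t0 nu0 nuE Jn
  (ray_test nu c N) (@continuous_ray_test R nu c N).
pose A omega := cos (theta + X omega) * ray c N (sin (rho omega) ^+ 2).
pose A1 omega := ray c N (sin (rho omega) ^+ 2).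
have mray : measurable_fun setT (ray c N).
  exact: continuous_measurable_fun (@continuous_ray R c N).
have ms2 : measurable_fun setT (fun x : R => sin x ^+ 2).
  exact: continuous_measurable_fun (@continuous_sin2 R).
have mA1 : measurable_fun setT A1.
  apply: (@measurableT_comp _ _ _ _ _ _ (ray c N)) => //.
  exact: (@measurableT_comp _ _ _ _ _ _ (fun x : R => sin x ^+ 2)).
have mcos : measurable_fun setT (fun omega => cos (theta + X omega)).
  apply: (@measurableT_comp _ _ _ _ _ _ (@cos R)).
    exact: continuous_measurable_fun (@continuous_cos R).
  by apply: measurable_funD => //; exact: (measurable_dot3 lam ha t0).
have bray y : `|ray c N y| <= 1 by rewrite ger0_norm ?ray_ge0 ?ray_le1.
have iA1 : P.-integrable setT (EFin \o A1).
  exact: bounded_integrable mA1 (fun omega => bray _).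
have iA : P.-integrable setT (EFin \o A).
  apply: (@bounded_integrable _ _ _ P A 1); first exact: measurable_funM.
  by move=> omega; rewrite normrM -[leRHS]mul1r ler_pM// ler_norml cos_geN1 cos_le1.
have ikA : P.-integrable setT (EFin \o (fun omega => kappa * A omega)).
  have h := @integrableZl _ _ R P _ measurableT kappa _ iA.
  by apply: eq_integrable h => // y _.
have -> : (\int[P]_(omega in setT) ((1 + kappa * cos (theta + X omega)) * ray c N (sin (rho omega) ^+ 2))%:E =
    (\int[P]_omega A1 omega + kappa * \int[P]_omega A omega)%:E)%E.
  rewrite -(@RintegralZl _ _ R P)// -(@RintegralD _ _ R P)// /Rintegral fineK; last first.
    apply: integrable_fin_num => //; have h := @integrableD _ _ R P _ measurableT _ _ iA1 ikA.
    by apply: eq_integrable h => // y _.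
  by apply: eq_integral => omega _; congr EFin; rewrite /A1 /A; ring.
have mcr (f : R -> R) : continuous f -> measurable_fun I (fun r => f (sin r ^+ 2)).
  move=> cf; apply: measurable_funTS.
  apply: (@measurableT_comp _ _ _ _ _ _ f); first exact: continuous_measurable_fun.
  exact: continuous_measurable_fun (@continuous_sin2 R).
have i1 : mu.-integrable I (EFin \o (fun r => h1 r * ray c N (sin r ^+ 2))).
  apply: (@density_mul_integrable R alpha 1 q1 J1 t 0 _ 1 t0 zI) => //.
  exact: mcr (@continuous_ray R c N).
have [B _ hB] : exists2 B, 0 <= B & forall y, I y -> `|ray_test nu c N (sin y ^+ 2)| <= B.
  apply: within_bounded; apply: continuous_subspaceT => x.
  have hc := @continuous_comp _ _ _ (fun x : R => sin x ^+ 2) (ray_test nu c N) x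
    (@continuous_sin2 R x) (@continuous_ray_test R nu c N _).
  exact: hc.
have i2 : mu.-integrable I (EFin \o (fun r => hb r * ray_test nu c N (sin r ^+ 2))).
  apply: (@density_mul_integrable R alpha (nu + 1) qn Jn t 0 _ B t0 zI) => //.
  exact: mcr (@continuous_ray_test R nu c N).
pose e := kappa * (expR (- (2 * n%:R * nu * t)) * cos theta).
have i3 : mu.-integrable I (EFin \o (fun r => e * (hb r * ray_test nu c N (sin r ^+ 2)))).
  have h := @integrableZl _ _ R mu _ mI e _ i2.
  by apply: eq_integrable h => // y _.
have i4 : mu.-integrable I (EFin \o (fun r => h1 r * ray c N (sin r ^+ 2) +
    e * (hb r * ray_test nu c N (sin r ^+ 2)))).
  have h := @integrableD _ _ R mu _ mI _ _ i1 i3.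
  by apply: eq_integrable h => // y _.
have -> : (\int[mu]_(r in D) ((h1 r + kappa * cos theta * (psi r * hb r)) * ray c N (sin r ^+ 2))%:E =
    \int[mu]_(r in D) (h1 r * ray c N (sin r ^+ 2) + e * (hb r * ray_test nu c N (sin r ^+ 2)))%:E)%E.
  apply: eq_integral => r /set_mem; rewrite /= in_itv /= => rD.
  by rewrite ray_test_cos// /psi /e; congr EFin; ring.
rewrite (iI i4) (@RintegralD _ _ R mu)// (@RintegralZl _ _ R mu)//.
congr (EFin (_ + _)).
- rewrite (_ : (\int[P]_omega A1 omega) = \int[P]_omega (cos (0 + dot3 0 (a t omega)) *
      cos (rho omega) `^ 0 * ray c N (sin (rho omega) ^+ 2))); last first.
    apply: eq_Rintegral => omega _; rewrite powRr0 mulr1 add0r.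
    by rewrite (_ : dot3 0 _ = 0) ?cos0 ?mul1r// /dot3 big1// => i _; rewrite mxE mul0r.
  rewrite E1; apply: eq_Rintegral => r _; rewrite mulr0 mul0r oppr0 expR0 cos0; ring.
- rewrite /e -mulrA; congr (_ * _).
  rewrite -(@RintegralZl _ _ R mu)//.
  rewrite (_ : (\int[P]_omega A omega) = \int[P]_omega (cos (theta + dot3 lam (a t omega)) *
      cos (rho omega) `^ nu * ray_test nu c N (sin (rho omega) ^+ 2))); last first.
    apply: eq_Rintegral => omega _; rewrite /A ray_test_cos ?HP_radius_itv//.
    rewrite -!mulrA mulVKf// gt_eqF// powR_gt0// cos_HP_radius_gt0//.
  by rewrite E2; apply: eq_Rintegral => r _; ring.
Qed.

Let mX : measurable_fun setT X := measurable_dot3 lam ha t0.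

Let mcosX theta : measurable_fun setT (fun omega => cos (theta + X omega)).
Proof.
apply: (@measurableT_comp _ _ _ _ _ _ (@cos R)); last exact: measurable_funD.
exact: continuous_measurable_fun (@continuous_cos R).
Qed.

Let mh1 : measurable_fun D h1.
Proof. exact: measurable_funS mI DI (jd_measurable J1 t0 zI). Qed.

Let mhb : measurable_fun D hb.
Proof. exact: measurable_funS mI DI (jd_measurable Jn t0 zI). Qed.

Let h1_ge0 r : D r -> 0 <= h1 r.
Proof. by move=> /DI rI; exact: (jd_ge0 J1 t0 zI). Qed.

Let hb_ge0 r : D r -> 0 <= hb r.
Proof. by move=> /DI rI; exact: (jd_ge0 Jn t0 zI). Qed.

Let psi_ge0 r : 0 <= psi r.
Proof. by rewrite divr_ge0 ?expR_ge0 ?powR_ge0. Qed.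

Let mpsi : measurable_fun setT psi.
Proof.
rewrite (_ : psi = fun r => expR (- (2 * n%:R * nu * t)) * cos r `^ (- nu)); last first.
  by apply/funext => r; rewrite powRN.
apply: measurable_funM => //.
apply: (@measurableT_comp _ _ _ _ _ _ (fun x : R => x `^ (- nu))); first exact: measurable_powR.
exact: continuous_measurable_fun (@continuous_cos R).
Qed.

Let mpsihb : measurable_fun D (fun r => psi r * hb r).
Proof. by apply: measurable_funM => //; exact: measurable_funTS. Qed.

Let psihb_ge0 r : D r -> 0 <= psi r * hb r.
Proof. by move=> rD; rewrite mulr_ge0 ?hb_ge0. Qed.

Lemma joint_law (kappa theta : R) (B : set R) : 0 <= kappa <= 1 -> 0 <= cos theta ->
  measurable B ->
  (\int[P]_(omega in rho @^-1` B) (1 + kappa * cos (theta + X omega))%:E =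
   \int[mu]_(r in D `&` B) (h1 r + kappa * cos theta * (psi r * hb r))%:E)%E.
Proof.
move=> /andP[k0 k1] c0 mB.
have f1_ge0 omega : 0 <= 1 + kappa * cos (theta + X omega) <= 2.
  have /andP[l u] : -1 <= cos (theta + X omega) <= 1 by rewrite cos_geN1 cos_le1.
  have kl : -1 <= kappa * cos (theta + X omega) by nra.
  have ku : kappa * cos (theta + X omega) <= 1 by nra.
  by apply/andP; split; lra.
have mf1 : measurable_fun setT (fun omega => 1 + kappa * cos (theta + X omega)).
  by apply: measurable_funD => //; apply: measurable_funM.
rewrite -[rho @^-1` B]setTI.
apply: (@integral_preimage_eq R _ _ _ _ P mu setT D measurableT mD
  (fun omega => 1 + kappa * cos (theta + X omega)) rho
  (fun r => h1 r + kappa * cos theta * (psi r * hb r)) id) => //.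
- by apply: measurable_funD => //; apply: measurable_funM.
- by move=> omega _; have /andP[] := f1_ge0 omega.
- by move=> r rD; rewrite addr_ge0 ?h1_ge0// mulr_ge0 ?psihb_ge0// mulr_ge0.
- by move=> omega _; exact: HP_radius_itv.
- apply: (@le_lt_trans _ _ (\int[P]_(omega in setT) (cst 2%:E omega))%E).
    apply: ge0_le_integral => //.
    + by move=> omega _; rewrite lee_fin; have /andP[] := f1_ge0 omega.
    + exact/measurable_EFinP.
    + by move=> omega _; rewrite lee_fin; have /andP[] := f1_ge0 omega.
  have PT : P setT = 1%E := probability_setT P.
  by rewrite integral_cst//= PT mule1 ltry.
- by move=> c N; exact: rays_eq.
Qed.

Lemma radius_law (B : set R) : measurable B ->
  (\int[P]_(omega in rho @^-1` B) (1 : R)%:E = \int[mu]_(r in D `&` B) (h1 r)%:E)%E.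
Proof.
move=> mB; have := @joint_law 0 0 B; rewrite lexx ler01 cos0 => /(_ isT ler01 mB) E.
rewrite (eq_integral (fun omega => (1 + 0 * cos (0 + X omega))%:E)) ?E; last first.
  by move=> omega _; rewrite mul0r addr0.
by apply: eq_integral => r _; rewrite !mul0r addr0.
Qed.

Let preimage_measurable (B : set R) : measurable B -> measurable (rho @^-1` B).
Proof. by move=> mB; rewrite -[X in measurable X]setTI; exact: mrho. Qed.

Let fin_radius (B : set R) : measurable B -> (\int[mu]_(r in D `&` B) (h1 r)%:E \is a fin_num)%E.
Proof.
move=> mB; rewrite -radius_law// integral_cst ?mul1e; last exact: preimage_measurable.
by rewrite fin_num_measure//; exact: preimage_measurable.
Qed.

Lemma cos_law (theta : R) (B : set R) : 0 <= cos theta -> measurable B ->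
  (\int[P]_(omega in rho @^-1` B) (cos (theta + X omega))%:E =
   \int[mu]_(r in D `&` B) (cos theta * (psi r * hb r))%:E)%E.
Proof.
move=> c0 mB; have := @joint_law 1 theta B; rewrite ler01 lexx => /(_ isT c0 mB).
have mrB := preimage_measurable mB.
have ic : P.-integrable (rho @^-1` B) (EFin \o (fun omega => cos (theta + X omega))).
  apply: (@integrableS _ _ R P setT) => //.
  by apply: (@bounded_integrable _ _ _ P _ 1) => // omega; rewrite ler_norml cos_geN1 cos_le1.
have i1 : P.-integrable (rho @^-1` B) (EFin \o cst (1 : R)).
  by apply: (@integrableS _ _ R P setT) => //; exact: finite_measure_integrable_cst.
have -> : (\int[P]_(omega in rho @^-1` B) (1 + 1 * cos (theta + X omega))%:E =
    \int[P]_(omega in rho @^-1` B) (1 : R)%:E +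
    \int[P]_(omega in rho @^-1` B) (cos (theta + X omega))%:E)%E.
  rewrite -(@integralD _ _ R P _ mrB _ _ i1 ic); apply: eq_integral => omega _.
  by rewrite mul1r EFinD.
have mDB : measurable (D `&` B) by exact: measurableI.
have -> : (\int[mu]_(r in D `&` B) (h1 r + 1 * cos theta * (psi r * hb r))%:E =
    \int[mu]_(r in D `&` B) (h1 r)%:E + \int[mu]_(r in D `&` B) (cos theta * (psi r * hb r))%:E)%E.
  rewrite -ge0_integralD//.
  - by apply: eq_integral => r _; rewrite mul1r EFinD.
  - by move=> r [rD _]; rewrite lee_fin h1_ge0.
  - by apply/measurable_EFinP; apply: (measurable_funS mD _ mh1); exact: subIsetl.
  - by move=> r [rD _]; rewrite lee_fin mulr_ge0 ?psihb_ge0.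
  - apply/measurable_EFinP; apply: measurable_funM => //.
    by apply: (measurable_funS mD _ mpsihb); exact: subIsetl.
rewrite (radius_law mB) ![(integral mu (D `&` B) (fun r => (h1 r)%:E) + _)%E]addeC.
move=> /(congr1 (fun z => z - \int[mu]_(r in D `&` B) (h1 r)%:E)%E).
by rewrite !addeK// fin_radius.
Qed.

Notation ratio := (fun r => hb r / h1 r).

Lemma ratio_cvg : exists2 L : R, 0 <= L & ratio r @[r --> 0^'+] --> L.
Proof.
have [H1 [cH1 H10 E1]] := heat_kernel J1 alpha0 ler01 t0.
have [Hb [cHb Hb0 Eb]] := heat_kernel Jn alpha0 nu1 t0.
have c2 : {for 0, continuous (fun r : R => cos r `^ (2 * nu))}.
  have hd : {for cos (0 : R), continuous (fun x : R => x `^ (2 * nu))}.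
    apply: differentiable_continuous; apply/derivable1_diffP.
    by have [] := @is_derive1_powR R (2 * nu) (cos 0) _; rewrite ?cos0.
  exact: (@continuous_comp _ _ _ (@cos R) (fun x : R => x `^ (2 * nu)) 0 (@continuous_cos R 0) hd).
exists (Hb 0 / H1 0); first by rewrite divr_ge0// ltW.
have H1n : H1 0 != 0 by rewrite gt_eqF.
have lim : (Hb r * (H1 r)^-1 * cos r `^ (2 * nu)) @[r --> 0^'+] --> Hb 0 / H1 0.
  apply: cvg_at_right_filter.
  have h : Hb r * (H1 r)^-1 * cos r `^ (2 * nu) @[r --> (0 : R)] -->
      Hb 0 / H1 0 * cos 0 `^ (2 * nu).
    exact: continuousM (continuousM (cHb 0) (continuousV H1n (cH1 0))) c2.
  by rewrite cos0 powR1 mulr1 in h.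
apply: cvg_trans lim; apply: near_eq_cvg; near=> r.
have r0 : 0 < r < pi / 2.
  apply/andP; split; near: r; [exact: nbhs_right_gt|apply: nbhs_right_lt; exact: pihalf_gt0].
have s0 := sin_gt0_pihalf r0; have c0 := cos_gt0_pihalf' r0.
rewrite (Eb r r0) (E1 r r0) /jac_weight !gtr0_norm//.
have -> : cos r `^ (2 * (nu + 1) + 1) = cos r `^ (2 * nu) * cos r `^ (2 * 1 + 1).
  by rewrite -powRD ?(gt_eqF c0) ?implybT//; congr (_ `^ _); ring.
have S0 : 0 < sin r `^ (2 * alpha + 1) by exact: powR_gt0.
have K0 : 0 < cos r `^ (2 * 1 + 1) by exact: powR_gt0.
rewrite !invfM; move: (_ `^ _) (_ `^ _) S0 K0 (cos r `^ _) ((H1 r)^-1) => S K S0 K0 C x.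
by field; rewrite !gt_eqF.
Unshelve. all: by end_near. Qed.

Notation g0 := (fun r => psi r * extend0 ratio r).

Lemma measurable_bridge : measurable_fun D g0.
Proof.
apply: measurable_funM; first exact: measurable_funTS.
pose L := lim (ratio r @[r --> 0^'+]).
apply: (eq_measurable_fun (fun r => hb r * h1 r `^ (-1) + (L - ratio 0) * \1_[set 0] r)).
  move=> r /set_mem rD; rewrite /extend0 powR_inv1 ?h1_ge0// indicE.
  have [->|r0] := eqVneq r 0; first by rewrite mem_set// mulr1 addrC subrK.
  by rewrite memNset ?mulr0 ?addr0//= => /eqP; rewrite (negbTE r0).
apply: measurable_funD.
  apply: measurable_funM => //.
  apply: (@measurableT_comp _ _ _ _ _ _ (fun x : R => x `^ (-1))); [exact: measurable_powR|exact: mh1].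
apply: measurable_funM => //; apply: measurable_funTS; exact: measurable_indic.
Qed.

Lemma bridge_ge0 r : D r -> 0 <= g0 r.
Proof.
move=> rD; rewrite mulr_ge0 ?psi_ge0// /extend0; case: ifP => _.
  by have [L L0 hL] := ratio_cvg; rewrite (cvg_lim _ hL).
by rewrite divr_ge0 ?hb_ge0 ?h1_ge0.
Qed.

Let ih1g0 (B : set R) : measurable B ->
  (\int[mu]_(r in D `&` B) (h1 r * g0 r)%:E =
   \int[mu]_(r in D `&` B) (psi r * hb r)%:E)%E.
Proof.
move=> mB; have mDB : measurable (D `&` B) by exact: measurableI.
pose Z := D `&` h1 @^-1` [set 0].
have mZ : measurable Z by exact: mh1.
have DZ : D `&` Z = Z by rewrite setIA setIid.
have PZ : P (rho @^-1` Z) = 0%E.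
  have := radius_law mZ; rewrite integral_cst; last exact: preimage_measurable.
  rewrite mul1e => ->; rewrite DZ; rewrite (eq_integral (cst 0%E)) ?integral0//.
  by move=> r /set_mem [_ /= ->].
have iZ : (\int[mu]_(r in Z) (psi r * hb r)%:E = 0)%E.
  have := @cos_law 0 Z; rewrite cos0 ler01 => /(_ isT mZ).
  rewrite null_set_integral//; last 2 first.
  - exact: preimage_measurable.
  - by apply: measurable_funTS; apply/measurable_EFinP; exact: mcosX.
  rewrite DZ => ->; apply: eq_integral => r _; by rewrite mul1r.
have mpZ : measurable_fun Z (fun r => (psi r * hb r)%:E).
  by apply/measurable_EFinP; apply: (measurable_funS mD _ mpsihb); exact: subIsetl.
have aeZ : ae_eq mu Z (fun r => (psi r * hb r)%:E) (cst 0%E).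
  apply/ae_eq_integral_abs => //; rewrite -[RHS]iZ; apply: eq_integral => r /set_mem [rD _].
  by rewrite gee0_abs// lee_fin psihb_ge0.
have ae0 : {ae mu, forall r : R, r <> 0}.
  exists [set 0]; split; [exact: measurable_set1|exact: lebesgue_measure_set1|].
  by move=> r /= /contrapT.
apply: ge0_ae_eq_integral => //.
- apply/measurable_EFinP; apply: (measurable_funS mD); first exact: subIsetl.
  by apply: measurable_funM => //; exact: measurable_bridge.
- by apply/measurable_EFinP; apply: (measurable_funS mD _ mpsihb); exact: subIsetl.
- by move=> r [rD _]; rewrite lee_fin mulr_ge0 ?h1_ge0 ?bridge_ge0.
- by move=> r [rD _]; rewrite lee_fin psihb_ge0.
- apply: filterS2 aeZ ae0 => r hZ r0 [rD rB]; congr EFin.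
  have [hz|hz] := eqVneq (h1 r) 0.
    by rewrite hz mul0r; have := hZ (conj rD hz) => -[->].
  rewrite /extend0 (negbTE (introN eqP r0)) mulrCA; congr (_ * _).
  by rewrite mulrC mulfVK.
Qed.

Lemma bridge_integral (B : set R) : measurable B ->
  (\int[P]_(omega in rho @^-1` B) (g0 (rho omega))%:E =
   \int[mu]_(r in D `&` B) (psi r * hb r)%:E)%E.
Proof.
move=> mB; rewrite -ih1g0//; have mDB : measurable (D `&` B) by exact: measurableI.
pose g := g0 \_ (D `&` B).
have mg : measurable_fun setT g.
  apply/(measurable_restrictT _ mDB).
  by apply: (measurable_funS mD _ measurable_bridge); exact: subIsetl.
have g_ge0 r : 0 <= g r.
  by rewrite /g patchE; case: ifP => // /set_mem [rD _]; exact: bridge_ge0.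
have midD : measurable_fun D (@id R) by [].
have := @integral_weight_comp R _ _ _ _ P mu setT D measurableT mD (cst 1) rho h1 id
  (measurable_cst _) mh1 (fun _ _ => ler01) h1_ge0 mrho midD _ g mg g_ge0.
move=> E; rewrite integral_mkcond [RHS]integral_mkcondr.
rewrite (eq_integral (fun omega => (cst 1 omega * g (rho omega))%:E)); last first.
  move=> omega _; rewrite patchE /g patchE mul1r.
  have rD : D (rho omega) by rewrite /= in_itv /= HP_radius_itv.
  have [oB|oB] := pselect (B (rho omega)); first by rewrite !mem_set.
  by rewrite !memNset// => -[].
rewrite E.
- apply: eq_integral => r /set_mem rD; rewrite patchE /g patchE.
  have [rB|rB] := pselect (B r); first by rewrite !mem_set.
  by rewrite !memNset ?mulr0// => -[].
- move=> C mC; rewrite setTI; exact: radius_law.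
Qed.

Lemma bridge_integrable : P.-integrable setT (EFin \o (g0 \o rho)).
Proof.
apply/integrableP; split.
  apply/measurable_EFinP => _ C mC; rewrite setTI.
  have := measurable_bridge mD mC => mg.
  rewrite (_ : (g0 \o rho) @^-1` C = rho @^-1` (D `&` g0 @^-1` C)).
    exact: preimage_measurable.
  apply/seteqP; split=> omega /=; last by case.
  by move=> h; split=> //; rewrite in_itv /= HP_radius_itv.
rewrite (eq_integral (fun omega => (g0 (rho omega))%:E)); last first.
  by move=> omega _; rewrite /= ger0_norm// bridge_ge0//= in_itv /= HP_radius_itv.
have := @bridge_integral setT measurableT; rewrite preimage_setT => ->.
have := @cos_law 0 setT; rewrite cos0 ler01 => /(_ isT measurableT).
rewrite preimage_setT (_ : (\int[mu]_(r in D `&` setT) (1 * (psi r * hb r))%:E =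
   \int[mu]_(r in D `&` setT) (psi r * hb r)%:E)%E) => [<-|]; last first.
  by apply: eq_integral => r _; rewrite mul1r.
have ic : P.-integrable setT (EFin \o (fun omega => cos (0 + X omega))).
  by apply: (@bounded_integrable _ _ _ P _ 1) => // omega; rewrite ler_norml cos_geN1 cos_le1.
have := integrable_fin_num measurableT ic; rewrite fin_numElt => /andP[_]; exact.
Qed.

Lemma area_cond_expectation :
  cvg (ratio r @[r --> 0^'+]) /\
  ccond_expectation P (fun omega => expi (X omega)) rho D
    (fun r => (psi r * extend0 ratio r)%:C%C).
Proof.
split; first by have [L _ hL] := ratio_cvg; apply/cvg_ex; exists L.
have rng : range rho `<=` D.
  by move=> _ [omega _ <-]; rewrite /= in_itv /= HP_radius_itv.
split; split=> //.
- exact: measurable_bridge.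
- exact: bridge_integrable.
- move=> B mB; rewrite bridge_integral//=.
  have := @cos_law 0 B; rewrite cos0 ler01 => /(_ isT mB).
  under eq_integral do rewrite add0r.
  by move=> ->; apply: eq_integral => r _; rewrite mul1r.
- rewrite (_ : EFin \o _ = cst 0%E) ?integrable0//.
- move=> B mB; rewrite [RHS](eq_integral (cst 0%E)) ?integral0//=.
  have := @cos_law (- (pi / 2)) B; rewrite cosN cos_pihalf lexx => /(_ isT mB).
  rewrite [in X in _ = X -> _](eq_integral (cst 0%E)) ?integral0 => [<-|r _]; last by rewrite mul0r.
  by apply: eq_integral => omega _; rewrite addrC cosBpihalf.
Qed.

End Conclusion.

Unset Implicit Arguments.

Theorem theorem4p6 (R : realType) (n : nat) (hn : (0 < n)%N)
  (d : measure_display) (Omega : measurableType d) (P : probability Omega R)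
  (F : R -> set (set Omega)) (w : R -> Omega -> 'M[R]_(n, 4))
  (hw : HP_brownian P F w)
  (a : R -> Omega -> 'rV[R]_3) (ha : HP_area P w a)
  (q : R -> R -> R -> R -> R -> R)
  (hq : forall alpha beta : R, -1 < alpha -> -1 < beta ->
          jacobi_density alpha beta (q alpha beta))
  (lambda : 'rV[R]_3) (hlambda : forall i, 0 <= lambda 0 i)
  (t : R) (ht : 0 < t) :
  let mu : R := Num.sqrt (enorm lambda ^+ 2 + 1) - 1 in
  let ratio (r : R) : R :=
    q (2 * n%:R - 1) (mu + 1) t 0 r / q (2 * n%:R - 1) 1 t 0 r in
  cvg (ratio r @[r --> 0^'+]) /\
  ccond_expectation P
    (fun omega => expi (dot3 lambda (a t omega)))
    (fun omega => HP_radius (w t omega))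
    `[0, pi / 2[
    (fun r => (expR (- (2 * n%:R * mu * t)) / (cos r `^ mu) *
               extend0 ratio r)%:C%C).
Proof.
move=> mu ratio.
have L0 : 0 <= enorm lambda ^+ 2 + 1 by rewrite addr_ge0 ?sqr_ge0.
have mu0 : 0 <= mu by rewrite /mu subr_ge0 -[leLHS]sqrtr1 ler_wsqrtr// lerDr sqr_ge0.
have muE : sqnorm lambda = mu * (mu + 2).
  have -> : sqnorm lambda = Num.sqrt (enorm lambda ^+ 2 + 1) ^+ 2 - 1.
    by rewrite sqr_sqrtr// addrK sqr_sqrtr// sqnorm_ge0.
  by rewrite /mu; ring.
have a0 : -1 < 2 * n%:R - 1 :> R by rewrite ltrBrDr addNr mulr_gt0// ltr0n.
have J1 := hq (2 * n%:R - 1) 1 a0 (lt_trans (ltrN10 R) ltr01).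
have Jmu := hq (2 * n%:R - 1) (mu + 1) a0 (lt_le_trans (ltrN10 R) (addr_ge0 mu0 ler01)).
exact: (area_cond_expectation hn hw ha ht mu0 muE J1 Jmu).
Qed.
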